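(* For $j\in\{0,1\}$ let $V^{[2,j]R}$ be the irreducible highest weight Ramond twisted module over the N=4 superconformal algebra with parameters $c=c^{[2]}$, $h=h^{[2,j]R}$, $s=s^{[2,j]R}$, where for $M\ge1$: $c^{[M]}=\frac{6(1-M)}M$, $h^{[M,j]R}=\frac{j^2}M+\frac1{4M}-\frac14$, $s^{[M,j]R}=\frac{2j}M$. Then: 1) $c^{[2]}=-3$; $h^{[2,0]R}=-\frac18$, $s^{[2,0]R}=0$; $h^{[2,1]R}=\frac38$, $s^{[2,1]R}=1$. 2) The characters and super-characters are $$\mathrm{ch}^{(+)}_{V^{[2,0]R}}(\tau,z)=\Big[\frac{\eta(2\tau)}{\eta(\tau)}\Big]^3\frac{\vartheta_{00}(2\tau,z)\,\vartheta_{10}(\tau,z)}{\vartheta_{10}(2\tau,z)\,\vartheta_{01}(2\tau,2z)},\qquad \mathrm{ch}^{(-)}_{V^{[2,0]R}}(\tau,z)=\Big[\frac{\eta(2\tau)}{\eta(\tau)}\Big]^3\frac{\vartheta_{01}(2\tau,z)\,\vartheta_{11}(\tau,z)}{\vartheta_{11}(2\tau,z)\,\vartheta_{01}(2\tau,2z)},$$ $$\mathrm{ch}^{(+)}_{V^{[2,1]R}}(\tau,z)=\Big[\frac{\eta(2\tau)}{\eta(\tau)}\Big]^3\frac{\vartheta_{10}(2\tau,z)\,\vartheta_{10}(\tau,z)}{\vartheta_{00}(2\tau,z)\,\vartheta_{01}(2\tau,2z)},\qquad \mathrm{ch}^{(-)}_{V^{[2,1]R}}(\tau,z)=-\Big[\frac{\eta(2\tau)}{\eta(\tau)}\Big]^3\frac{\vartheta_{11}(2\tau,z)\,\vartheta_{11}(\tau,z)}{\vartheta_{01}(2\tau,z)\,\vartheta_{01}(2\tau,2z)}.$$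 3) The leading terms (the terms of least degree in $q$) are: for $\mathrm{ch}^{(\pm)}_{V^{[2,0]R}}(\tau,z)$, $$1=q^{-\frac1{24}c^{[2]}+h^{[2,0]R}}e^{2\pi is^{[2,0]R}z},$$ and for $\mathrm{ch}^{(\pm)}_{V^{[2,1]R}}(\tau,z)$, $$q^{\frac12}e^{2\pi iz}(1\pm e^{-2\pi iz})^2=q^{-\frac1{24}c^{[2]}+h^{[2,1]R}}e^{2\pi is^{[2,1]R}z}(1\pm e^{-2\pi iz})^2.$$
   Context: Notation: $\tau$ is in the upper half plane, $q=e^{2\pi i\tau}$, $z\in\mathbf C$, $\eta(\tau)=q^{1/24}\prod_{n\ge1}(1-q^n)$. Mumford's theta functions are $\vartheta_{ab}(\tau,z)=\sum_{n\in\mathbf Z}e^{\pi i(n+\frac a2)^2\tau+2\pi i(n+\frac a2)(z+\frac b2)}$ for $a,b\in\{0,1\}$. N=4 superconformal algebra: the (small) N=4 superconformal algebra of central charge $c$ is generated by a Virasoro field $L$, primary even fields $J^0=J,J^{\pm}$ of conformal weight $1$, and primary odd fields $G^\pm,\bar G^\pm$ of conformal weight $\frac32$, with nonzero $\lambda$-brackets (with $\partial$ the derivation; besides those with $L$): $[J^0{}_\lambda J^\pm]=\pm2J^\pm$, $[J^0{}_\lambda J^0]=\frac c3\lambda$, $[J^+{}_\lambda J^-]=J^0+\frac c6\lambda$, $[J^0{}_\lambda G^\pm]=\pm G^\pm$, $[J^0{}_\lambda\bar G^\pm]=\pm\bar G^\pm$, $[J^+{}_\lambda G^-]=G^+$,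 $[J^-{}_\lambda G^+]=G^-$, $[J^+{}_\lambda\bar G^-]=-\bar G^+$, $[J^-{}_\lambda\bar G^+]=-\bar G^-$, $[G^\pm{}_\lambda\bar G^\pm]=(\partial+2\lambda)J^\pm$, $[G^\pm{}_\lambda\bar G^\mp]=L\pm\frac12\partial J^0\pm\lambda J^0+\frac c6\lambda^2$. It is the algebra obtained by quantum Hamiltonian reduction of $\widehat A(1,1)$ with respect to the lowest root vector $e_{-\theta}$. Modules: in Ramond twisted modules all modes (with $L(w)=\sum L_nw^{-n-2}$, $J(w)=\sum J_nw^{-n-1}$, $G(w)=\sum G_nw^{-n-3/2}$) are indexed by $\mathbf Z$. A highest weight module is generated by a vector $v_0$ (taken to be even) annihilated by all modes of positive index and by $J_0^+,G^+_0,\bar G^+_0$, with $L_0v_0=hv_0$, $J_0v_0=sv_0$; an irreducible highest weight module is determined by $(c,h,s)$. Characters: $\mathrm{ch}^{(+)}_V(\tau,z)=\mathrm{tr}_V\,q^{L_0-c/24}e^{2\pi izJ_0}$ and $\mathrm{ch}^{(-)}_V(\tau,z)=\mathrm{str}_V\,q^{L_0-c/24}e^{2\pi izJ_0}$, the right-hand sides being expanded in the domain $1<|e^{2\pi iz}|<|q|^{-1/2}$. *)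

(* Defs.v *)
From HB Require Import structures.
From mathcomp Require Import all_boot all_order all_algebra.
From mathcomp Require Import all_classical all_reals all_analysis.
From mathcomp Require Import finmap complex.
From mathcomp.analysis Require Import showcase.summability.

Set Implicit Arguments.
Unset Strict Implicit.
Unset Printing Implicit Defensive.

Import Order.TTheory GRing.Theory Num.Theory.
Import numFieldNormedType.Exports.

Local Open Scope classical_set_scope.
Local Open Scope complex_scope.
Local Open Scope ring_scope.

Section Functions.
Variable R : realType.
Local Notation C := R[i].

Definition cexp (z : C) : C :=
  (expR (complex.Re z))%:C * (cos (complex.Im z) +i* sin (complex.Im z)).

Definition ci : C := 0 +i* 1.
Definition cpi : C := (pi : R)%:C.

(* [expi x] is e^{2 pi i x}; with [q = expi tau], the power q^x is
   [expi (tau * x)]. *)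
Definition expi (x : C) : C := cexp (2%:R * cpi * ci * x).

(* Unconditional convergence of [\sum_i x i] to [S]: the limit is along the net
   of all finite sets of indices. [C^o] carries the topology of the norm. *)
Definition sums_to (I : choiceType) (x : I -> C) (S : C) : Prop :=
  partial_sum (x : I -> C^o) @ totally --> (S : C^o).

Definition theta (a b : nat) (tau z : C) : C :=
  summability.sum (fun n : int =>
    cexp (cpi * ci * (n%:~R + a%:R / 2%:R) ^+ 2 * tau
          + 2%:R * cpi * ci * (n%:~R + a%:R / 2%:R) * (z + b%:R / 2%:R)) : C^o).

Definition eta (tau : C) : C :=
  expi (tau / 24%:R) *
  lim ((fun N : nat => \prod_(1 <= n < N.+1) (1 - expi tau ^+ n) : C^o) @ \oo).

End Functions.

Inductive N4gen := L | J0 | Jp | Jm | Gp | Gm | Gbp | Gbm.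

Definition N4rank (a : N4gen) : nat :=
  match a with
  | L => 0 | J0 => 1 | Jp => 2 | Jm => 3 | Gp => 4 | Gm => 5 | Gbp => 6 | Gbm => 7
  end.

Definition N4odd (a : N4gen) : bool :=
  match a with Gp | Gm | Gbp | Gbm => true | _ => false end.

Section Algebra.
Variable R : realType.
Local Notation C := R[i].

Definition N4weight (a : N4gen) : C :=
  match a with
  | L => 2%:R
  | J0 | Jp | Jm => 1
  | Gp | Gm | Gbp | Gbm => 3%:R / 2%:R
  end.

(* The vacuum, a generating field, or the derivative of a generating field. *)
Inductive N4elt := Vac | Fld of N4gen | Der of N4gen.

(* The lambda-bracket [a_lambda b] as a list of terms (k, j, x) standing for
   k lambda^j x. The table covers the pairs with [N4rank a <= N4rank b]; the
   other brackets are determined by skew-symmetry. *)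
Definition N4bracket (c : C) (a b : N4gen) : seq (C * nat * N4elt) :=
  match a, b with
  | L, L => [:: (1, 0%N, Der L); (2%:R, 1%N, Fld L); (c / 12%:R, 3%N, Vac)]
  | L, x => [:: (1, 0%N, Der x); (N4weight x, 1%N, Fld x)]
  | J0, J0 => [:: (c / 3%:R, 1%N, Vac)]
  | J0, Jp => [:: (2%:R, 0%N, Fld Jp)]
  | J0, Jm => [:: (- 2%:R, 0%N, Fld Jm)]
  | Jp, Jm => [:: (1, 0%N, Fld J0); (c / 6%:R, 1%N, Vac)]
  | J0, Gp => [:: (1, 0%N, Fld Gp)]
  | J0, Gm => [:: (- 1, 0%N, Fld Gm)]
  | J0, Gbp => [:: (1, 0%N, Fld Gbp)]
  | J0, Gbm => [:: (- 1, 0%N, Fld Gbm)]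
  | Jp, Gm => [:: (1, 0%N, Fld Gp)]
  | Jm, Gp => [:: (1, 0%N, Fld Gm)]
  | Jp, Gbm => [:: (- 1, 0%N, Fld Gbp)]
  | Jm, Gbp => [:: (- 1, 0%N, Fld Gbm)]
  | Gp, Gbp => [:: (1, 0%N, Der Jp); (2%:R, 1%N, Fld Jp)]
  | Gm, Gbm => [:: (1, 0%N, Der Jm); (2%:R, 1%N, Fld Jm)]
  | Gp, Gbm => [:: (1, 0%N, Fld L); (1 / 2%:R, 0%N, Der J0); (1, 1%N, Fld J0);
                   (c / 6%:R, 2%N, Vac)]
  | Gm, Gbp => [:: (1, 0%N, Fld L); (- (1 / 2%:R), 0%N, Der J0); (- 1, 1%N, Fld J0);
                   (c / 6%:R, 2%N, Vac)]
  | _, _ => [::]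
  end.

(* x (x - 1) ... (x - j + 1). *)
Definition falling (x : C) (j : nat) : C := \prod_(i < j) (x - i%:R).

(* The n-th mode of an element, where a(w) = \sum_n a_n w^(- n - weight a):
   the modes of the derivative are (Der a)_n = - (n + weight a) a_n. *)
Definition elt_mode (V : lmodType C) (mode : N4gen -> int -> V -> V)
    (x : N4elt) (n : int) (v : V) : V :=
  match x with
  | Vac => if n == 0 then v else 0
  | Fld a => mode a n v
  | Der a => - (n%:~R + N4weight a) *: mode a n v
  end.

(* [a_m, b_n] from the commutator formula
     [a_m, b_n] = \sum_j binom(m + weight a - 1, j) (a_(j) b)_(m + n),
   in which a_(j) b / j! is the coefficient of lambda^j in [a_lambda b]. *)
Definition mode_bracket (c : C) (V : lmodType C)
    (mode : N4gen -> int -> V -> V) (a b : N4gen) (m n : int) (v : V) : V :=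
  \sum_(t <- N4bracket c a b)
     (t.1.1 * falling (m%:~R + N4weight a - 1) t.1.2)
       *: elt_mode mode t.2 (m + n) v.

(* Ramond twisted modules: all modes are indexed by the integers. The
   Z/2-grading is given by the operator [parity], equal to 1 on the even part
   and to -1 on the odd part. *)
Record ramond_module (c : C) := RamondModule {
  carrier :> lmodType C;
  parity : {linear carrier -> carrier};
  mode : N4gen -> int -> {linear carrier -> carrier};
  parityK : involutive parity;
  mode_parity : forall a n v,
    parity (mode a n v) = (- 1) ^+ N4odd a *: mode a n (parity v);
  mode_field : forall a v, exists N : int, forall n, N <= n -> mode a n v = 0;
  mode_comm : forall a b m n v, (N4rank a <= N4rank b)%N ->
    mode a m (mode b n v)
      - (- 1) ^+ (N4odd a && N4odd b) *: mode b n (mode a m v)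
    = mode_bracket c mode a b m n v
}.

Section Module.
Variables (c : C) (V : ramond_module c).

Definition submodule (S : set V) : Prop :=
  [/\ S 0,
      forall (k : C) u v, S u -> S v -> S (k *: u + v),
      forall v, S v -> S (parity V v)
    & forall a n v, S v -> S (mode V a n v)].

Definition irreducible_module : Prop :=
  (exists v : V, v != 0) /\
  forall S : set V, submodule S -> S = [set 0] \/ S = setT.

Definition highest_weight_vector (h s : C) (v : V) : Prop :=
  [/\ v != 0, parity V v = v,
      forall a (n : int), 0 < n -> mode V a n v = 0,
      [/\ mode V Jp 0 v = 0, mode V Gp 0 v = 0 & mode V Gbp 0 v = 0]
    & mode V L 0 v = h *: v /\ mode V J0 0 v = s *: v].

Definition highest_weight_module (h s : C) : Prop :=
  exists2 v : V, highest_weight_vector h s v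
    & forall S : set V, submodule S -> S v -> S = setT.

Definition irreducible_highest_weight (h s : C) : Prop :=
  irreducible_module /\ highest_weight_module h s.

(* The subspace of parity [p] (true for odd) in the joint eigenspace of L_0 and
   J_0 with eigenvalues [w.1] and [w.2]. *)
Definition weight_space (p : bool) (w : C * C) : set V :=
  [set v | [/\ parity V v = (- 1) ^+ p *: v,
               mode V L 0 v = w.1 *: v & mode V J0 0 v = w.2 *: v]].

Definition has_dim (S : set V) (d : nat) : Prop :=
  exists b : 'I_d -> V,
    [/\ forall i, S (b i),
        forall k : 'I_d -> C, \sum_i k i *: b i = 0 -> forall i, k i = 0
      & forall v, S v -> exists k : 'I_d -> C, v = \sum_i k i *: b i].

Definition weight_dims (d : bool -> C * C -> nat) : Prop :=
  forall p w, has_dim (weight_space p w) (d p w).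

(* Trace multiplicity, or supertrace multiplicity if [super]. *)
Definition mult (super : bool) (d : bool -> C * C -> nat) (w : C * C) : C :=
  (d false w)%:R + (- 1) ^+ super * (d true w)%:R.

(* [ch_eq super tau z S]: the trace (supertrace if [super]) over [V] of
   q^(L_0 - c/24) e^(2 pi i z J_0) exists and is equal to [S]. On a highest
   weight module L_0 and J_0 are simultaneously diagonalizable, so the trace is
   the sum over the joint eigenspaces, which are required to be
   finite-dimensional. *)
Definition ch_eq (super : bool) (tau z S : C) : Prop :=
  exists2 d, weight_dims d &
    sums_to (fun w : C * C =>
      mult super d w * (expi (tau * (w.1 - c / 24%:R)) * expi (z * w.2))) S.

(* The coefficient of q^x in the (super)character, a function of [z], takes the
   value [S] at [z]. *)
Definition ch_coef_eq (super : bool) (x z S : C) : Prop :=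
  exists2 d, weight_dims d &
    sums_to (fun mu : C => mult super d (x + c / 24%:R, mu) * expi (z * mu)) S.

(* [T] is the term of least degree in q of the (super)character. The order on
   [C] is such that [deg <= x] means that x - deg is a nonnegative real. A
   coefficient depends on [z] only, and the conditions
   1 < |e^{2 pi i z}| < |q|^{-1/2} leave |e^{2 pi i z}| > 1. *)
Definition leading_term (super : bool) (T : C -> C -> C) : Prop :=
  exists (deg : C) (P : C -> C),
    [/\ forall tau z, T tau z = expi (tau * deg) * P z,
        forall z, 1 < `|expi z| -> ch_coef_eq super deg z (P z),
        exists2 z, 1 < `|expi z| & P z != 0
      & forall x, ~~ (deg <= x) ->
          forall z, 1 < `|expi z| -> ch_coef_eq super x z 0].

End Module.

(* c^{[M]}, h^{[M,j]R} and s^{[M,j]R}. *)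
Definition cM (M : nat) : C := 6%:R * (1 - M%:R) / M%:R.
Definition hR (M j : nat) : C :=
  j%:R ^+ 2 / M%:R + 1 / (4%:R * M%:R) - 1 / 4%:R.
Definition sR (M j : nat) : C := 2%:R * j%:R / M%:R.

(* tau in the upper half plane and 1 < |e^{2 pi i z}| < |q|^{-1/2}. *)
Definition in_domain (tau z : C) : Prop :=
  [/\ 0 < complex.Im tau, 1 < `|expi z|
    & `|expi z| < (sqrtC `|expi tau|)^-1].

End Algebra.

(* Main.v *)
(* At c = -3 the N=4 algebra acts on the Fock space F of two bosons gamma^+, gamma^-
   and two fermions chi, chi^bar, all with modes of half-integral index, through bilinears
   in these fields. The even and the odd part of F (by the number of quanta) are irreducible
   with highest weights (h, s) = (-1/8, 0) and (3/8, 1): the normally ordered product of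
   G^+ and G^- is a multiple of (d chi) chi, so its modes multiply the coefficients of a
   bilinear gamma chi by polynomials in the index, and interpolation puts every product of
   two oscillators in the image of the algebra. An irreducible highest weight module with
   the same highest weight has the same weight multiplicities, because the submodule of
   V x F generated by the two highest weight vectors is the graph of an isomorphism.
   The character of F is an infinite product, a quotient of theta functions by Jacobi's
   triple product; its even and odd parts are separated by t -> - t with t^2 = q, and
   T(t, e) T(t, y) +- T(t, -e) T(t, -y) is turned into the square of a theta series of
   nome t^2 by the substitution (m, n) = (a - b, a + b + j). *)
From HB Require Import structures.
Require Import Defs.
From mathcomp Require Import all_boot all_order all_algebra.
From mathcomp Require Import all_classical all_reals all_analysis.
From mathcomp Require Import complex finmap ring lra zify.
From mathcomp.analysis Require Import showcase.summability.

Set Implicit Arguments.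
Unset Strict Implicit.
Unset Printing Implicit Defensive.

Import Order.TTheory GRing.Theory Num.Theory.
Import numFieldNormedType.Exports.

Local Open Scope ring_scope.

(** * The Fock space *)

(** The central charge -3 is (-1) + (-2): gamma^+, gamma^- are symplectic bosons of conformal weight
    1/2, and chi, chi^bar symplectic fermions of conformal weight 1. The odd fields, of weight 3/2,
    are the products gamma chi. Their Ramond modes are integral, so with half-integral gamma the chi
    are half-integral too; for fields of weight 1 this is the twisted sector, whose ground state
    energy -1/8 is the first highest weight h. The relations are not checked by multiplying infinite
    sums. An operator that supercommutes with all oscillators and has zero vacuum expectation value
    is zero, so each relation reduces to a finite table of actions on oscillators and to two-point
    functions. The obstacle to irreducibility is that a mode of an odd field is an infinite sum of
    products gamma_i chi_k with all coefficients equal. Even polynomials in the index of chi do not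
    separate that index from its opposite; commutators with the modes of (d chi) chi of index 1 and
    -1 supply an odd polynomial. *)

Section FreeModule.
Variables (K : fieldType) (T : choiceType).

Definition fin_supp : {pred T -> K^o} :=
  fun v => `[< exists A : {fset T}, forall x, x \notin A -> v x = 0 >].

Record freemod := FreeMod { fm_val :> T -> K^o; _ : fm_val \in fin_supp }.
Arguments fm_val : simpl never.

HB.instance Definition _ := [isSub for fm_val].
HB.instance Definition _ := [Choice of freemod by <:].

Lemma fin_suppP (v : T -> K^o) :
  reflect (exists A : {fset T}, forall x, x \notin A -> v x = 0) (v \in fin_supp).
Proof. exact: asboolP. Qed.

Fact fin_supp_submod : submod_closed fin_supp.
Proof.
split=> [|a u v]; first by apply/fin_suppP; exists fset0.
move=> /fin_suppP[A hA] /fin_suppP[B hB]; apply/fin_suppP.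
exists (A `|` B)%fset => x; rewrite inE negb_or => /andP[xA xB].
have -> : (a *: u + v) x = a *: (u x) + v x by [].
by rewrite hA // hB // scaler0 addr0.
Qed.
HB.instance Definition _ :=
  GRing.isSubmodClosed.Build K (T -> K^o) fin_supp fin_supp_submod.
HB.instance Definition _ := [SubChoice_isSubLmodule of freemod by <:].

Implicit Types (u v : freemod).

Lemma freemodP u v : (forall x, u x = v x) -> u = v.
Proof. by move=> uv; apply/val_inj/funext. Qed.

Lemma fm_linearE a u v x : (a *: u + v) x = a * u x + v x.
Proof. by []. Qed.
Lemma fm_addE u v x : (u + v) x = u x + v x. Proof. by []. Qed.
Lemma fm_scaleE a u x : (a *: u) x = a * u x. Proof. by []. Qed.
Lemma fm_oppE u x : (- u) x = - u x. Proof. by []. Qed.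
Lemma fm_zeroE x : (0 : freemod) x = 0. Proof. by []. Qed.
Lemma fm_sumE (I : Type) (r : seq I) (P : pred I) (F : I -> freemod) x :
  (\sum_(i <- r | P i) F i) x = \sum_(i <- r | P i) F i x.
Proof.
by elim/big_rec2: _ => [|i a b _ <-]; rewrite ?fm_zeroE ?fm_addE.
Qed.

Fact fm_supp_ex v : exists A : {fset T}, forall x, x \notin A -> v x = 0.
Proof. by case: v => v hv; apply/fin_suppP. Qed.

(** Not the exact support: some finite set outside which [v] vanishes, picked by choice. [lextE]
    makes sums independent of the pick. *)
Definition fm_supp v : {fset T} := projT1 (cid (fm_supp_ex v)).

Lemma fm_suppP v x : x \notin fm_supp v -> v x = 0.
Proof. exact: (projT2 (cid (fm_supp_ex v))). Qed.

Fact bas_supp (x : T) : (fun y => (y == x)%:R : K^o) \in fin_supp.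
Proof. by apply/fin_suppP; exists [fset x]%fset => y; rewrite inE => /negPf->. Qed.

Definition bas (x : T) : freemod := FreeMod (bas_supp x).

Lemma basE x y : bas x y = (y == x)%:R. Proof. by []. Qed.

Section Extension.
Variable V : lmodType K.

Definition lext (g : T -> V) v : V := \sum_(x <- fm_supp v) v x *: g x.

Lemma lextE g v (A : {fset T}) : (forall x, x \notin A -> v x = 0) ->
  lext g v = \sum_(x <- A) v x *: g x.
Proof.
move=> hA; rewrite /lext.
rewrite (big_fset_incl _ (fsubsetUl (fm_supp v) A)); last first.
  by move=> x _ /fm_suppP->; rewrite scale0r.
rewrite [RHS](big_fset_incl _ (fsubsetUr (fm_supp v) A)) //.
by move=> x _ /hA->; rewrite scale0r.
Qed.

Fact lext_linear g : linear (lext g).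
Proof.
move=> a u v; set A := (fm_supp u `|` fm_supp v)%fset.
have hu x : x \notin A -> u x = 0.
  by rewrite inE negb_or => /andP[/fm_suppP].
have hv x : x \notin A -> v x = 0.
  by rewrite inE negb_or => /andP[_ /fm_suppP].
rewrite (lextE g hu) (lextE g hv) (@lextE g _ A); last first.
  by move=> x xA; rewrite fm_linearE hu // hv // mulr0 addr0.
rewrite scaler_sumr -big_split; apply: eq_bigr => x _ /=.
by rewrite fm_linearE scalerDl scalerA.
Qed.
HB.instance Definition _ g := GRing.isLinear.Build K freemod V *:%R (lext g)
  (lext_linear g).

Lemma lext_bas g x : lext g (bas x) = g x.
Proof.
rewrite (@lextE _ _ [fset x]%fset) ?big_seq_fset1 ?basE ?eqxx ?scale1r //.
by move=> y; rewrite inE basE => /negPf->.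
Qed.

End Extension.

Lemma lext_id v : lext bas v = v.
Proof.
apply: freemodP => x; rewrite /lext fm_sumE.
have [xv|xv] := boolP (x \in fm_supp v).
  rewrite (big_fsetD1 x) //= big1_fset ?addr0 => [|y].
    by rewrite fm_scaleE basE eqxx mulr1.
  rewrite !inE => /andP[/negPf yx _] _.
  by rewrite fm_scaleE basE eq_sym yx mulr0.
rewrite (fm_suppP xv) big1_fset // => y yv _.
rewrite fm_scaleE basE; case: eqP => [xy|_]; last by rewrite mulr0.
by rewrite -xy (negPf xv) in yv.
Qed.

Lemma freemod_ind (P : freemod -> Prop) :
    P 0 -> (forall k u v, P u -> P v -> P (k *: u + v)) ->
  forall v, (forall x, v x != 0 -> P (bas x)) -> P v.
Proof.
move=> P0 PD v hv; rewrite -[v]lext_id /lext big_seq_cond.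
elim/big_rec: _ => // x u /andP[_ _] Pu.
have [vx0|vx0] := eqVneq (v x) 0; first by rewrite vx0 scale0r add0r.
exact/PD/Pu/hv.
Qed.

Lemma lin_ext (V : lmodType K) (f g : {linear freemod -> V}) :
  (forall x, f (bas x) = g (bas x)) -> f =1 g.
Proof.
move=> fg v; apply: (@freemod_ind (fun v => f v = g v)) => [|k u w Pu Pw|x _].
- by rewrite !linear0.
- by rewrite !linearP Pu Pw.
exact: fg.
Qed.

Fact fm_coef_linear x : linear (fun v : freemod => v x : K^o).
Proof. by move=> a u v; exact: fm_linearE. Qed.

Lemma lin_ext0 (V : lmodType K) (f : {linear freemod -> V}) :
  (forall x, f (bas x) = 0) -> forall v, f v = 0.
Proof.
move=> f0 v; apply: (@freemod_ind (fun v => f v = 0)) => [|k u w Pu Pw|x _].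
- by rewrite linear0.
- by rewrite linearP Pu Pw scaler0 addr0.
exact: f0.
Qed.

Definition fm_coef x (v : freemod) : K^o := v x.
HB.instance Definition _ x := GRing.isLinear.Build K freemod K^o *:%R (fm_coef x)
  (@fm_coef_linear x).

End FreeModule.

(** * Bosonic and fermionic creation and annihilation operators *)

Section FockSpace.
Variable K : fieldType.

(* Occupation numbers of the bosons and occupied fermions; the code 2k + e stands
   for the creation operator of index - (k + 1/2) of the field labelled e. *)
Definition state : choiceType := ({fsfun nat -> nat with 0%N} * {fset nat})%type.
Local Notation fock := (freemod K state).

Definition inc (n : {fsfun nat -> nat with 0%N}) i : {fsfun nat -> nat with 0%N} :=
  [fsfun n with i |-> (n i).+1].
Definition dec (n : {fsfun nat -> nat with 0%N}) i : {fsfun nat -> nat with 0%N} :=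
  [fsfun n with i |-> (n i).-1].

Lemma incE n i j : inc n i j = ((i == j) + n j)%N.
Proof. by rewrite /inc fsfun_withE eq_sym; case: eqP => [->|]. Qed.
Lemma decE n i j : dec n i j = (n j - (i == j))%N.
Proof. by rewrite /dec fsfun_withE eq_sym; case: eqP => [->|]; rewrite ?subn1 ?subn0. Qed.

Lemma incC n i j : inc (inc n i) j = inc (inc n j) i.
Proof. by apply/fsfunP => k; rewrite !incE addnCA. Qed.
Lemma decC n i j : dec (dec n i) j = dec (dec n j) i.
Proof. by apply/fsfunP => k; rewrite !decE -!subnDA addnC. Qed.
Lemma incK n i : dec (inc n i) i = n.
Proof. by apply/fsfunP => k; rewrite decE incE addKn. Qed.
Lemma decK (n : {fsfun nat -> nat with 0%N}) i : (0 < n i)%N -> inc (dec n i) i = n.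
Proof.
move=> ni; apply/fsfunP => k; rewrite incE decE.
by case: eqP => [<-|_]; rewrite ?subn0 // subnKC.
Qed.
Lemma dec_inc n i j : i != j -> dec (inc n j) i = inc (dec n i) j.
Proof.
move=> ij; apply/fsfunP => k; rewrite !(incE, decE).
have [<-|_] := eqVneq j k; last by rewrite !add0n.
by rewrite (negPf ij) !subn0.
Qed.

(** The Jordan-Wigner sign, counting the occupied places before [i]; it makes operators at different
    places anticommute. *)
Definition fsgn (i : nat) (S : {fset nat}) : K :=
  \prod_(j <- S) (if (j < i)%N then - 1 else 1).

Lemma fsgnU1 i j S : j \notin S ->
  fsgn i (j |` S)%fset = (if (j < i)%N then - 1 else 1) * fsgn i S.
Proof. exact: big_fsetU1. Qed.

Lemma fsgnD1 i j S : j \in S ->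
  fsgn i S = (if (j < i)%N then - 1 else 1) * fsgn i (S `\ j)%fset.
Proof. exact: big_fsetD1. Qed.

Lemma fsgn_sq i S : fsgn i S * fsgn i S = 1.
Proof.
rewrite /fsgn -big_split big1 //= => j _.
by case: ifP => _; rewrite ?mulrNN mulr1.
Qed.

(** The states are unnormalised monomials: creation is multiplication by a variable, and
    annihilation is the derivative, which brings down the occupation number. *)
Definition bcr i : fock -> fock := lext (fun x : state => bas K (inc x.1 i, x.2) : fock).
Definition ban i : fock -> fock :=
  lext (fun x : state => (x.1 i)%:R *: bas K (dec x.1 i, x.2) : fock).
Definition fcr i : fock -> fock := lext (fun x : state =>
  if i \in x.2 then 0 else fsgn i x.2 *: bas K (x.1, (i |` x.2)%fset) : fock).
Definition fan i : fock -> fock := lext (fun x : state =>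
  if i \in x.2 then fsgn i x.2 *: bas K (x.1, (x.2 `\ i)%fset) else 0 : fock).
HB.instance Definition _ i := GRing.Linear.on (bcr i).
HB.instance Definition _ i := GRing.Linear.on (ban i).
HB.instance Definition _ i := GRing.Linear.on (fcr i).
HB.instance Definition _ i := GRing.Linear.on (fan i).

Lemma bcrE i x : bcr i (bas K x) = bas K (inc x.1 i, x.2).
Proof. exact: lext_bas. Qed.
Lemma banE i x : ban i (bas K x) = (x.1 i)%:R *: bas K (dec x.1 i, x.2).
Proof. exact: lext_bas. Qed.
Lemma fcrE i x : fcr i (bas K x) =
  if i \in x.2 then 0 else fsgn i x.2 *: bas K (x.1, (i |` x.2)%fset).
Proof. exact: lext_bas. Qed.
Lemma fanE i x : fan i (bas K x) =
  if i \in x.2 then fsgn i x.2 *: bas K (x.1, (x.2 `\ i)%fset) else 0.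
Proof. exact: lext_bas. Qed.

Lemma bcrC i j v : bcr i (bcr j v) = bcr j (bcr i v).
Proof.
apply: (@lin_ext _ _ _ (bcr i \o bcr j) (bcr j \o bcr i)) => x.
by rewrite /= !bcrE /= incC.
Qed.

Lemma banC i j v : ban i (ban j v) = ban j (ban i v).
Proof.
apply: (@lin_ext _ _ _ (ban i \o ban j) (ban j \o ban i)) => x.
rewrite /= !banE !linearZ /= !banE /= !scalerA !decE -!natrM eq_sym decC.
have [->|ij] := eqVneq i j; first by rewrite mulnC.
by rewrite !subn0 mulnC.
Qed.

Lemma ban_bcr i j v : ban i (bcr j v) = bcr j (ban i v) + (i == j)%:R *: v.
Proof.
apply: (@lin_ext _ _ _ (ban i \o bcr j) ((bcr j \o ban i) \+ (i == j)%:R \*: idfun)) => x.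
rewrite /= bcrE !banE linearZ /= bcrE /= incE [j == i]eq_sym.
have [->|ij] := eqVneq i j; last by rewrite scale0r addr0 add0n dec_inc.
rewrite scale1r add1n incK; case: x => n S /=.
have [nj|] := posnP (n j); first by rewrite nj scale0r add0r scale1r.
by move=> /decK->; rewrite -addn1 natrD scalerDl scale1r.
Qed.

Lemma fcrC i j v : fcr i (fcr j v) = - fcr j (fcr i v).
Proof.
apply: (@lin_ext _ _ _ (fcr i \o fcr j) (\- (fcr j \o fcr i))) => x.
rewrite /= !fcrE; case: ifPn => jx; case: ifPn => ix; rewrite ?linear0 ?oppr0 //.
- by rewrite linearZ /= fcrE /= !inE jx orbT scaler0 oppr0.
- by rewrite !linearZ /= fcrE /= inE ix orbT /= scaler0.
rewrite !linearZ /= !fcrE /= !inE (negPf ix) (negPf jx) !orbF eq_sym.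
have [->|ij] := eqVneq j i; first by rewrite ?eqxx /= ?scaler0 ?oppr0 ?scaler0.
rewrite ?scalerN !scalerA -?scaleNr !fsgnU1 // fsetUCA; congr (_ *: _).
by case: (ltngtP i j) ij => // _ _; ring.
Qed.

Lemma fanC i j v : fan i (fan j v) = - fan j (fan i v).
Proof.
apply: (@lin_ext _ _ _ (fan i \o fan j) (\- (fan j \o fan i))) => x.
rewrite /= !fanE; case: ifPn => jx; case: ifPn => ix; rewrite ?linear0 ?oppr0 //.
- rewrite !linearZ /= !fanE /= !inE ix jx !andbT eq_sym.
  have [->|ij] := eqVneq j i; first by rewrite ?eqxx /= ?scaler0 ?oppr0 ?scaler0.
  rewrite /= ?scalerN !scalerA -?scaleNr fsetDDl fsetUC -fsetDDl.
  rewrite (fsgnD1 i jx) (fsgnD1 j ix); congr (_ *: _).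
  by case: (ltngtP i j) ij => // _ _; ring.
- by rewrite !linearZ /= fanE /= inE (negPf ix) andbF scaler0.
- by rewrite linearZ /= fanE /= !inE (negPf jx) andbF scaler0 oppr0.
Qed.

Lemma fan_fcr i j v : fan i (fcr j v) = - fcr j (fan i v) + (i == j)%:R *: v.
Proof.
apply: (@lin_ext _ _ _ (fan i \o fcr j)
          ((\- (fcr j \o fan i)) \+ (i == j)%:R \*: idfun)) => x.
rewrite /= fcrE fanE; have [->|ij] := eqVneq i j.
  rewrite scale1r; case: x => n S /=; case: ifPn => jS.
    rewrite linear0 linearZ /= fcrE /= !inE eqxx /= scalerA.
    by rewrite (fsgnD1 _ jS) ltnn mul1r fsgn_sq scale1r fsetD1K // addNr.
  rewrite linear0 oppr0 add0r linearZ /= fanE /= !inE eqxx /= scalerA.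
  by rewrite fsgnU1 // ltnn mul1r fsgn_sq scale1r fsetU1K.
rewrite scale0r addr0; case: ifPn => jx; case: ifPn => ix; rewrite ?linear0 ?oppr0 //.
- by rewrite linearZ /= fcrE /= !inE jx eq_sym ij scaler0 oppr0.
- rewrite !linearZ /= !fcrE !fanE /= !inE ix (negPf jx) (negPf ij) orbT andbF.
  rewrite /= ?scalerN !scalerA -?scaleNr.
  have -> : ((j |` x.2) `\ i = j |` (x.2 `\ i))%fset.
    apply/fsetP => k; rewrite !inE; case: eqP => [->|//] /=.
    by rewrite (negPf ij).
  rewrite fsgnU1 // (fsgnD1 j ix); congr (_ *: _).
  by case: (ltngtP i j) ij => // _ _; ring.
by rewrite linearZ /= fanE /= !inE (negPf ij) (negPf ix) scaler0.
Qed.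

Lemma bcr_fcr i j v : bcr i (fcr j v) = fcr j (bcr i v).
Proof.
apply: (@lin_ext _ _ _ (bcr i \o fcr j) (fcr j \o bcr i)) => x.
by rewrite /= bcrE !fcrE /=; case: ifP; rewrite ?linear0 // linearZ /= bcrE.
Qed.
Lemma bcr_fan i j v : bcr i (fan j v) = fan j (bcr i v).
Proof.
apply: (@lin_ext _ _ _ (bcr i \o fan j) (fan j \o bcr i)) => x.
by rewrite /= bcrE !fanE /=; case: ifP; rewrite ?linear0 // linearZ /= bcrE.
Qed.
Lemma ban_fcr i j v : ban i (fcr j v) = fcr j (ban i v).
Proof.
apply: (@lin_ext _ _ _ (ban i \o fcr j) (fcr j \o ban i)) => x.
rewrite /= banE linearZ /= !fcrE /=; case: ifP; rewrite ?linear0 ?scaler0 //.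
by rewrite linearZ /= banE !scalerA mulrC.
Qed.
Lemma ban_fan i j v : ban i (fan j v) = fan j (ban i v).
Proof.
apply: (@lin_ext _ _ _ (ban i \o fan j) (fan j \o ban i)) => x.
rewrite /= banE linearZ /= !fanE /=; case: ifP; rewrite ?linear0 ?scaler0 //.
by rewrite linearZ /= banE !scalerA mulrC.
Qed.

Lemma ban_coef i (v : fock) x :
  ban i v x = (x.1 i).+1%:R * v (inc x.1 i, x.2).
Proof.
move: v; change (forall v, (fm_coef x \o ban i) v =
  ((x.1 i).+1%:R \*: fm_coef (inc x.1 i, x.2)) v); apply: lin_ext => y /=.
rewrite /fm_coef banE fm_scaleE !basE.
have [->|xy] := eqVneq x (dec y.1 i, y.2); last first.
  rewrite mulr0; case: eqP => [yE|_]; last by rewrite scaler0.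
  by case/eqP: xy; rewrite -yE /= incK -surjective_pairing.
rewrite /= decE eqxx subn1; have [yi|yi] := posnP (y.1 i).
  rewrite yi mul0r; case: eqP => [yE|_]; last by rewrite scaler0.
  by have := incE (dec y.1 i) i i; rewrite eqxx (congr1 fst yE : inc _ _ = _) yi.
by rewrite decK // -surjective_pairing eqxx prednK.
Qed.

Lemma fan_coef i (v : fock) x :
  fan i v x = if i \in x.2 then 0 else fsgn i x.2 * v (x.1, (i |` x.2)%fset).
Proof.
have [ix|ix] := boolP (i \in x.2).
  move: v; change (forall v, (fm_coef x \o fan i) v = 0); apply: lin_ext0 => y /=.
  rewrite /fm_coef fanE; case: ifP => iy; rewrite ?fm_zeroE // fm_scaleE basE.
  by case: eqP => [xE|_]; rewrite ?mulr0 //; rewrite xE /= !inE eqxx in ix.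
move: v; change (forall v, (fm_coef x \o fan i) v =
  (fsgn i x.2 \*: fm_coef (x.1, (i |` x.2)%fset)) v); apply: lin_ext => y /=.
rewrite /fm_coef fanE; case: ifP => iy; last first.
  rewrite fm_zeroE; case: eqP => [yE|_]; last by rewrite scaler0.
  by rewrite -yE /= !inE eqxx in iy.
rewrite fm_scaleE !basE; case: eqP => [->|xy] /=.
  by rewrite fsetD1K // -surjective_pairing eqxx (fsgnD1 _ iy) ltnn mul1r.
case: eqP => [yE|_]; last by rewrite scaler0 mulr0.
by case: xy; rewrite -yE /= fsetU1K // -surjective_pairing.
Qed.

Lemma bcr_coef i (v : fock) x :
  bcr i v x = if (0 < x.1 i)%N then v (dec x.1 i, x.2) else 0.
Proof.
have [xi|xi] := ltnP 0 (x.1 i).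
  move: v; change (forall v, (fm_coef x \o bcr i) v =
    (fm_coef (dec x.1 i, x.2)) v); apply: lin_ext => y /=.
  rewrite /fm_coef bcrE !basE; congr (_%:R); congr nat_of_bool.
  apply/eqP/eqP => [->|<-] /=.
    by rewrite incK -surjective_pairing.
  by rewrite decK // -surjective_pairing.
move: v; change (forall v, (fm_coef x \o bcr i) v = 0); apply: lin_ext0 => y /=.
rewrite /fm_coef bcrE basE; case: eqP => // xE.
by move: xi; rewrite xE /= incE eqxx.
Qed.

Lemma fcr_coef i (v : fock) x :
  fcr i v x = if i \in x.2 then fsgn i x.2 * v (x.1, (x.2 `\ i)%fset) else 0.
Proof.
have [ix|ix] := boolP (i \in x.2); last first.
  move: v; change (forall v, (fm_coef x \o fcr i) v = 0); apply: lin_ext0 => y /=.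
  rewrite /fm_coef fcrE; case: ifP => iy; rewrite ?fm_zeroE // fm_scaleE basE.
  by case: eqP => [xE|_]; rewrite ?mulr0 //; rewrite xE /= !inE eqxx in ix.
move: v; change (forall v, (fm_coef x \o fcr i) v =
  (fsgn i x.2 \*: fm_coef (x.1, (x.2 `\ i)%fset)) v); apply: lin_ext => y /=.
rewrite /fm_coef fcrE; case: ifPn => iy.
  rewrite fm_zeroE; case: eqP => [yE|_]; last by rewrite scaler0.
  by rewrite -yE /= !inE eqxx in iy.
rewrite fm_scaleE !basE; case: eqP => [->|xy] /=.
  by rewrite fsetU1K // -surjective_pairing eqxx fsgnU1 // ltnn mul1r.
case: eqP => [yE|_]; last by rewrite scaler0 mulr0.
by case: xy; rewrite -yE /= fsetD1K // -surjective_pairing.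
Qed.

End FockSpace.

(** * Additive statistics of states *)

Section Statistics.

Lemma big_finsupp (M : nmodType) (n : {fsfun nat -> nat with 0%N}) (f : nat -> M)
    (A : {fset nat}) : (finsupp n `<=` A)%fset ->
  \sum_(i <- finsupp n) f i *+ n i = \sum_(i <- A) f i *+ n i.
Proof.
move=> sA; apply: big_fset_incl => // i _ /fsfun_dflt->.
by rewrite mulr0n.
Qed.

Definition vst : state := ([fsfun], fset0)%fset.

(** The number of quanta, the degree and the charge of a state are all of this form, so that
    [stat_inc] and [stat_fsetU1] serve the three of them. *)
Definition stat (M : nmodType) (f g : nat -> M) (x : state) : M :=
  \sum_(i <- finsupp x.1) f i *+ x.1 i + \sum_(i <- x.2) g i.

Lemma stat_vst (M : nmodType) (f g : nat -> M) : stat f g vst = 0.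
Proof. by rewrite /stat /= finsupp0 !big_seq_fset0 addr0. Qed.

Lemma stat_inc (M : nmodType) (f g : nat -> M) x i :
  stat f g (inc x.1 i, x.2) = f i + stat f g x.
Proof.
rewrite /stat /= addrA; congr (_ + _).
set A := (i |` (finsupp x.1 `|` finsupp (inc x.1 i)))%fset.
have iA : i \in A by rewrite !inE eqxx.
rewrite (@big_finsupp _ x.1 _ A) ?(@big_finsupp _ (inc x.1 i) _ A); last 2 first.
- by apply/fsubsetP => j jx; rewrite !inE jx !orbT.
- by apply/fsubsetP => j jx; rewrite !inE jx !orbT.
rewrite !(big_fsetD1 i iA) /= incE eqxx add1n mulrS -addrA; congr (_ + (_ + _)).
rewrite !big_seq; apply: eq_bigr => j; rewrite !inE => /andP[/negPf ji _].
by rewrite incE eq_sym ji.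
Qed.

Lemma stat_fsetU1 (M : nmodType) (f g : nat -> M) x i : i \notin x.2 ->
  stat f g (x.1, (i |` x.2)%fset) = g i + stat f g x.
Proof. by move=> ix; rewrite /stat /= big_fsetU1 //= addrCA. Qed.

Definition num : state -> nat := stat (fun=> 1%N) (fun=> 1%N).

Lemma state_ind (P : state -> Prop) :
    P vst -> (forall x i, P x -> P (inc x.1 i, x.2)) ->
    (forall x i, i \notin x.2 -> P x -> P (x.1, (i |` x.2)%fset)) ->
  forall x, P x.
Proof.
move=> P0 Pb Pf x; have [m] := ubnP (num x); elim: m x => // m IH [n S] nm.
have [n0| [i0] ] := fset_0Vmem (finsupp n); last first.
  rewrite mem_finsupp -lt0n; move: i0 => i ni.
  have nE : num (n, S) = (num (dec n i, S)).+1.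
    by rewrite /num -[in LHS](decK ni) (stat_inc _ _ (dec n i, S)).
  rewrite -(decK ni); apply: (Pb (dec n i, S)); apply: IH.
  by rewrite nE ltnS in nm.
have nE : n = [fsfun] :> {fsfun nat -> nat with 0%N}.
  apply/fsfunP => i; rewrite fsfunE /=; apply/eqP.
  by rewrite -[_ == _]negbK -mem_finsupp n0.
have [->| [i iS] ] := fset_0Vmem S; first by rewrite nE.
have nSE : num (n, S) = (num (n, S `\ i)%fset).+1.
  rewrite /num -[in LHS](fsetD1K iS) (stat_fsetU1 _ _ (x := (n, S `\ i)%fset)) //=.
  by rewrite !inE eqxx.
rewrite -(fsetD1K iS); apply: (Pf (n, (S `\ i)%fset)); first by rewrite !inE eqxx.
by apply: IH; rewrite nSE ltnS in nm.
Qed.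

Lemma num_eq0 x : num x = 0%N -> x = vst.
Proof. by elim/state_ind: x => // x i => [|ix]; rewrite /num ?stat_inc ?stat_fsetU1. Qed.

End Statistics.

(** * The modes of the four free fields *)

Section Oscillators.
Variable K : numFieldType.
Local Notation fock := (freemod K state).

(* (false, e) stands for the bosonic field gamma^+ or gamma^-, (true, e) for
   the fermionic field chi or its conjugate; the first of each pair is e = true. *)
Definition species := (bool * bool)%type.
Implicit Types (s t : species) (k l : int) (v : fock).

Definition conj s : species := (s.1, ~~ s.2).

(* The k-th mode of a field is the one with half-integral index k + 1/2. *)
Definition hat k : K := k%:~R + 2%:R^-1.
(** The fermions carry the extra factor [hat k] because chi and chi^bar have conformal weight 1 and
    a double pole between them; the pole between the bosons is simple. *)
Definition wt s k : K := (if s.2 then 1 else - 1) * (if s.1 then hat k else 1).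
(** The value of the supercommutator. The condition says that the true indices k + 1/2 and l + 1/2
    are opposite. *)
Definition om s k t l : K := if (t == conj s) && (k + l + 1 == 0) then wt s k else 0.

(** For nonnegative [k] the code contains [~~ s.2]: the quantum removed is one created by the
    conjugate field. *)
Definition osc s k v : fock :=
  match k with
  | Negz n => if s.1 then fcr (n.*2 + s.2)%N v else bcr (n.*2 + s.2)%N v
  | Posz n => wt s k *: (if s.1 then fan (n.*2 + ~~ s.2)%N v
                         else ban (n.*2 + ~~ s.2)%N v)
  end.

Fact osc_linear s k : linear (osc s k).
Proof.
move=> a u v; case: k => n; rewrite /osc; case: ifP => _; rewrite linearP //.
  by rewrite scalerDr !scalerA mulrC.
by rewrite scalerDr !scalerA mulrC.
Qed.
HB.instance Definition _ s k := GRing.isLinear.Build K fock fock *:%R (osc s k)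
  (osc_linear s k).
Arguments osc : simpl never.

Lemma oscD s k u v : osc s k (u + v) = osc s k u + osc s k v.
Proof. exact: linearD. Qed.
Lemma oscN s k v : osc s k (- v) = - osc s k v.
Proof. exact: linearN. Qed.
Lemma oscZ s k c v : osc s k (c *: v) = c *: osc s k v.
Proof. exact: linearZ. Qed.
Lemma osc0 s k : osc s k 0 = 0.
Proof. exact: linear0. Qed.

Definition sgp (a b : bool) : K := (- 1) ^+ (a && b).

Lemma code_eq (m n : nat) (a b : bool) :
  (m.*2 + a == n.*2 + b)%N = (m == n) && (a == b).
Proof.
apply/eqP/andP => [|[/eqP-> /eqP->] //] mn.
have ab : a = b by have := congr1 odd mn; rewrite !oddD !odd_double; case: a b {mn} => [] [].
by subst b; split=> //; apply/eqP; lia.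
Qed.

(** Conjugation changes the sign of [wt]; for fermions the passage to the opposite index changes it
    once more. The pairing is thus antisymmetric on bosons and symmetric on fermions. *)
Lemma om_sym s k t l : om s k t l = - sgp s.1 t.1 * om t l s k.
Proof.
rewrite /om /conj [l + k]addrC.
case: s => f e; case: t => f' e'; rewrite /= !xpair_eqE [f == _]eq_sym.
have -> : (e == ~~ e') = (e' == ~~ e) by case: e e' => [] [].
case: ifPn => [|_]; last by rewrite mulr0.
case/andP=> /andP[/eqP-> /eqP->] /eqP kl; have -> : l = - 1 - k by lia.
rewrite /wt /sgp /hat /= rmorphB rmorphN rmorph1.
by case: f; case: e; rewrite /= ?expr0 ?expr1; field.
Qed.

Lemma sgpC a b : sgp a b = sgp b a. Proof. by rewrite /sgp andbC. Qed.
Lemma sgp_sq a b : sgp a b * sgp a b = 1.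
Proof. by rewrite /sgp; case: (a && b); rewrite ?expr1 ?mulrNN mulr1. Qed.

Lemma osc_comm s k t l v :
  osc s k (osc t l v) = sgp s.1 t.1 *: osc t l (osc s k v) + om s k t l *: v.
Proof.
(* An annihilator in front of a creator is the only case with a central term; the opposite order
   follows from it by [om_sym]. *)
have mixed r m q n u : osc r (Posz m) (osc q (Negz n) u) =
    sgp r.1 q.1 *: osc q (Negz n) (osc r (Posz m) u) + om r (Posz m) q (Negz n) *: u.
  rewrite /om (_ : (m%:Z + Negz n + 1 == 0) = (m == n)); last by apply/eqP/eqP; lia.
  rewrite /sgp /osc; case: r => -[] d; case: q => -[] e /=; rewrite ?expr1 ?expr0 ?scale1r.
  - rewrite fan_fcr scalerDr code_eq !linearZ /= !scalerN scalerA scaleNr scale1r.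
    rewrite xpair_eqE /= andbC [~~ d == e]eq_sym.
    by case: (e == ~~ d); case: (m == n); rewrite /= ?(mul1r, mul0r) scalerN.
  - by rewrite scale0r addr0 linearZ /= bcr_fan.
  - by rewrite scale0r addr0 linearZ /= ban_fcr.
  rewrite ban_bcr scalerDr code_eq !linearZ /= scalerA.
  rewrite xpair_eqE /= andbC [~~ d == e]eq_sym.
  by case: (e == ~~ d); case: (m == n); rewrite /= ?(mul1r, mul0r, mulr1, mulr0).
case: k => m; case: l => n.
- rewrite /om (_ : (m%:Z + n%:Z + 1 == 0) = false) ?andbF ?scale0r ?addr0; last by lia.
  rewrite /sgp /osc; case: s => -[] d; case: t => -[] e /=; rewrite ?expr1 ?expr0 ?scale1r.
  + by rewrite !linearZ /= fanC !scalerA scalerN -scaleNr; congr (_ *: _); ring.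
  + by rewrite !linearZ /= ban_fan !scalerA mulrC.
  + by rewrite !linearZ /= ban_fan !scalerA mulrC.
  + by rewrite !linearZ /= banC !scalerA mulrC.
- exact: mixed.
- rewrite om_sym mixed scalerDr !scalerA sgpC sgp_sq scale1r -addrA -scalerDl.
  by rewrite mulNr subrr scale0r addr0.
- rewrite /om (_ : (Negz m + Negz n + 1 == 0) = false) ?andbF ?scale0r ?addr0; last by lia.
  rewrite /sgp /osc; case: s => -[] d; case: t => -[] e /=; rewrite ?expr1 ?expr0 ?scale1r.
  + by rewrite fcrC scaleN1r.
  + by rewrite bcr_fcr.
  + by rewrite bcr_fcr.
  + by rewrite bcrC.
Qed.

Definition vac : fock := bas K vst.

Lemma osc_vac s k : 0 <= k -> osc s k vac = 0.
Proof.
case: k => // n _; rewrite /osc /vac; case: ifP => _.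
  by rewrite fanE inE scaler0.
by rewrite banE fsfunE /= scale0r scaler0.
Qed.

Lemma fock_ind (P : fock -> Prop) :
    P 0 -> (forall a u v, P u -> P v -> P (a *: u + v)) -> P vac ->
    (forall s (n : nat) v, P v -> P (osc s (Negz n) v)) ->
  forall v, P v.
Proof.
move=> P0 PD Pv PX v.
have decode i : i = ((i./2).*2 + odd i)%N by rewrite addnC odd_double_half.
apply: freemod_ind => // x _; elim/state_ind: x => // x i.
  move/(PX (false, odd i) i./2); rewrite /osc /= -decode.
  by rewrite bcrE.
move=> ix /(PX (true, odd i) i./2); rewrite /osc /= -decode fcrE (negPf ix).
move/(PD (fsgn K i x.2) _ _)/(_ P0); rewrite addr0 scalerA fsgn_sq.
by rewrite scale1r.
Qed.

Lemma osc_tame v : exists N : nat, forall s k, N%:Z <= k -> osc s k v = 0.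
Proof.
elim/fock_ind: v => [|a u v [M hM] [N hN]||s n v [N hN]].
- by exists 0%N => s k _; rewrite linear0.
- exists (maxn M N) => s k; rewrite linearP /= => k_ge.
  by rewrite hM ?hN ?scaler0 ?addr0 //; lia.
- by exists 0%N => s k; apply: osc_vac.
exists (maxn N n.+1) => t k k_ge; rewrite osc_comm hN ?linear0 ?scaler0; last by lia.
rewrite /om (_ : (k + Negz n + 1 == 0) = false) ?andbF ?scale0r ?addr0 //.
by apply/eqP; rewrite NegzE; lia.
Qed.

Definition vev v : K := v vst.

Lemma vevD u v : vev (u + v) = vev u + vev v. Proof. by []. Qed.
Lemma vevZ c v : vev (c *: v) = c * vev v. Proof. by []. Qed.
Lemma vevN v : vev (- v) = - vev v. Proof. by []. Qed.
Lemma vev0 : vev 0 = 0. Proof. by []. Qed.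

Lemma vev_sum (I : Type) (r : seq I) (F : I -> fock) :
  vev (\sum_(i <- r) F i) = \sum_(i <- r) vev (F i).
Proof. exact: fm_sumE. Qed.

Lemma vev_osc s (n : nat) v : vev (osc s (Negz n) v) = 0.
Proof.
rewrite /vev /osc; case: ifP => _; last by rewrite bcr_coef fsfunE.
by rewrite fcr_coef inE.
Qed.

Lemma vev_vac : vev vac = 1.
Proof. by rewrite /vev basE eqxx. Qed.

Lemma vev_osc2 s k t (n : nat) : vev (osc s k (osc t (Negz n) vac)) = om s k t (Negz n).
Proof.
case: k => k; last by rewrite vev_osc /om (_ : _ == 0 = false) ?andbF //; lia.
by rewrite osc_comm (osc_vac s (k := k)) // linear0 scaler0 add0r vevZ vev_vac mulr1.
Qed.

Lemma wt_neq0 s k : wt s k != 0.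
Proof.
rewrite /wt mulf_neq0 //; first by case: ifP; rewrite ?oner_eq0 ?oppr_eq0 ?oner_eq0.
case: ifP => _; last exact: oner_neq0.
apply/eqP => h0; have : (2 * k + 1)%:~R = 0 :> K.
  rewrite rmorphD rmorphM /= rmorph1.
  have -> : 2%:~R * k%:~R + 1 = 2 * hat k :> K by rewrite /hat; field.
  by rewrite h0 mulr0.
by move/eqP; rewrite intr_eq0; lia.
Qed.

Lemma osc_coef s (n : nat) v x : osc s n v x = 0 ->
  if s.1 then (n.*2 + ~~ s.2)%N \notin x.2 ->
               v (x.1, ((n.*2 + ~~ s.2)%N |` x.2)%fset) = 0
  else v (inc x.1 (n.*2 + ~~ s.2)%N, x.2) = 0.
Proof.
rewrite /osc fm_scaleE => /eqP; rewrite mulf_eq0 (negPf (wt_neq0 _ _)) /=.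
case: ifP => _.
  move=> /[swap] /negPf xn; rewrite fan_coef xn mulf_eq0 => /orP[|/eqP//].
  by move/eqP=> s0; have := fsgn_sq K (n.*2 + ~~ s.2) x.2; rewrite s0 mul0r => /esym/eqP; rewrite oner_eq0.
by rewrite ban_coef mulf_eq0 pnatr_eq0 => /eqP.
Qed.

(** Removing one quantum loses no information: the coefficient at [y] after annihilation is a
    nonzero multiple of the coefficient at [x] before. *)
Lemma state_split x : x <> vst ->
  exists (s : species) (n : nat) y, num x = (num y).+1 /\ forall v : fock, osc s n v y = 0 -> v x = 0.
Proof.
have decode i : i = ((i./2).*2 + ~~ ~~ odd i)%N by rewrite negbK addnC odd_double_half.
elim/state_ind: x => // [x i _ _|x i ix _ _].
  exists (false, ~~ odd i), i./2, x; split; first by rewrite /num stat_inc.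
  by move=> v /osc_coef /=; rewrite -decode.
exists (true, ~~ odd i), i./2, x; split; first by rewrite /num stat_fsetU1.
by move=> v /osc_coef /=; rewrite -decode; apply.
Qed.

Lemma annihilated_vac v : (forall s (n : nat), osc s n v = 0) -> v = vev v *: vac.
Proof.
move=> v0; apply: freemodP => x; rewrite fm_scaleE basE.
have [->|/eqP xv] := eqVneq x vst; first by rewrite mulr1.
by have [s [n [y [_ ->]]]] := state_split xv; rewrite ?mulr0 // v0 fm_zeroE.
Qed.

Lemma num_inc (x : state) i : num (inc x.1 i, x.2) = (num x).+1.
Proof. by rewrite /num stat_inc. Qed.
Lemma num_fsetU1 (x : state) i : i \notin x.2 -> num (x.1, (i |` x.2)%fset) = (num x).+1.
Proof. exact: stat_fsetU1. Qed.

Lemma osc_bas s k (x : state) : exists (c : K) y, osc s k (bas K x) = c *: bas K y /\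
  (c != 0 -> if k < 0 then num y = (num x).+1 else num x = (num y).+1).
Proof.
case: k => n; rewrite /osc; case: s => -[] e /=.
- rewrite fanE; case: ifPn => ix; last by exists 0, x; rewrite scaler0 scale0r eqxx.
  eexists _, _; split=> [|_]; first by rewrite scalerA.
  have iD : (n.*2 + ~~ e)%N \notin (x.2 `\ (n.*2 + ~~ e)%N)%fset by rewrite !inE eqxx.
  by rewrite -(num_fsetU1 (x := (x.1, _)) iD) /= fsetD1K // -surjective_pairing.
- rewrite banE; have [nx|nx] := posnP (x.1 (n.*2 + ~~ e)%N).
    by exists 0, x; rewrite nx !scale0r scaler0 eqxx.
  eexists _, _; split=> [|_]; first by rewrite scalerA.
  by rewrite -(num_inc (dec x.1 (n.*2 + ~~ e)%N, x.2) (n.*2 + ~~ e)%N) /= decK -?surjective_pairing.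
- rewrite fcrE; case: ifPn => ix; first by exists 0, x; rewrite scale0r eqxx.
  by eexists _, _; split=> [//|_]; rewrite num_fsetU1.
by rewrite bcrE; exists 1; eexists; rewrite scale1r; split=> [//|_]; rewrite num_inc.
Qed.

Lemma osc_binc (x : state) i :
  osc (false, odd i) (Negz i./2) (bas K x) = bas K (inc x.1 i, x.2).
Proof. by rewrite /osc /= addnC odd_double_half bcrE. Qed.

Lemma osc_finc (x : state) i : i \notin x.2 ->
  osc (true, odd i) (Negz i./2) (bas K x) = fsgn K i x.2 *: bas K (x.1, (i |` x.2)%fset).
Proof. by move=> /negPf ix; rewrite /osc /= addnC odd_double_half fcrE ix. Qed.

Lemma fsgn_neq0 i (S : {fset nat}) : fsgn K i S != 0.
Proof.
by apply: contra_eq_neq (fsgn_sq K i S) => ->; rewrite mul0r eq_sym oner_eq0.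
Qed.

Lemma state_create (x : state) : x <> vst -> exists s (n : nat) y, exists2 c : K, c != 0 &
  num x = (num y).+1 /\ osc s (Negz n) (bas K y) = c *: bas K x.
Proof.
elim/state_ind: x => // [x i _ _|x i ix _ _].
  exists (false, odd i), i./2, x; exists 1; rewrite ?oner_eq0 //.
  by rewrite num_inc osc_binc scale1r.
exists (true, odd i), i./2, x; exists (fsgn K i x.2); first exact: fsgn_neq0.
by rewrite num_fsetU1 // osc_finc.
Qed.

End Oscillators.
Arguments vev : simpl never.
Global Opaque vev.

(** * Normally ordered bilinears and the N=4 modes *)

Section FiniteSupportSums.
Variables (K : nzRingType) (V : lmodType K).
Implicit Types x y : int -> V.

(** The value is 0 by default when the support is infinite; hence the [finsum] hypotheses below. *)
Definition zsum x : V := \sum_(k \in [set: int]) x k.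

Definition finsum x := exists A : {fset int}, forall k, k \notin A -> x k = 0.

Lemma zsumE x (A : {fset int}) : (forall k, k \notin A -> x k = 0) ->
  zsum x = \sum_(k <- A) x k.
Proof. exact: fsbigTE. Qed.

Lemma eq_zsum x y : x =1 y -> zsum x = zsum y.
Proof. by move=> /funext->. Qed.

Lemma zsum_eq0 x : (forall k, x k = 0) -> zsum x = 0.
Proof. by move=> x0; rewrite (@zsumE _ fset0) ?big_seq_fset0. Qed.

Lemma zsum_eq1 x c : (forall k, k != c -> x k = 0) -> zsum x = x c.
Proof.
move=> x0; rewrite (@zsumE _ [fset c]%fset) ?big_seq_fset1 // => k.
by rewrite inE => /x0.
Qed.

Lemma zsum_shift c x : zsum (fun k => x (k + c)) = zsum x.
Proof.
apply/esym/reindex_fsbigT.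
by exists (fun k => k - c) => k; rewrite ?addrK ?subrK.
Qed.

Lemma zsum_refl c x : zsum (fun k => x (c - k)) = zsum x.
Proof.
apply/esym/reindex_fsbigT.
by exists (fun k => c - k) => k; rewrite opprB addrC subrK.
Qed.

Lemma finsum2 x y : finsum x -> finsum y -> exists A : {fset int},
  (forall k, k \notin A -> x k = 0) /\ (forall k, k \notin A -> y k = 0).
Proof.
move=> [A hA] [B hB]; exists (A `|` B)%fset.
by split=> k; rewrite inE negb_or => /andP[/hA ? /hB ?].
Qed.

Lemma zsumD x y : finsum x -> finsum y -> zsum (fun k => x k + y k) = zsum x + zsum y.
Proof.
move=> fx fy; have [A [hx hy]] := finsum2 fx fy.
rewrite (zsumE hx) (zsumE hy) (@zsumE _ A) ?big_split // => k kA.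
by rewrite hx // hy // addr0.
Qed.

Lemma zsum_linear (f : {linear V -> V}) x : finsum x ->
  f (zsum x) = zsum (fun k => f (x k)).
Proof.
move=> [A hA]; rewrite (zsumE hA) linear_sum (@zsumE _ A) // => k /hA->.
exact: linear0.
Qed.

Lemma finsumD x y : finsum x -> finsum y -> finsum (fun k => x k + y k).
Proof.
move=> fx fy; have [A [hx hy]] := finsum2 fx fy.
by exists A => k kA; rewrite hx // hy // addr0.
Qed.

Lemma finsum_linear (f : {linear V -> V}) x : finsum x -> finsum (fun k => f (x k)).
Proof. by move=> [A hA]; exists A => k /hA->; rewrite linear0. Qed.

Lemma zsum_range x (M : int) (n : nat) :
  (forall k, k < M -> x k = 0) -> (forall k, M + n%:Z <= k -> x k = 0) ->
  zsum x = \sum_(i < n) x (M + i%:Z).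
Proof.
move=> hM hN; rewrite -(big_mkord xpredT (fun i => x (M + i%:Z))) /index_iota subn0.
rewrite -(big_map (fun i => M + i%:Z) xpredT) /zsum.
set r := [seq _ | i <- _]; transitivity (\sum_(i <- r | i \in [set: int]%classic) x i).
  apply: fsbigE => //; first by rewrite map_inj_uniq ?iota_uniq // => i j; lia.
  move=> k _; have [/hM//|Mk] := ltP k M; have [/hN//|kN] := leP (M + n%:Z) k.
  by case/negP; apply/mapP; exists `|k - M|%N; rewrite ?mem_iota; lia.
by apply: eq_bigl => i; rewrite in_setT.
Qed.

Lemma finsum_bound x (M N : int) :
  (forall k, k < M -> x k = 0) -> (forall k, N < k -> x k = 0) -> finsum x.
Proof.
move=> hM hN.
exists (seq_fset tt [seq (M + i%:Z)%R | i <- iota 0 `|N - M|.+1]) => k.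
rewrite seq_fsetE => kA.
have [/hM//|Mk] := ltP k M; have [/hN//|kN] := ltP N k; case/negP: kA.
by apply/mapP; exists `|k - M|%N; rewrite ?mem_iota; lia.
Qed.

Lemma finsum1 x c : (forall k, k != c -> x k = 0) -> finsum x.
Proof. by move=> x0; exists [fset c]%fset => k; rewrite inE => /x0. Qed.

(* Telescoping: the series of differences of a function vanishing at -oo and
   equal to c near +oo. *)
Lemma zsum_telescope (f : int -> V) (c : V) (M N p q : int) :
  (forall k, k < M -> f k = 0) -> (forall k, N < k -> f k = c) ->
  finsum (fun k => f (k + p) - f (k + q)) /\
  zsum (fun k => f (k + p) - f (k + q)) = (p - q)%:~R *: c.
Proof.
move=> hM hN.
have fin r s : finsum (fun k => f (k + r) - f (k + s)).
  apply: (@finsum_bound _ (M - `|r|%N%:Z - `|s|%N%:Z) (N + `|r|%N%:Z + `|s|%N%:Z)) => k kb.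
    by rewrite !hM ?subrr //; lia.
  by rewrite !hN ?subrr //; lia.
split; first exact: fin.
have step : zsum (fun k => f (k + 1) - f k) = c.
  pose M' := Num.min M N; pose n := `|N - M'|.+2%N.
  rewrite (@zsum_range _ (M' - 1) n) => [|k kM|k kM]; last 2 first.
  - by rewrite !hM ?subrr //; lia.
  - by rewrite !hN ?subrr //; lia.
  rewrite -(big_mkord xpredT (fun i => f (M' - 1 + i%:Z + 1) - f (M' - 1 + i%:Z))).
  under eq_bigr do rewrite -addrA -PoszD addn1.
  rewrite (telescope_sumr (fun i => f (M' - 1 + i%:Z))) //.
  by rewrite hN ?hM ?subr0 //; lia.
have stepr r : zsum (fun k => f (k + (r + 1)) - f (k + r)) = c.
  rewrite -step -[RHS](zsum_shift r); apply: eq_zsum => k.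
  by rewrite [r + 1]addrC addrA addrAC.
have stepn (n : nat) : zsum (fun k => f (k + n%:Z) - f (k + 0)) = n%:R *: c.
  elim: n => [|n IH].
    by rewrite scale0r zsum_eq0 // => k; rewrite subrr.
  rewrite -addn1 natrD scalerDl scale1r -IH -(stepr n%:Z) -zsumD ?PoszD //.
  by apply: eq_zsum => k; rewrite [RHS]addrC [RHS]addrA subrK.
(* A reindexing by [- q] leaves only the difference of the two shifts. *)
transitivity (zsum (fun k => f (k + (p - q)) - f (k + 0))).
  rewrite -[LHS](zsum_shift (- q)); apply: eq_zsum => k.
  by rewrite addr0 -!addrA addNr addr0 [- q + p]addrC.
case: (p - q) => n; first exact: stepn.
rewrite NegzE -[LHS](zsum_shift n.+1%:Z) rmorphN scaleNr /= -stepn.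
transitivity (zsum (fun k => - (f (k + n.+1%:Z) - f (k + 0)))).
  by apply: eq_zsum => k; rewrite opprB !addr0 addrK.
have [A hA] := fin n.+1%:Z 0; rewrite (zsumE hA) (@zsumE _ A) ?sumrN // => k /hA->.
by rewrite oppr0.
Qed.

End FiniteSupportSums.

Ltac fock_coefs := apply: freemodP => ?;
  rewrite ?(fm_addE, fm_scaleE, fm_oppE, fm_zeroE).
Ltac fock_ring := fock_coefs; ring.
Ltac fock_field := fock_coefs; field.

(** * Normally ordered bilinears in the oscillators *)

Section Quadratics.
Variable K : numFieldType.
Local Notation fock := (freemod K state).
Local Notation osc := (@osc K).
Local Notation om := (@om K).
Local Notation wt := (@wt K).
Local Notation hat := (@hat K).
Local Notation vac := (@vac K).
Implicit Types (s t r : species) (k l m p : int) (v : fock).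
Implicit Types f : int -> K.

Lemma sgpDr a b c : sgp K a (b (+) c) = sgp K a b * sgp K a c.
Proof. by rewrite /sgp -signr_addb; case: a. Qed.
Lemma sgpDl a b c : sgp K (a (+) b) c = sgp K a c * sgp K b c.
Proof. by rewrite ![sgp K _ c]sgpC sgpDr. Qed.

(** It is enough to test the second factor: when it annihilates, it already stands on the right. *)
Definition nop s l t k v : fock :=
  if k < 0 then sgp K s.1 t.1 *: osc t k (osc s l v) else osc s l (osc t k v).

(** The halves hidden in the two mode indices add up to 1, so with the first index [m - 1 - k] the
    total index is [m]. *)
Definition quad s t f m v : fock := zsum (fun k => f k *: nop s (m - 1 - k) t k v).

Lemma nopE s l t k v :
  nop s l t k v = osc s l (osc t k v) - (if k < 0 then om s l t k else 0) *: v.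
Proof.
rewrite /nop; case: ifP => _; last by rewrite scale0r subr0.
by rewrite [in RHS]osc_comm addrK.
Qed.

Fact nop_linear s l t k : linear (nop s l t k).
Proof.
move=> a u v; rewrite /nop; by case: ifP => _; rewrite !linearP //= scalerDr.
Qed.
HB.instance Definition _ s l t k := GRing.isLinear.Build K fock fock *:%R (nop s l t k)
  (nop_linear s l t k).

Lemma quad_finsum s t f m v : finsum (fun k => f k *: nop s (m - 1 - k) t k v).
Proof.
have [N hN] := osc_tame v.
apply: (@finsum_bound _ _ _ (Num.min 0 (m - N%:Z - 1)) N%:Z) => k kb.
  by rewrite /nop ifT ?hN ?linear0 ?scaler0 //; lia.
by rewrite /nop ifF ?hN ?linear0 ?scaler0 //; lia.
Qed.

Fact quad_linear s t f m : linear (quad s t f m).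
Proof.
move=> a u v; rewrite /quad.
have -> : a *: zsum (fun k => f k *: nop s (m - 1 - k) t k u) =
    zsum (fun k => a *: (f k *: nop s (m - 1 - k) t k u)).
  exact: (zsum_linear (a \*: idfun)) (quad_finsum s t f m u).
rewrite -zsumD; last 2 first.
- exact: (finsum_linear (a \*: idfun)) (quad_finsum s t f m u).
- exact: quad_finsum.
apply: eq_zsum => k.
by rewrite linearP /= scalerDr !scalerA mulrC.
Qed.
HB.instance Definition _ s t f m := GRing.isLinear.Build K fock fock *:%R (quad s t f m)
  (quad_linear s t f m).

Definition wtc t p r : K := if r == conj t then wt t (- 1 - p) else 0.

Lemma om_wtc t p r : om t (- 1 - p) r p = wtc t p r.
Proof. by rewrite /om /wtc (_ : _ + 1 == 0 = true) ?andbT //; lia. Qed.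

Lemma om_eq0 s k t l : k + l + 1 != 0 -> om s k t l = 0.
Proof. by rewrite /om => /negPf->; rewrite andbF. Qed.

Lemma nop_osc s l t k r p v : nop s l t k (osc r p v) =
  sgp K (s.1 (+) t.1) r.1 *: osc r p (nop s l t k v)
  + om t k r p *: osc s l v + (sgp K t.1 r.1 * om s l r p) *: osc t k v.
Proof.
rewrite !nopE [osc t k (osc r p v)]osc_comm linearP linearZ /=.
rewrite [osc s l (osc r p _)]osc_comm linearB linearZ /= scalerDr scalerBr.
have -> : sgp K (s.1 (+) t.1) r.1 = sgp K s.1 r.1 * sgp K t.1 r.1.
  exact: sgpDl.
have [/eqP ts|ts] := boolP (t == conj s); last first.
  have -> : om s l t k = 0 by rewrite /om (negPf ts).
  by rewrite if_same !scale0r !linear0; fock_ring.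
have -> : sgp K s.1 r.1 * sgp K t.1 r.1 = 1 by rewrite ts /= sgp_sq.
have -> : sgp K s.1 r.1 = sgp K t.1 r.1 by rewrite ts.
rewrite [osc r p (_ *: v)]linearZ /= [_ *: (_ *: osc r p _)]scalerA sgp_sq.
by set c := (if _ then _ else _); fock_ring.
Qed.

(** Wick's rule: a contraction of [osc r p] with the second factor selects the term k = - 1 - p, and
    one with the first factor the term k = m + p. *)
Lemma quad_osc s t f m r p v : quad s t f m (osc r p v) =
  sgp K (s.1 (+) t.1) r.1 *: osc r p (quad s t f m v)
  + (f (- 1 - p) * wtc t p r) *: osc s (m + p) v
  + (sgp K t.1 r.1 * f (m + p) * wtc s p r) *: osc t (m + p) v.
Proof.
pose x1 k := f k *: (sgp K (s.1 (+) t.1) r.1 *: osc r p (nop s (m - 1 - k) t k v)).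
pose x2 k := f k *: (om t k r p *: osc s (m - 1 - k) v).
pose x3 k := f k *: ((sgp K t.1 r.1 * om s (m - 1 - k) r p) *: osc t k v).
have h2 k : k != - 1 - p -> x2 k = 0.
  by move=> kp; rewrite /x2 om_eq0 ?scale0r ?scaler0 //; lia.
have h3 k : k != m + p -> x3 k = 0.
  by move=> kp; rewrite /x3 om_eq0 ?mulr0 ?scale0r ?scaler0 //; lia.
have x1E : x1 =1 fun k => (sgp K (s.1 (+) t.1) r.1 \*: osc r p) (f k *: nop s (m - 1 - k) t k v).
  by move=> k; rewrite /x1 /= [osc r p (_ *: _)]linearZ /= !scalerA [f k * _]mulrC.
have f1 : finsum x1.
  rewrite (funext x1E); apply: finsum_linear; exact: quad_finsum.
transitivity (zsum (fun k => x1 k + x2 k + x3 k)).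
  by apply: eq_zsum => k; rewrite nop_osc !scalerDr.
rewrite !zsumD //; [|exact: finsum1 h2|apply: finsumD => //; exact: finsum1 h2|exact: finsum1 h3].
rewrite (zsum_eq1 h2) (zsum_eq1 h3) (eq_zsum x1E) -zsum_linear; last exact: quad_finsum.
rewrite /x2 /x3 /=.
have -> : m - 1 - (- 1 - p) = m + p by lia.
have -> : m - 1 - (m + p) = - 1 - p by lia.
by rewrite !om_wtc !scalerA [f (m + p) * _]mulrC -!mulrA [wtc _ _ _ * f _]mulrC.
Qed.

(* An operator is determined by its supercommutators with the oscillators and
   its vacuum expectation value. *)
Lemma osc_central (b : bool) (D : {linear fock -> fock}) :
    (forall s p v, D (osc s p v) = sgp K b s.1 *: osc s p (D v)) ->
    vev (D vac) = 0 -> forall v, D v = 0.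
Proof.
move=> Dc D0; have Dvac : D vac = 0.
  rewrite [LHS]annihilated_vac ?D0 ?scale0r // => s n.
  have : D (osc s n vac) = 0 by rewrite osc_vac ?linear0.
  rewrite Dc => /(congr1 (fun u => sgp K b s.1 *: u)).
  by rewrite scaler0 scalerA sgp_sq scale1r.
elim/fock_ind => [|a u v Du Dv||s n v Dv]; rewrite ?linear0 ?linearP ?Du ?Dv //.
  by rewrite scaler0 addr0.
by rewrite Dc Dv linear0 scaler0.
Qed.

(** The bound is uniform in [f]: when the total index is large, one of the two factors has an index
    that already annihilates [v]. *)
Lemma quad_field s t v : exists N : nat, forall f m, N%:Z <= m -> quad s t f m v = 0.
Proof.
have [N hN] := osc_tame v; exists (N.*2.+1)%N => f m Nm; apply: zsum_eq0 => k.
have [kN|kN] := leP N%:Z k; first by rewrite nopE hN ?linear0 // ifF ?scale0r ?subr0 ?scaler0 //; lia.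
rewrite /nop; case: ifPn => k0; first by rewrite hN ?linear0 ?scaler0 //; lia.
by rewrite osc_comm hN ?om_eq0 ?linear0 ?scale0r ?scaler0 ?addr0 ?scaler0 //; lia.
Qed.

Lemma vev_zsum (x : int -> fock) : finsum x -> vev (zsum x) = zsum (fun k => vev (x k) : K^o).
Proof.
move=> [A hA]; rewrite (zsumE hA) (@zsumE _ _ _ A) => [|k /hA->]; last exact: vev0.
exact: vev_sum.
Qed.

Lemma vev_quad_vac s t f m : vev (quad s t f m vac) = 0.
Proof.
rewrite vev_zsum; last exact: quad_finsum.
apply: zsum_eq0 => k.
rewrite vevZ /nop; case: ifPn => k0; last first.
  by rewrite -leNgt in k0; rewrite (osc_vac _ _ k0) linear0 vev0 mulr0.
by case: k k0 => // k _; rewrite vevZ vev_osc !mulr0.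
Qed.

Definition parity_op : fock -> fock :=
  lext (fun x : state => (- 1) ^+ #|` x.2| *: bas K x : fock).
HB.instance Definition _ := GRing.Linear.on parity_op.

Lemma parity_opE (x : state) : parity_op (bas K x) = (- 1) ^+ #|` x.2| *: bas K x.
Proof. exact: lext_bas. Qed.

Lemma parity_opK : involutive parity_op.
Proof.
apply: (@lin_ext _ _ _ (parity_op \o parity_op) idfun) => x /=.
rewrite parity_opE linearZ /= parity_opE scalerA.
by rewrite -exprMn mulrNN mulr1 expr1n scale1r.
Qed.

Lemma parity_op_osc s k v : parity_op (osc s k v) = (- 1) ^+ s.1 *: osc s k (parity_op v).
Proof.
apply: (@lin_ext _ _ _ (parity_op \o osc s k) (((- 1) ^+ s.1 \*: osc s k) \o parity_op)) => x /=.
rewrite parity_opE linearZ /=.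
case: k => n; rewrite /osc; case: s => -[] e /=; rewrite ?expr0 ?expr1 ?scale1r.
- rewrite fanE; case: ifPn => ix; last by rewrite !(linear0, scaler0).
  rewrite !linearZ /= parity_opE /= [#|` x.2|](cardfsD1 (n.*2 + ~~ e)) ix /= add1n exprS.
  by rewrite !scalerA; congr (_ *: _); ring.
- by rewrite banE !linearZ /= parity_opE /= !scalerA; congr (_ *: _); ring.
- rewrite fcrE; case: ifPn => ix; first by rewrite !(linear0, scaler0).
  by rewrite !linearZ /= parity_opE /= cardfsU1 ix exprS !scalerA; congr (_ *: _); ring.
by rewrite bcrE parity_opE.
Qed.

Lemma parity_op_quad s t f m v :
  parity_op (quad s t f m v) = (- 1) ^+ (s.1 (+) t.1) *: quad s t f m (parity_op v).
Proof.
rewrite zsum_linear; last exact: quad_finsum.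
have sg : (- 1) ^+ (s.1 (+) t.1) = (- 1) ^+ s.1 * (- 1) ^+ t.1 :> K.
  by rewrite signr_addb.
have -> : (- 1) ^+ (s.1 (+) t.1) *: quad s t f m (parity_op v) =
    zsum (fun k => (- 1) ^+ (s.1 (+) t.1) *: (f k *: nop s (m - 1 - k) t k (parity_op v))).
  exact: (zsum_linear ((- 1) ^+ (s.1 (+) t.1) \*: idfun)) (quad_finsum _ _ _ _ _).
apply: eq_zsum => k; rewrite sg linearZ /= [RHS]scalerA [_ * f k]mulrC -[RHS]scalerA.
congr (f k *: _); rewrite /nop.
have pp r l q n u : parity_op (osc r l (osc q n u)) =
    ((- 1) ^+ r.1 * (- 1) ^+ q.1) *: osc r l (osc q n (parity_op u)).
  by rewrite !parity_op_osc linearZ /= scalerA.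
case: ifP => _; last by rewrite pp.
by rewrite [LHS]linearZ /= pp; fock_ring.
Qed.

End Quadratics.
Arguments quad : simpl never.
Arguments nop : simpl never.
Global Opaque osc quad.

(** * The N=4 generators as bilinears, and their action on oscillators *)

Section Modes.
Variable K : numFieldType.
Local Notation fock := (freemod K state).
Local Notation osc := (@osc K).
Local Notation om := (@om K).
Local Notation wt := (@wt K).
Local Notation hat := (@hat K).
Local Notation vac := (@vac K).
Local Notation quad := (@quad K).
Implicit Types (a b : N4gen) (s t r : species) (k l m n p : int) (v : fock).

Local Notation gp := (false, true).
Local Notation gm := (false, false).
Local Notation xp := (true, true).
Local Notation xm := (true, false).

(** The coefficient m/2 - hat k comes from the weight 1/2 stress tensor (gamma^+ d gamma^- - d
    gamma^+ gamma^-)/2. The constant at m = 0 is the ground state energy -1/8 of weight 1 fermions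
    with half-integral modes; the bosons contribute none. *)
Definition modeop a m v : fock :=
  match a with
  | L => quad gp gm (fun k => m%:~R / 2%:R - hat k) m v - quad xp xm (fun=> 1) m v
         - (if m == 0 then 8%:R^-1 else 0) *: v
  | J0 => - quad gp gm (fun=> 1) m v
  | Jp => 2%:R^-1 *: quad gp gp (fun=> 1) m v
  | Jm => - (2%:R^-1 *: quad gm gm (fun=> 1) m v)
  | Gp => quad gp xp (fun=> 1) m v
  | Gm => quad gm xp (fun=> 1) m v
  | Gbp => quad gp xm (fun=> 1) m v
  | Gbm => - quad gm xm (fun=> 1) m v
  end.

Fact modeop_linear a m : linear (modeop a m).
Proof.
move=> c u v; case: a; rewrite /modeop !linearP //=; fock_ring.
Qed.
HB.instance Definition _ a m := GRing.isLinear.Build K fock fock *:%R (modeop a m)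
  (modeop_linear a m).
Arguments modeop : simpl never.

(* [a_m, X^s_p] = adc a s m p *: X^(adt a s)_(m + p) for the oscillators X. *)
Definition adt a s : species :=
  match a, s with
  | Jp, (false, _) => gp
  | Jm, (false, _) => gm
  | Gp, (false, _) => xp
  | Gp, (true, _) => gp
  | Gm, (false, _) => xp
  | Gm, (true, _) => gm
  | Gbp, (false, _) => xm
  | Gbp, (true, _) => gp
  | Gbm, (false, _) => xm
  | Gbm, (true, _) => gm
  | _, s => s
  end.

Definition adc a s m p : K :=
  match a, s with
  | L, (false, _) => - (hat p + m%:~R / 2%:R)
  | L, (true, _) => - hat p
  | J0, (false, e) => if e then 1 else - 1
  | Jp, (false, false) => 1
  | Jm, (false, true) => 1
  | Gp, (false, false) => 1
  | Gp, (true, false) => - hat p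
  | Gm, (false, true) => - 1
  | Gm, (true, false) => - hat p
  | Gbp, (false, false) => 1
  | Gbp, (true, true) => hat p
  | Gbm, (false, true) => 1
  | Gbm, (true, true) => - hat p
  | _, _ => 0
  end.

Lemma modeop_osc a m s p v : modeop a m (osc s p v) =
  sgp K (N4odd a) s.1 *: osc s p (modeop a m v) + adc a s m p *: osc (adt a s) (m + p) v.
Proof.
case: a; case: s => -[] [];
  rewrite /modeop !quad_osc ?(oscD, oscN, oscZ) /wtc /conj /=
    /wt /hat /sgp /= ?expr0 ?expr1 ?rmorphB ?rmorphD ?rmorphN /= ?rmorph1;
  by fock_field.
Qed.

Lemma adt_parity a s m p : adc a s m p != 0 -> (adt a s).1 = N4odd a (+) s.1.
Proof. by case: a; case: s => -[] [] //=; rewrite eqxx. Qed.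

(** The two actions compose through [adt]; the terms in which only one of the two modes meets the
    oscillator cancel by the sign rule. *)
Lemma comm_osc a b m n s p v (C : fock -> fock) :
    (forall v, C v = modeop a m (modeop b n v)
                 - sgp K (N4odd a) (N4odd b) *: modeop b n (modeop a m v)) ->
  C (osc s p v) = sgp K (N4odd a (+) N4odd b) s.1 *: osc s p (C v)
    + ((adc b s n p * adc a (adt b s) m (n + p)) *: osc (adt a (adt b s)) (m + n + p) v
       - (sgp K (N4odd a) (N4odd b) * adc a s m p * adc b (adt a s) n (m + p))
           *: osc (adt b (adt a s)) (m + n + p) v).
Proof.
move=> CE; rewrite !CE.
rewrite (modeop_osc b n) (modeop_osc a m s).
rewrite [modeop a m (_ + _)]linearD [modeop b n (_ + _)]linearD.
rewrite /= ![modeop _ _ (_ *: _)]linearZ /= !modeop_osc !addrA [n + m]addrC.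
rewrite [osc s p (_ - _)]oscD oscN oscZ.
have sq := sgp_sq K (N4odd a) (N4odd b); rewrite sgpDl.
have [->|ca] := eqVneq (adc a s m p) 0; last rewrite (adt_parity ca) sgpDr [sgp K (N4odd b) (N4odd a)]sgpC.
  rewrite !(scale0r, mul0r, mulr0).
  have [->|cb] := eqVneq (adc b s n p) 0; last rewrite (adt_parity cb) sgpDr.
    by rewrite !(scale0r, mul0r, mulr0); fock_ring.
  by fock_ring.
have [->|cb] := eqVneq (adc b s n p) 0; last rewrite (adt_parity cb) sgpDr.
  by rewrite !(scale0r, mul0r, mulr0); fock_coefs; ring: sq.
by fock_coefs; ring: sq.
Qed.

Lemma modeop_vac a m : 0 <= m -> modeop a m vac =
  (if (N4rank a == 0%N) && (m == 0) then - 8%:R^-1 else 0) *: vac.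
Proof.
move=> m0; have q0 s t f : quad s t f m vac = 0.
  apply: zsum_eq0 => k; rewrite /nop; case: ifPn => k0.
    by rewrite osc_vac ?linear0 ?scaler0 //; lia.
  by rewrite -leNgt in k0; rewrite (osc_vac _ _ k0) linear0 ?scaler0.
case: a; rewrite /modeop !q0 /= ?oppr0 ?scaler0 ?scale0r ?oppr0 ?subr0 //.
by rewrite addr0 sub0r; case: ifP => _; rewrite ?scaleNr // scale0r oppr0.
Qed.

Lemma vev_modeop a m :
  vev (modeop a m vac) = if (N4rank a == 0%N) && (m == 0) then - 8%:R^-1 else 0.
Proof.
case: a; rewrite /modeop ?vevD ?(vevN, vevZ) ?vev_quad_vac ?vevZ ?vev_quad_vac ?mulr0 ?oppr0 //=.
by rewrite !add0r vev_vac mulr1; case: ifP; rewrite ?oppr0.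
Qed.

(** On the vacuum only products of two creators survive, and [modeop a m] has to turn one of them
    into the annihilator of the other. This leaves the N indices k = -1, ..., -N. *)
Lemma vev_modeop_quad a s t f m n : vev (modeop a m (quad s t f n vac)) =
  if (m + n == 0) && (s == conj (adt a t)) then
    if m is Posz N then
      \sum_(i < N) f (- (i.+1%:Z)) * sgp K s.1 t.1
         * adc a t m (- (i.+1%:Z)) * wt (adt a t) (m - i.+1%:Z)
    else 0
  else 0.
Proof.
rewrite (@zsum_linear _ _ (modeop a m)); last exact: quad_finsum.
rewrite vev_zsum; last by apply: finsum_linear; exact: quad_finsum.
have term k : vev (modeop a m (f k *: nop s (n - 1 - k) t k vac)) =
    if (k < 0) && (n - 1 - k < 0) then
      f k * sgp K s.1 t.1 * adc a t m k * om (adt a t) (m + k) s (n - 1 - k)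
    else 0.
  rewrite linearZ vevZ /= /nop; case: ifPn => k0 /=; last first.
    by rewrite -leNgt in k0; rewrite (osc_vac _ _ k0) !linear0 vev0 mulr0.
  rewrite [modeop a m _]linearZ vevZ /=; case: ifPn => l0; last first.
    by rewrite -leNgt in l0; rewrite (osc_vac _ _ l0) !linear0 vev0 !mulr0.
  case: k k0 l0 => // k _; case: (n - 1 - _) => // l _.
  by rewrite modeop_osc vevD !vevZ vev_osc vev_osc2 mulr0 add0r !mulrA.
rewrite (eq_zsum term); case: ifPn => [/andP[/eqP mn /eqP sE]|mns]; last first.
  apply: zsum_eq0 => k; case: ifP => // _; rewrite /om.
  case: andP => [[sE /eqP kE]|_]; last by rewrite mulr0.
  by case/negP: mns; rewrite sE andbT; apply/eqP; lia.
case: m mn {term} => N mn; last by apply: zsum_eq0 => k; rewrite ifF //; lia.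
rewrite (@zsum_range _ _ _ (- N%:Z) N) => [|k kN|k kN].
- rewrite [RHS](reindex_inj rev_ord_inj) /=; apply: eq_bigr => i _.
  have iN := ltn_ord i; rewrite ifT; last by lia.
  have -> : - N%:Z + i%:Z = - (N - i.+1).+1%:Z by lia.
  by rewrite /om sE eqxx ifT //=; apply/eqP; lia.
- by rewrite ifF //; lia.
by rewrite ifF //; lia.
Qed.

Lemma modeop_def a m v : modeop a m v =
  match a with
  | L => quad gp gm (fun k => m%:~R / 2%:R - hat k) m v
         - quad xp xm (fun=> 1) m v
         - (if m == 0 then 8%:R^-1 else 0) *: v
  | J0 => - quad gp gm (fun=> 1) m v
  | Jp => 2%:R^-1 *: quad gp gp (fun=> 1) m v
  | Jm => - (2%:R^-1 *: quad gm gm (fun=> 1) m v)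
  | Gp => quad gp xp (fun=> 1) m v
  | Gm => quad gm xp (fun=> 1) m v
  | Gbp => quad gp xm (fun=> 1) m v
  | Gbm => - quad gm xm (fun=> 1) m v
  end.
Proof. by []. Qed.

End Modes.
Arguments modeop : simpl never.
Global Opaque modeop.

(** * The commutation relations at central charge -3 *)

Section Commutators.
Variable K : numFieldType.
Local Notation fock := (freemod K state).
Local Notation osc := (@osc K).
Local Notation modeop := (@modeop K).
Local Notation vac := (@vac K).
Local Notation quad := (@quad K).
Implicit Types (a b : N4gen) (s t r : species) (k l m n p : int) (v : fock).

Lemma modeopD a m u v : modeop a m (u + v) = modeop a m u + modeop a m v.
Proof. exact: linearD. Qed.
Lemma modeopN a m v : modeop a m (- v) = - modeop a m v.
Proof. exact: linearN. Qed.
Lemma modeopZ a m c v : modeop a m (c *: v) = c *: modeop a m v.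
Proof. exact: linearZ. Qed.

Definition gweight a : K :=
  match a with L => 2%:R | J0 | Jp | Jm => 1 | _ => 3%:R / 2%:R end.

(* [N4bracket] at central charge -3, over an arbitrary field K of scalars. *)
Definition gbracket a b : seq (K * nat * N4elt) :=
  match a, b with
  | L, L => [:: (1, 0%N, Der L); (2%:R, 1%N, Fld L); (- 3%:R / 12%:R, 3%N, Vac)]
  | L, x => [:: (1, 0%N, Der x); (gweight x, 1%N, Fld x)]
  | J0, J0 => [:: (- 3%:R / 3%:R, 1%N, Vac)]
  | J0, Jp => [:: (2%:R, 0%N, Fld Jp)]
  | J0, Jm => [:: (- 2%:R, 0%N, Fld Jm)]
  | Jp, Jm => [:: (1, 0%N, Fld J0); (- 3%:R / 6%:R, 1%N, Vac)]
  | J0, Gp => [:: (1, 0%N, Fld Gp)]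
  | J0, Gm => [:: (- 1, 0%N, Fld Gm)]
  | J0, Gbp => [:: (1, 0%N, Fld Gbp)]
  | J0, Gbm => [:: (- 1, 0%N, Fld Gbm)]
  | Jp, Gm => [:: (1, 0%N, Fld Gp)]
  | Jm, Gp => [:: (1, 0%N, Fld Gm)]
  | Jp, Gbm => [:: (- 1, 0%N, Fld Gbp)]
  | Jm, Gbp => [:: (- 1, 0%N, Fld Gbm)]
  | Gp, Gbp => [:: (1, 0%N, Der Jp); (2%:R, 1%N, Fld Jp)]
  | Gm, Gbm => [:: (1, 0%N, Der Jm); (2%:R, 1%N, Fld Jm)]
  | Gp, Gbm => [:: (1, 0%N, Fld L); (1 / 2%:R, 0%N, Der J0); (1, 1%N, Fld J0);
                   (- 3%:R / 6%:R, 2%N, Vac)]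
  | Gm, Gbp => [:: (1, 0%N, Fld L); (- (1 / 2%:R), 0%N, Der J0); (- 1, 1%N, Fld J0);
                   (- 3%:R / 6%:R, 2%N, Vac)]
  | _, _ => [::]
  end.

Definition gelt (x : N4elt) n v : fock :=
  match x with
  | Vac => if n == 0 then v else 0
  | Fld a => modeop a n v
  | Der a => - (n%:~R + gweight a) *: modeop a n v
  end.

(** Unfolded up to the third power of lambda, the highest in the brackets, so that [field] can
    compute with it. *)
Definition gfalling (x : K) (j : nat) : K :=
  match j with
  | 0%N => 1 | 1%N => x | 2%N => x * (x - 1) | _ => x * (x - 1) * (x - 2%:R)
  end.

Definition gcoef a m (w : K * nat * N4elt) : K :=
  w.1.1 * gfalling (m%:~R + gweight a - 1) w.1.2.

Definition gmode_bracket a b m n v : fock :=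
  \sum_(w <- gbracket a b) gcoef a m w *: gelt w.2 (m + n) v.

Definition elt_odd (x : N4elt) : bool :=
  match x with Vac => false | Fld a | Der a => N4odd a end.
Definition elt_adc (x : N4elt) s q p : K :=
  match x with
  | Vac => 0 | Fld a => adc K a s q p | Der a => - (q%:~R + gweight a) * adc K a s q p
  end.
Definition elt_adt (x : N4elt) s : species :=
  match x with Vac => s | Fld a | Der a => adt a s end.

Lemma gelt_osc x q s p v : gelt x q (osc s p v) =
  sgp K (elt_odd x) s.1 *: osc s p (gelt x q v)
  + elt_adc x s q p *: osc (elt_adt x s) (q + p) v.
Proof.
case: x => [|a|a] /=; last 2 first.
- exact: modeop_osc.
- by rewrite modeop_osc scalerDr oscZ !scalerA [_ * sgp _ _ _]mulrC.
by rewrite scale0r addr0 /sgp expr0 scale1r; case: ifP; rewrite ?osc0.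
Qed.

Lemma gbracket_osc_gen a b m n s p v :
  all (fun w => elt_odd w.2 == N4odd a (+) N4odd b) (gbracket a b) ->
  gmode_bracket a b m n (osc s p v) =
    sgp K (N4odd a (+) N4odd b) s.1 *: osc s p (gmode_bracket a b m n v)
    + \sum_(w <- gbracket a b)
        (gcoef a m w * elt_adc w.2 s (m + n) p) *: osc (elt_adt w.2 s) (m + n + p) v.
Proof.
rewrite /gmode_bracket; elim: (gbracket a b) => [|w r IH] /=.
  by rewrite !big_nil osc0 scaler0 addr0.
move=> /andP[/eqP tE /IH{}IH]; rewrite !big_cons IH gelt_osc tE oscD oscZ.
by rewrite !scalerDr !scalerA [gcoef a m w * sgp _ _ _]mulrC addrACA.
Qed.

(** The correction term is literally that of [comm_osc], so that the commutator minus the bracket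
    supercommutes with every oscillator. *)
Lemma gbracket_osc a b m n s p v : (N4rank a <= N4rank b)%N ->
  gmode_bracket a b m n (osc s p v) =
    sgp K (N4odd a (+) N4odd b) s.1 *: osc s p (gmode_bracket a b m n v)
    + ((adc K b s n p * adc K a (adt b s) m (n + p)) *: osc (adt a (adt b s)) (m + n + p) v
       - (sgp K (N4odd a) (N4odd b) * adc K a s m p * adc K b (adt a s) n (m + p))
           *: osc (adt b (adt a s)) (m + n + p) v).
Proof.
move=> ab; rewrite gbracket_osc_gen; last by case: a b {ab} => -[].
congr (_ + _).
move: (m + n + p) => q; rewrite /gcoef /sgp.
case: a ab; case: b => //= _; case: s => -[] []; rewrite /= ?big_cons ?big_nil /=
  ?(mul0r, mulr0, scale0r, subr0, addr0, oppr0) // ?expr0 ?expr1;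
  generalize (osc (false, false) q v) (osc (false, true) q v)
     (osc (true, false) q v) (osc (true, true) q v) => u1 u2 u3 u4;
  rewrite /hat ?rmorphD /=; by fock_field.
Qed.

Lemma vev_gmode_bracket a b m n : vev (gmode_bracket a b m n vac) =
  if m + n == 0 then \sum_(w <- gbracket a b) gcoef a m w *
    (match w.2 with Vac => 1 | Fld L => - 8%:R^-1 | Der L => 4%:R^-1 | _ => 0 end) else 0.
Proof.
rewrite /gmode_bracket; have [mn|mn] := eqVneq (m + n) 0.
  elim: (gbracket a b) => [|w r IH]; first by rewrite !big_nil vev0.
  rewrite !big_cons vevD vevZ IH mn; congr (_ * _ + _).
  case: w.2 => [|x|x] /=; first by rewrite vev_vac.
    by rewrite vev_modeop; case: x.
  by rewrite vevZ vev_modeop; case: x => /=; rewrite ?mulr0 //; field.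
elim: (gbracket a b) => [|w r IH]; first by rewrite !big_nil vev0.
rewrite !big_cons vevD vevZ IH addr0; case: w.2 => [|x|x] /=.
- by rewrite (negPf mn) vev0 mulr0.
- by rewrite vev_modeop (negPf mn) andbF mulr0.
by rewrite vevZ vev_modeop (negPf mn) andbF !mulr0.
Qed.

(** The half-integers i + 1/2 with i < N add up to N^2/2, without a linear term; this is why the
    two-point functions are monomials in N. *)
Lemma sumK (N : nat) (g : 'I_N -> K) (c d : K) :
  (forall i, g i = c + d * (i%:R + 2%:R^-1)) ->
  \sum_i g i = c * N%:R + d * N%:R ^+ 2 / 2%:R.
Proof.
move=> gE; rewrite (eq_bigr _ (fun i _ => gE i)) {g gE}.
elim: N => [|N IH]; first by rewrite big_ord0; ring.
by rewrite big_ord_recr /= IH -natr1; field.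
Qed.

(* The two-point functions <a_N b_(-N)>. *)
Definition two_point a b (N : K) : K :=
  match a, b with
  | L, L => - N ^+ 3 / 4%:R
  | J0, J0 => - N
  | Jp, Jm | Jm, Jp => - N / 2%:R
  | Gp, Gbm | Gbm, Gp | Gm, Gbp | Gbp, Gm => - N ^+ 2 / 2%:R
  | _, _ => 0
  end.

Definition quad_sum a s t (f : int -> K) (N : nat) : K :=
  if s == conj (adt a t) then
    \sum_(i < N) f (- (i.+1%:Z)) * sgp K s.1 t.1
         * adc K a t N (- (i.+1%:Z)) * wt K (adt a t) (N%:Z - i.+1%:Z)
  else 0.

Lemma hatN (i : nat) : hat K (- i.+1%:Z) = - (i%:R + 2%:R^-1).
Proof. by rewrite /hat rmorphN /= -natr1; field. Qed.

Lemma hat_subS (N i : nat) : hat K (N%:Z - i.+1%:Z) = N%:R - (i%:R + 2%:R^-1).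
Proof. by rewrite /hat rmorphB /= -natr1; field. Qed.

Lemma quad_sumE a s t (f : int -> K) (N : nat) c d :
  (forall i : nat, f (- (i.+1%:Z)) * sgp K s.1 t.1 * adc K a t N%:Z (- (i.+1%:Z))
     * wt K (adt a t) (N%:Z - i.+1%:Z) = c + d * (i%:R + 2%:R^-1)) ->
  quad_sum a s t f N = if s == conj (adt a t) then c * N%:R + d * N%:R ^+ 2 / 2%:R else 0.
Proof.
by move=> h; rewrite /quad_sum; case: ifP => // _; apply: sumK => i; exact: h.
Qed.

Lemma vev_modeop_quadN a s t f (N : nat) :
  vev (modeop a N (quad s t f (- N%:Z) vac)) = quad_sum a s t f N.
Proof. by rewrite vev_modeop_quad subrr eqxx. Qed.

Ltac two_point_body N := let i := fresh "i" in
  move=> i; move: (hatN i) (hat_subS N i); move: (- i.+1%:Z) (N%:Z - i.+1%:Z);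
  rewrite /= /wt /sgp /= ?expr0 ?expr1 ?rmorphN /= -?pmulrn;
  let hk := fresh "hk" in let hk' := fresh "hk'" in
  move=> ? ? hk hk'; rewrite ?hk ?hk'; by field.
Ltac two_point_eval N c d := rewrite (@quad_sumE _ _ _ _ N c d);
  solve [rewrite /=; by field | by two_point_body N].

Lemma vev_modeop3 a m u v w c : vev (modeop a m (u - v - c *: w)) =
  vev (modeop a m u) - vev (modeop a m v) - c * vev (modeop a m w).
Proof. by rewrite !modeopD !modeopN modeopZ !vevD !vevN vevZ. Qed.

Lemma vev2 a b (N : nat) : (0 < N)%N ->
  vev (modeop a N%:Z (modeop b (- N%:Z) vac)) = two_point a b N%:R.
Proof.
move=> N0; rewrite (modeop_def b); have NZ : (- N%:Z == 0) = false by lia.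
case: b; last first.
- rewrite modeopN vevN vev_modeop_quadN.
  by case: a; first [by rewrite /quad_sum /= ?oppr0 | two_point_eval N (0 : K) (1 : K) | two_point_eval N (0 : K) (0 : K)].
- rewrite vev_modeop_quadN.
  by case: a; first [by rewrite /quad_sum /= ?oppr0 | two_point_eval N (0 : K) (-1 : K) | two_point_eval N (0 : K) (0 : K)].
- rewrite vev_modeop_quadN.
  by case: a; first [by rewrite /quad_sum /= ?oppr0 | two_point_eval N (0 : K) (-1 : K) | two_point_eval N (0 : K) (0 : K)].
- rewrite vev_modeop_quadN.
  by case: a; first [by rewrite /quad_sum /= ?oppr0 | two_point_eval N (0 : K) (-1 : K) | two_point_eval N (0 : K) (0 : K)].
- rewrite modeopN modeopZ vevN vevZ vev_modeop_quadN.
  by case: a; first [by rewrite /quad_sum /= ?mulr0 ?oppr0 | two_point_eval N (1 : K) (0 : K) | two_point_eval N (0 : K) (0 : K)].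
- rewrite modeopZ vevZ vev_modeop_quadN.
  by case: a; first [by rewrite /quad_sum /= ?mulr0 ?oppr0 | two_point_eval N (- 1 : K) (0 : K) | two_point_eval N (0 : K) (0 : K)].
- rewrite modeopN vevN vev_modeop_quadN.
  by case: a; first [by rewrite /quad_sum /= ?mulr0 ?oppr0 | two_point_eval N (1 : K) (0 : K) | two_point_eval N (0 : K) (0 : K) | two_point_eval N (N%:R / 2%:R : K) (- 1 : K)].
rewrite vev_modeop3 NZ mul0r subr0 2!vev_modeop_quadN.
case: a; last first.
- by rewrite /quad_sum /= subr0.
- by rewrite /quad_sum /= subr0.
- by rewrite /quad_sum /= subr0.
- by rewrite /quad_sum /= subr0.
- rewrite (@quad_sumE Jm (true, true) _ _ _ 0 0) /=; last by move=> i; rewrite /=; ring.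
  rewrite (@quad_sumE Jm (false, true) _ _ _ 0 0) /=; last by move=> i; rewrite /=; ring.
  by ring.
- rewrite (@quad_sumE Jp (true, true) _ _ _ 0 0) /=; last by move=> i; rewrite /=; ring.
  by rewrite /quad_sum /=; ring.
- rewrite (@quad_sumE J0 (true, true) _ _ _ 0 0) /=; last by move=> i; rewrite /=; ring.
  rewrite (@quad_sumE J0 (false, true) _ _ _ (- N%:R / 2%:R) 1) /=; first by field.
  by two_point_body N.
(* In the case of L with L, bosons and fermions each give a quadratic polynomial in i + 1/2, to
   which [quad_sumE] does not apply; their difference is the constant - N^2/4. *)
rewrite /quad_sum /= -sumrB.
rewrite (@sumK N _ (- N%:R ^+ 2 / 4%:R) 0); [by field|by two_point_body N].
Qed.

Lemma vev2_neg a b (N : nat) : vev (modeop a (Negz N) (modeop b N.+1%:Z vac)) = 0.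
Proof. by rewrite (@modeop_vac _ b) // andbF scale0r linear0 vev0. Qed.

Lemma vev2_neq a b k l : k + l != 0 -> vev (modeop a k (modeop b l vac)) = 0.
Proof.
move=> kl; have q s t f : vev (modeop a k (quad s t f l vac)) = 0.
  by rewrite vev_modeop_quad (negPf kl).
rewrite (modeop_def b); case: b; last first.
- by rewrite modeopN vevN q oppr0.
- by rewrite q.
- by rewrite q.
- by rewrite q.
- by rewrite modeopN modeopZ vevN vevZ q mulr0 oppr0.
- by rewrite modeopZ vevZ q mulr0.
- by rewrite modeopN vevN q oppr0.
rewrite vev_modeop3 2!q vev_modeop.
have [l0|l0] := eqVneq l 0; last by rewrite mul0r !subr0.
by rewrite l0 addr0 in kl; rewrite (negPf kl) andbF mulr0 !subr0.
Qed.

(** For nonzero m with m + n = 0, one of the two products applies a mode of positive index to the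
    vacuum and drops out; the other is a two-point function. *)
Lemma vev_comm a b m n : (N4rank a <= N4rank b)%N ->
  vev (modeop a m (modeop b n vac))
    - sgp K (N4odd a) (N4odd b) * vev (modeop b n (modeop a m vac))
  = vev (gmode_bracket a b m n vac).
Proof.
move=> ab; rewrite vev_gmode_bracket; have [mn|mn] := eqVneq (m + n) 0; last first.
  by rewrite !vev2_neq ?mulr0 ?subr0 // addrC.
case: m mn => [[|N]|N] mn.
- have -> : n = 0 by lia.
  rewrite !modeop_vac // !modeopZ !vevZ !modeop_vac // !vevZ vev_vac !mulr1 /gcoef.
  case: a ab; case: b => //= _; rewrite ?big_cons ?big_nil /sgp /= ?expr0 ?expr1; by field.
- have -> : n = - N.+1%:Z by lia.
  rewrite vev2 // -NegzE vev2_neg mulr0 subr0 /gcoef.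
  case: a ab; case: b => //= _; rewrite ?big_cons ?big_nil /= ?oppr0 // -?pmulrn; by field.
have -> : n = N.+1%:Z by lia.
rewrite vev2_neg {1}NegzE vev2 // sub0r /gcoef NegzE rmorphN /=.
case: a ab; case: b => //= _; rewrite ?big_cons ?big_nil /sgp /= ?expr0 ?expr1 ?mulr0 ?oppr0 // -?pmulrn; by field.
Qed.

Fact gmode_bracket_linear a b m n : linear (gmode_bracket a b m n).
Proof.
have gl x q : linear (gelt x q).
  move=> c u w; case: x => [|x|x] /=; rewrite ?modeopD ?modeopZ //.
    by case: ifP; rewrite ?scaler0 ?addr0.
  by rewrite scalerDr !scalerA [_ * c]mulrC.
move=> c u w; rewrite /gmode_bracket scaler_sumr -big_split; apply: eq_bigr => x _ /=.
by rewrite gl scalerDr !scalerA [c * _]mulrC.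
Qed.

Lemma modeop_comm a b m n v : (N4rank a <= N4rank b)%N ->
  modeop a m (modeop b n v) - sgp K (N4odd a) (N4odd b) *: modeop b n (modeop a m v)
  = gmode_bracket a b m n v.
Proof.
move=> ab; apply/eqP; rewrite -subr_eq0; apply/eqP.
pose C u := modeop a m (modeop b n u) - sgp K (N4odd a) (N4odd b) *: modeop b n (modeop a m u).
pose D u := C u - gmode_bracket a b m n u.
have Dl : linear D.
  move=> c u w; rewrite /D /C gmode_bracket_linear !modeopD !modeopZ.
  move: (gmode_bracket a b m n u) (gmode_bracket a b m n w) => x1 x2.
  move: (modeop a m (modeop b n u)) (modeop a m (modeop b n w)) => x3 x4.
  move: (modeop b n (modeop a m u)) (modeop b n (modeop a m w)) => x5 x6.
  by fock_ring.
pose HD := GRing.isLinear.Build K fock fock *:%R D Dl.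
pose DL : {linear fock -> fock} := HB.pack D HD.
apply: (@osc_central K (N4odd a (+) N4odd b) DL) => [s p u|].
  rewrite /= /D gbracket_osc // (@comm_osc _ a b m n s p u C) //.
  by rewrite opprD addrACA subrr addr0 oscD oscN scalerBr.
by rewrite /= /D /C !vevD !vevN vevZ vev_comm // subrr.
Qed.

Lemma modeop_field a v : exists N : nat, forall m, N%:Z <= m -> modeop a m v = 0.
Proof.
have q s t : exists N : nat, forall f m, N%:Z <= m -> quad s t f m v = 0.
  exact: quad_field.
have [Na ha] := q (false, true) (false, false).
have [Nb hb] := q (true, true) (true, false).
have [Nc hc] := q (false, true) (false, true).
have [Nd hd] := q (false, false) (false, false).
have [Ne he] := q (false, true) (true, true).
have [Nf hf] := q (false, true) (true, false).
have [Ng hg] := q (false, false) (true, true).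
have [Nh hh] := q (false, false) (true, false).
exists (Na + Nb + Nc + Nd + Ne + Nf + Ng + Nh).+1%N => m mN; rewrite modeop_def.
case: a; rewrite ?ha ?hb ?hc ?hd ?he ?hf ?hg ?hh ?oppr0 ?scaler0 ?oppr0 //; try lia.
by rewrite addr0 sub0r ifF ?scale0r ?oppr0 //; lia.
Qed.

Lemma parity_op_modeop a n v :
  parity_op (modeop a n v) = (- 1) ^+ N4odd a *: modeop a n (parity_op v).
Proof.
rewrite !modeop_def; case: a; rewrite ?linearB ?linearN ?linearZ /= ?parity_op_quad /=
  ?expr0 ?expr1 ?scaleN1r ?scale1r //.
Qed.

End Commutators.

(** * The Fock space as a Ramond twisted module *)

Section FockModule.
Variable R : realType.
Local Notation K := R[i].
Local Notation fock := (freemod K state).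

Lemma cM2 : cM R 2 = - 3%:R.
Proof. by rewrite /cM; field. Qed.

Lemma fallingE (x : K) (j : nat) : (j <= 3)%N -> falling x j = gfalling x j.
Proof.
case: j => [|[|[|[|//]]]] _; rewrite /falling ?big_ord_recr big_ord0 /= ?subr0 ?mul1r //.
Qed.

Lemma eq_sum_all (T : Type) (V : nmodType) (p : pred T) (r : seq T) (F G : T -> V) :
  all p r -> (forall x, p x -> F x = G x) -> \sum_(x <- r) F x = \sum_(x <- r) G x.
Proof.
move=> + FG; elim: r => [|x r IH] /=; first by rewrite !big_nil.
by case/andP=> /FG px /IH{}IH; rewrite !big_cons px IH.
Qed.

Lemma mode_bracketE (a b : N4gen) (m n : int) (v : fock) :
  mode_bracket (cM R 2) (fun a n => modeop a n : fock -> fock) a b m n v = gmode_bracket a b m n v.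
Proof.
have gw x : N4weight R x = gweight K x by case: x.
have gb : N4bracket (cM R 2) a b = gbracket K a b.
  by rewrite cM2; case: a; case: b => //=; rewrite ?gw.
have le3 : all (fun w => w.1.2 <= 3)%N (gbracket K a b) by case: a {gb}; case: b.
rewrite /mode_bracket /gmode_bracket gb; apply: (eq_sum_all le3) => w w3.
rewrite /gcoef gw fallingE //; congr (_ *: _).
Qed.

Fact fock_mode_parity (a : N4gen) (n : int) (v : fock) :
  parity_op (modeop a n v) = (- 1) ^+ N4odd a *: modeop a n (parity_op v).
Proof. exact: parity_op_modeop. Qed.

Fact fock_mode_field (a : N4gen) (v : fock) :
  exists N : int, forall n, N <= n -> modeop a n v = 0.
Proof. by have [N hN] := modeop_field a v; exists N%:Z. Qed.

Fact fock_mode_comm (a b : N4gen) (m n : int) (v : fock) : (N4rank a <= N4rank b)%N ->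
  modeop a m (modeop b n v)
    - (- 1) ^+ (N4odd a && N4odd b) *: modeop b n (modeop a m v)
  = mode_bracket (cM R 2) (fun a n => modeop a n : fock -> fock) a b m n v.
Proof. by move=> ab; rewrite mode_bracketE -modeop_comm. Qed.

Definition fock_module : ramond_module (cM R 2) :=
  @RamondModule R (cM R 2) fock (GRing.Linear.clone _ _ _ _ (@parity_op K) _)
    (fun a n => GRing.Linear.clone _ _ _ _ (@modeop K a n) _)
    (@parity_opK K) fock_mode_parity fock_mode_field fock_mode_comm.

End FockModule.

(** * Irreducibility of the even and odd parts *)

Ltac fock_atoms := repeat match goal with
  | |- context [@osc ?K ?s ?k ?v] => let u := fresh "u" in generalize (@osc K s k v); intro u
  end.

Section InvariantSubspaces.
Variable K : numFieldType.
Local Notation fock := (freemod K state).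
Local Notation osc := (@osc K).
Local Notation om := (@om K).
Local Notation wt := (@wt K).
Local Notation hat := (@hat K).
Local Notation modeop := (@modeop K).
Local Notation vac := (@vac K).
Local Notation quad := (@quad K).
Implicit Types (s t r : species) (k l m n p : int) (v : fock) (e d : bool).

(* The odd generating fields are the products gamma^e chi^d, up to sign. *)
Definition gfield e d m v : fock := quad (false, e) (true, d) (fun=> 1) m v.
HB.instance Definition _ e d m := GRing.isLinear.Build K fock fock *:%R (gfield e d m)
  (quad_linear (false, e) (true, d) (fun=> 1) m).

Lemma gfield0 e d m : gfield e d m 0 = 0. Proof. exact: linear0. Qed.
Lemma gfieldN e d m v : gfield e d m (- v) = - gfield e d m v. Proof. exact: linearN. Qed.
Lemma gfieldD e d m u v : gfield e d m (u + v) = gfield e d m u + gfield e d m v.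
Proof. exact: linearD. Qed.
Lemma gfieldZ e d m c v : gfield e d m (c *: v) = c *: gfield e d m v.
Proof. exact: linearZ. Qed.

Definition sg d : K := if d then 1 else - 1.

Lemma om_same s k l : om s k s l = 0.
Proof. by rewrite /om; case: s => f [] ; rewrite /conj /= xpair_eqE andbF. Qed.
Lemma om_bf e k d l : om (false, e) k (true, d) l = 0.
Proof. by rewrite /om /conj xpair_eqE. Qed.
Lemma gb_comm e k e' l v : om (false, e) k (false, e') l = 0 ->
  osc (false, e) k (osc (false, e') l v) = osc (false, e') l (osc (false, e) k v).
Proof. by move=> o0; rewrite osc_comm o0 scale0r addr0 /sgp expr0 scale1r. Qed.
Lemma gc_comm e k d l v :
  osc (false, e) k (osc (true, d) l v) = osc (true, d) l (osc (false, e) k v).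
Proof. by rewrite osc_comm om_bf scale0r addr0 /sgp expr0 scale1r. Qed.
Lemma cc_comm d k d' l v : om (true, d) k (true, d') l = 0 ->
  osc (true, d) k (osc (true, d') l v) = - osc (true, d') l (osc (true, d) k v).
Proof. by move=> o0; rewrite osc_comm o0 scale0r addr0 /sgp expr1 scaleN1r. Qed.

Lemma quad_gc e d f m v : quad (false, e) (true, d) f m v =
  zsum (fun k => f k *: osc (false, e) (m - 1 - k) (osc (true, d) k v)).
Proof.
by apply: eq_zsum => k; rewrite nopE om_bf if_same scale0r subr0.
Qed.

Lemma gc_finsum e d m v :
  finsum (fun k => osc (false, e) (m - 1 - k) (osc (true, d) k v)).
Proof.
have [A hA] := quad_finsum (false, e) (true, d) (fun=> 1) m v.
exists A => k /hA; rewrite nopE om_bf if_same scale0r subr0 scale1r //.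
Qed.

Lemma gfield_g e d m p v :
  gfield e d m (osc (false, e) p v) = osc (false, e) p (gfield e d m v).
Proof.
rewrite /gfield quad_osc /wtc /conj !xpair_eqE /= !mulr0 !scale0r !addr0.
rewrite (_ : (e == ~~ e) = false) ?mulr0 ?scale0r ?addr0; last by case: (e).
by rewrite /sgp expr0 scale1r.
Qed.

Lemma gfield_gN e d m p v : gfield e d m (osc (false, ~~ e) p v) =
  osc (false, ~~ e) p (gfield e d m v) + sg e *: osc (true, d) (m + p) v.
Proof.
rewrite /gfield quad_osc /wtc /conj !xpair_eqE /= eqxx !mulr0 !scale0r !addr0.
by rewrite /sgp expr0 scale1r mulr1 mul1r /wt /= mulr1.
Qed.

Lemma gfield_c e d m p v :
  gfield e d m (osc (true, d) p v) = - osc (true, d) p (gfield e d m v).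
Proof.
rewrite /gfield quad_osc /wtc /conj !xpair_eqE /=.
rewrite (_ : (d == ~~ d) = false) ?mulr0 ?scale0r ?addr0; last by case: (d).
by rewrite /sgp expr1 scaleN1r.
Qed.

Lemma gfield_cN e d m p v : gfield e d m (osc (true, ~~ d) p v) =
  - osc (true, ~~ d) p (gfield e d m v) - (sg d * hat p) *: osc (false, e) (m + p) v.
Proof.
rewrite /gfield quad_osc /wtc /conj !xpair_eqE /= eqxx !mulr0 !scale0r !addr0.
rewrite /sgp expr1 scaleN1r mul1r -scaleNr -mulrN; congr (_ + (_ * _) *: _).
by rewrite /hat rmorphB rmorphN rmorph1; field.
Qed.

Lemma gfieldE e d :
  exists2 c : K, c != 0 & exists a, forall m v, modeop a m v = c *: gfield e d m v.
Proof.
case: e; case: d.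
- by exists 1; [exact: oner_neq0|exists Gp => k u; rewrite modeop_def scale1r].
- by exists 1; [exact: oner_neq0|exists Gbp => k u; rewrite modeop_def scale1r].
- by exists 1; [exact: oner_neq0|exists Gm => k u; rewrite modeop_def scale1r].
exists (- 1); first by rewrite oppr_eq0 oner_neq0.
by exists Gbm => k u; rewrite modeop_def scaleN1r.
Qed.

Lemma gfield_anticomm d m n v :
  gfield true d m (gfield false d n v) = - gfield false d n (gfield true d m v).
Proof.
apply/eqP; rewrite -subr_eq0 opprK; apply/eqP; case: d.
  have := @modeop_comm K Gp Gm m n v isT; rewrite /gmode_bracket big_nil /sgp expr1.
  by rewrite scaleN1r opprK !modeop_def.
have := @modeop_comm K Gbp Gbm m n v isT; rewrite /gmode_bracket big_nil /sgp expr1.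
have Gbm1 u : modeop Gbm n u = - gfield false false n u by rewrite modeop_def.
have Gbp1 u : modeop Gbp m u = gfield true false m u by rewrite modeop_def.
rewrite scaleN1r opprK !Gbm1 !Gbp1 gfieldN -opprD => /eqP.
by rewrite oppr_eq0 => /eqP.
Qed.

Lemma gfield_tame e d v : exists N : nat, forall m, N%:Z <= m -> gfield e d m v = 0.
Proof. by have [N hN] := quad_field (false, e) (true, d) v; exists N => m /hN; apply. Qed.

Lemma zsumN (x : int -> fock) : finsum x -> zsum (fun k => - x k) = - zsum x.
Proof. by move=> fx; rewrite (zsum_linear (\- idfun)). Qed.
Lemma zsumZ c (x : int -> fock) : finsum x -> zsum (fun k => c *: x k) = c *: zsum x.
Proof. by move=> fx; rewrite (zsum_linear (c \*: idfun)). Qed.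
Lemma finsumN (x : int -> fock) : finsum x -> finsum (fun k => - x k).
Proof. by move=> [A hA]; exists A => k /hA->; rewrite oppr0. Qed.

(* chi(w) chi(w) = 0. *)
Lemma cc_sum d m v : zsum (fun k => osc (true, d) k (osc (true, d) (m - k) v)) = 0.
Proof.
have [N hN] := osc_tame v.
have fin : finsum (fun k => osc (true, d) k (osc (true, d) (m - k) v)).
  apply: (@finsum_bound _ _ _ (m - N%:Z) N%:Z) => k kb; first by rewrite hN ?osc0 //; lia.
  by rewrite cc_comm ?om_same // hN ?osc0 ?oppr0 //; lia.
set z := zsum _; have zz : z = - z.
  rewrite /z -zsumN // -(zsum_refl m); apply: eq_zsum => k.
  have -> : m - (m - k) = k by lia.
  by rewrite cc_comm ?om_same.
apply: freemodP => x; have /eqP := congr1 (fun w : fock => w x) zz.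
by rewrite fm_oppE -addr_eq0 -mulr2n mulrn_eq0 /= => /eqP.
Qed.

Lemma gc_sum e d m p q v : m = p + q + 1 ->
  zsum (fun k => osc (false, e) (k + p) (osc (true, d) (q - k) v)) = gfield e d m v.
Proof.
move=> mE; rewrite /gfield quad_gc -[RHS](zsum_refl q); apply: eq_zsum => k.
by rewrite scale1r; congr (osc _ _ _); lia.
Qed.

Definition gchi e d m v : fock := zsum (fun k => gfield e d k (osc (true, d) (m - k) v)).

Lemma gchi_finsum e d m v : finsum (fun k => gfield e d k (osc (true, d) (m - k) v)).
Proof.
have [N hN] := osc_tame v; have [M hM] := gfield_tame e d v.
apply: (@finsum_bound _ _ _ (m - N%:Z) M%:Z) => k kb; first by rewrite hN ?gfield0 //; lia.
by rewrite gfield_c hM ?osc0 ?oppr0 //; lia.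
Qed.

Fact gchi_linear e d m : linear (gchi e d m).
Proof.
move=> c u v; rewrite /gchi -zsumZ; last exact: gchi_finsum.
rewrite -zsumD; last 2 first.
- by have [A hA] := gchi_finsum e d m u; exists A => k /hA->; rewrite scaler0.
- exact: gchi_finsum.
by apply: eq_zsum => k; rewrite oscD oscZ gfieldD gfieldZ.
Qed.
HB.instance Definition _ e d m := GRing.isLinear.Build K fock fock *:%R (gchi e d m)
  (gchi_linear e d m).

(* G(w) chi(w) = 0. *)
Lemma gchi_eq0 e d m v : gchi e d m v = 0.
Proof.
apply: (@osc_central K false) => [s p {}v|]; last first.
  rewrite /= vev_zsum; last exact: gchi_finsum.
  apply: zsum_eq0 => k; rewrite gfield_c vevN.
  have [mk|] := ltP (m - k) 0; last first.
    by move=> mk; rewrite -vevN -gfield_c osc_vac // gfield0 vev0.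
  by case: (m - k) mk => // j _; rewrite vev_osc oppr0.
rewrite /sgp expr0 scale1r /= zsum_linear; last exact: gchi_finsum.
rewrite /gchi; case: s => -[] c; last first.
  have [->|/negPf ce] := eqVneq c e.
    by apply: eq_zsum => k; rewrite -gc_comm gfield_g.
  have -> : c = ~~ e by case: c e ce => [] [].
  transitivity (zsum (fun k => osc (false, ~~ e) p (gfield e d k (osc (true, d) (m - k) v))
      + sg e *: osc (true, d) (k + p) (osc (true, d) (m - k) v))).
    by apply: eq_zsum => k; rewrite -gc_comm gfield_gN.
  have fc : finsum (fun k => osc (true, d) (k + p) (osc (true, d) (m - k) v)).
    have [N hN] := osc_tame v.
    apply: (@finsum_bound _ _ _ (m - N%:Z) (N%:Z - p)) => k kb; first by rewrite hN ?osc0 //; lia.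
    by rewrite cc_comm ?om_same // hN ?osc0 ?oppr0 //; lia.
  rewrite zsumD; last 2 first.
  - by apply: finsum_linear; exact: gchi_finsum.
  - by apply: (finsum_linear (sg e \*: idfun)).
  rewrite zsumZ // (_ : zsum (fun k => osc (true, d) (k + p) _) = 0) ?scaler0 ?addr0 //.
  rewrite -[RHS](cc_sum d (m + p) v) -[RHS](zsum_shift p); apply: eq_zsum => k.
  by congr (osc _ _ (osc _ _ _)); lia.
have [->|/negPf ce] := eqVneq c d.
  apply: eq_zsum => k.
  by rewrite [osc _ (m - k) _]cc_comm ?om_same // gfieldN gfield_c opprK.
have -> : c = ~~ d by case: c d ce => [] [].
pose w k := osc (false, e) (k + p) (osc (true, d) (m - k) v).
pose u k := om (true, d) (m - k) (true, ~~ d) p *: gfield e d k v.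
have u0 k : k != m + p + 1 -> u k = 0.
  by move=> kp; rewrite /u om_eq0 ?scale0r //; apply/eqP; lia.
have fw : finsum w.
  have [A hA] := gc_finsum e d (m + p + 1) v.
  exists [fset (m - k : int) | k in A]%fset => k kA; rewrite /w.
  have := hA (m - k); rewrite (_ : _ - 1 - (m - k) = k + p) => [|]; last by lia.
  apply; apply: contra kA => kA; apply/imfsetP; exists (m - k) => //=; lia.
transitivity (zsum (fun k => osc (true, ~~ d) p (gfield e d k (osc (true, d) (m - k) v))
    + ((sg d * hat p) *: w k + u k))).
  apply: eq_zsum => k; rewrite osc_comm /sgp expr1 scaleN1r gfieldD gfieldN gfieldZ.
  by rewrite gfield_cN opprB opprK /u /w addrA [X in X + _]addrC.
rewrite zsumD; last 2 first.
- by apply: finsum_linear; exact: gchi_finsum.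
- by apply: finsumD; [exact: (finsum_linear (_ \*: idfun))|exact: finsum1 u0].
rewrite zsumD; last 2 first.
- exact: (finsum_linear (_ \*: idfun)).
- exact: finsum1 u0.
rewrite zsumZ // (zsum_eq1 u0) /w (@gc_sum _ _ (m + p + 1)); last by lia.
(* The single contraction, at k = m + p + 1, cancels the sum of all the [w k], which is again a mode
   of the odd field. *)
rewrite /u -scalerDl (_ : _ + om _ _ _ _ = 0) ?scale0r ?addr0 //.
rewrite /om /conj eqxx (_ : _ == 0 = true) /=; last by apply/eqP; lia.
have -> : m - (m + p + 1) = - 1 - p by lia.
rewrite /wt /sg /= /hat rmorphB rmorphN rmorph1.
by case: (d); field.
Qed.

(* The derivative of chi, as the regular part of G^+(z) gamma^-(w) - gamma^+(z) G^-(w). *)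
Definition dchi_term d n p k v : fock :=
  gfield true d k (osc (false, false) (n + p - k) v)
  - osc (false, true) (k + p) (gfield false d (n - k) v).

Definition dchi d n p v : fock := zsum (fun k => dchi_term d n p k v).

Lemma gp_gm d k l v : gfield true d k (osc (false, false) l v) =
  osc (false, false) l (gfield true d k v) + osc (true, d) (k + l) v.
Proof. by rewrite (gfield_gN true) scale1r. Qed.
Lemma gm_gp d k l v : gfield false d k (osc (false, true) l v) =
  osc (false, true) l (gfield false d k v) - osc (true, d) (k + l) v.
Proof. by rewrite (gfield_gN false) scaleN1r. Qed.

(** Both exchanges produce the same mode of chi, of index n + p, and these cancel. The defining form
    vanishes for k near -oo and this one for k near +oo, whence the finite support. *)
Lemma dchi_termE d n p k v : dchi_term d n p k v =
  osc (false, false) (n + p - k) (gfield true d k v)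
  - gfield false d (n - k) (osc (false, true) (k + p) v).
Proof.
rewrite /dchi_term gp_gm gm_gp.
have -> : k + (n + p - k) = n + p by lia.
have -> : n - k + (k + p) = n + p by lia.
by rewrite opprB addrA addrAC.
Qed.

Lemma dchi_finsum d n p v : finsum (fun k => dchi_term d n p k v).
Proof.
have [N hN] := osc_tame v.
have [M hM] := gfield_tame true d v; have [M' hM'] := gfield_tame false d v.
apply: (@finsum_bound _ _ _ (Num.min (n + p - N%:Z) (n - M'%:Z)) (Num.max M%:Z (N%:Z - p))) => k kb.
  by rewrite /dchi_term hN ?hM' ?gfield0 ?osc0 ?subrr //; lia.
by rewrite dchi_termE hM ?hN ?gfield0 ?osc0 ?subrr //; lia.
Qed.

Fact dchi_term_linear d n p k : linear (dchi_term d n p k).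
Proof.
move=> c u v; rewrite /dchi_term !oscD !gfieldD !oscZ !gfieldZ !oscD oscZ.
by rewrite opprD addrACA scalerBr.
Qed.

Fact dchi_linear d n p : linear (dchi d n p).
Proof.
move=> c u v; rewrite /dchi -zsumZ; last exact: dchi_finsum.
rewrite -zsumD; last 2 first.
- by have [A hA] := dchi_finsum d n p u; exists A => k /hA->; rewrite scaler0.
- exact: dchi_finsum.
by apply: eq_zsum => k; rewrite dchi_term_linear.
Qed.
HB.instance Definition _ d n p := GRing.isLinear.Build K fock fock *:%R (dchi d n p)
  (dchi_linear d n p).

Lemma gc_sumN e d m p q v : m = p + q + 1 ->
  finsum (fun k => osc (false, e) (k + p) (osc (true, d) (q - k) v)).
Proof.
move=> mE; have [A hA] := gc_finsum e d m v.
exists [fset (q - k : int) | k in A]%fset => k kA.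
have := hA (q - k); rewrite (_ : m - 1 - (q - k) = k + p); last by lia.
apply; apply: contra kA => kA; apply/imfsetP; exists (q - k) => //=; lia.
Qed.

Lemma dchi_gp d n p q v :
  dchi d n p (osc (false, true) q v) = osc (false, true) q (dchi d n p v).
Proof.
rewrite zsum_linear; last exact: dchi_finsum.
pose x k := om (false, false) (n + p - k) (false, true) q *: gfield true d k v.
pose y k := osc (false, true) (k + p) (osc (true, d) (n + q - k) v).
have E k : dchi_term d n p k (osc (false, true) q v) =
    osc (false, true) q (dchi_term d n p k v) + (x k + y k).
  rewrite /dchi_term /x /y [osc (false, false) _ (osc _ _ _)]osc_comm.
  rewrite /sgp expr0 scale1r gfieldD gfieldZ gfield_g gm_gp !oscD !oscN.
  rewrite [osc (false, true) (k + p) (osc (false, true) q _)]gb_comm ?om_same //.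
  have -> : n - k + q = n + q - k by lia.
  by rewrite opprD opprK addrACA.
have x0 k : k != n + p + q + 1 -> x k = 0.
  by move=> kp; rewrite /x om_eq0 ?scale0r //; apply/eqP; lia.
have fy : finsum y by apply: (@gc_sumN _ _ (n + p + q + 1)); lia.
rewrite {1}/dchi (eq_zsum E) zsumD; last 2 first.
- by apply: finsum_linear; exact: dchi_finsum.
- by apply: finsumD => //; exact: finsum1 x0.
rewrite zsumD //; last exact: finsum1 x0.
rewrite (zsum_eq1 x0) /y (@gc_sum _ _ (n + p + q + 1)); last by lia.
rewrite /x /om /conj eqxx (_ : _ == 0 = true) /=; last by apply/eqP; lia.
by rewrite /wt /= mulr1 scaleN1r addNr addr0.
Qed.

Lemma dchi_gm d n p q v :
  dchi d n p (osc (false, false) q v) = osc (false, false) q (dchi d n p v).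
Proof.
rewrite zsum_linear; last exact: dchi_finsum.
pose x k := om (false, true) (k + p) (false, false) q *: gfield false d (n - k) v.
pose y k := osc (false, false) (n + p - k) (osc (true, d) (k + q) v).
have E k : dchi_term d n p k (osc (false, false) q v) =
    osc (false, false) q (dchi_term d n p k v) + (y k - x k).
  rewrite /dchi_term /x /y [osc (false, false) (n + p - k) (osc (false, false) q _)]gb_comm ?om_same //.
  rewrite gp_gm gfield_g [osc (false, true) _ (osc (false, false) _ _)]osc_comm.
  by rewrite /sgp expr0 scale1r !oscD !oscN opprD addrACA -gc_comm.
have x0 k : k != - p - q - 1 -> x k = 0.
  by move=> kp; rewrite /x om_eq0 ?scale0r //; apply/eqP; lia.
pose g j := osc (false, false) (j + (n + p)) (osc (true, d) (q - j) v).
have yE k : y k = g (0 - k).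
  by rewrite /y /g; congr (osc _ _ (osc _ _ _)); lia.
have fy0 : finsum g := @gc_sumN false d (n + p + q + 1) (n + p) q v erefl.
have fy : finsum y.
  have [A hA] := fy0; exists [fset (- k : int) | k in A]%fset => k kA; rewrite yE.
  apply: hA; rewrite sub0r; apply: contra kA => kA; apply/imfsetP; exists (- k) => //=.
  by rewrite opprK.
rewrite {1}/dchi (eq_zsum E) zsumD; last 2 first.
- by apply: finsum_linear; exact: dchi_finsum.
- by apply: finsumD => //; apply: finsumN; exact: finsum1 x0.
rewrite zsumD //; last by apply: finsumN; exact: finsum1 x0.
rewrite zsumN; last exact: finsum1 x0.
rewrite (zsum_eq1 x0) (eq_zsum yE) zsum_refl (@gc_sum _ _ (n + p + q + 1)) //.
rewrite /x /om /conj eqxx (_ : _ == 0 = true) /=; last by apply/eqP; lia.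
rewrite /wt /= mulr1 scale1r (_ : n - (- p - q - 1) = n + p + q + 1); last by lia.
by rewrite subrr addr0.
Qed.

Lemma dchi_c d n p q v : dchi d n p (osc (true, d) q v) = - osc (true, d) q (dchi d n p v).
Proof.
rewrite zsum_linear; last exact: dchi_finsum.
rewrite -zsumN; last by apply: finsum_linear; exact: dchi_finsum.
apply: eq_zsum => k; rewrite /dchi_term gc_comm gfield_c gfield_c oscN gc_comm.
by rewrite -opprD /= oscD oscN.
Qed.

(** The bosonic bilinears f (k + p) and f (k + q) would cancel after a shift of k if f had finite
    support. But f is constant near +oo, equal to a contraction, and telescoping leaves p - q: this
    is the quantum correction. *)
Lemma dchi_cN d n p q v : dchi d n p (osc (true, ~~ d) q v) =
  - osc (true, ~~ d) q (dchi d n p v)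
  + (sg d * hat q * (p - q)%:~R * (n + p + q + 1 == 0)%:R) *: v.
Proof.
have [N hN] := osc_tame v.
pose f k := osc (false, true) k (osc (false, false) (n + p + q - k) v).
pose c := (n + p + q + 1 == 0)%:R *: v.
have f0 k : k < n + p + q - N%:Z -> f k = 0.
  by move=> kN; rewrite /f hN ?osc0 //; lia.
have fc k : N%:Z < k -> f k = c.
  move=> kN; rewrite /f osc_comm hN ?osc0 ?scaler0 ?add0r; last by lia.
  rewrite /om /conj eqxx /c /= (_ : (k + _ + 1 == 0) = (n + p + q + 1 == 0)); last by apply/eqP/eqP; lia.
  by rewrite /wt /= mulr1; case: ifP.
have [ft fE] := zsum_telescope p q f0 fc.
have E k : dchi_term d n p k (osc (true, ~~ d) q v) =
    - osc (true, ~~ d) q (dchi_term d n p k v)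
    + (sg d * hat q) *: (f (k + p) - f (k + q)).
  rewrite /dchi_term /f [osc (false, false) _ (osc (true, _) _ _)]gc_comm.
  have -> : n + p + q - (k + p) = n - k + q by lia.
  have -> : n + p + q - (k + q) = n + p - k by lia.
  rewrite !gfield_cN !oscD !oscN oscZ [osc (false, true) _ (osc (true, _) _ _)]gc_comm.
  rewrite scalerBr !opprB !opprK.
  by fock_atoms; fock_ring.
rewrite {1}/dchi (eq_zsum E) zsumD; last 2 first.
- by apply: finsumN; apply: finsum_linear; exact: dchi_finsum.
- exact: (finsum_linear (_ \*: idfun)).
rewrite zsumN; last by apply: finsum_linear; exact: dchi_finsum.
rewrite -zsum_linear; last exact: dchi_finsum.
by rewrite zsumZ // fE !scalerA.
Qed.

Lemma vev_dchi d n p : vev (dchi d n p vac) = 0.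
Proof.
rewrite vev_zsum; last exact: dchi_finsum.
have vc d' k : vev (osc (true, d') k vac) = 0.
  by case: k => k; [rewrite osc_vac // vev0|rewrite vev_osc].
apply: zsum_eq0 => k; rewrite /dchi_term vevD vevN.
have -> : vev (gfield true d k (osc (false, false) (n + p - k) vac)) = 0.
  case: (n + p - k) => l; first by rewrite osc_vac // gfield0 vev0.
  by rewrite gp_gm vevD vev_osc vc addr0.
rewrite sub0r; case: (k + p) => l; last by rewrite vev_osc oppr0.
have -> : osc (false, true) l (gfield false d (n - k) vac) = osc (true, d) (n - k + l) vac.
  have := gm_gp d (n - k) l vac; rewrite osc_vac // gfield0 => /esym/eqP.
  by rewrite subr_eq0 => /eqP.
by rewrite vc oppr0.
Qed.

Lemma dchiE d n p v : dchi d n p v = - ((n + p + p + 1)%:~R *: osc (true, d) (n + p) v).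
Proof.
apply/eqP; rewrite -subr_eq0 opprK; apply/eqP.
pose c : K := (n + p + p + 1)%:~R.
apply: (@osc_central K true (dchi d n p \+ c \*: osc (true, d) (n + p))) => [s q {}v|]; last first.
  rewrite /= vevD vev_dchi add0r vevZ.
  by case: (n + p) => k; [rewrite osc_vac // vev0 mulr0|rewrite vev_osc mulr0].
rewrite /=; case: s => -[] e; rewrite /sgp ?expr0 ?expr1; last first.
  rewrite scale1r; case: e; rewrite ?dchi_gp ?dchi_gm -gc_comm oscD oscZ //.
have [->|/negPf ed] := eqVneq e d.
  by rewrite dchi_c cc_comm ?om_same // scaleN1r scalerN -opprD oscD oscZ.
have -> : e = ~~ d by case: e d ed => [] [].
rewrite dchi_cN osc_comm /sgp expr1 !scaleN1r oscD oscZ scalerDr scalerN scalerA addrACA -opprD.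
rewrite -scalerDl (_ : _ + _ * om _ _ _ _ = 0) ?scale0r ?addr0 //.
rewrite /om /conj eqxx /=; have [npq|_] := eqVneq (n + p + q + 1) 0; last by rewrite !mulr0 addr0.
have -> : n + p = - 1 - q by lia.
(* Where the contraction is nonzero, the constant n + 2p + 1 is the number p - q left by the
   telescoping sum. *)
have -> : c = (p - q)%:~R by rewrite /c; congr (_%:~R); lia.
rewrite mulr1 /wt /= /sg; move: ((p - q)%:~R) => x.
by rewrite /hat rmorphB rmorphN rmorph1; case: (d); field.
Qed.

(* The normally ordered product of G^+ and G^- is a multiple of the bilinear
   (d chi) chi: a quantum correction, the classical product being zero. *)
Definition kop d n v : fock := zsum (fun m => gfield true d m (gfield false d (n - m) v)).

(** The sum is finite on each vector without normal ordering: the two odd fields anticommute, so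
    either factor can be moved to the right. *)
Lemma kop_finsum d n v : finsum (fun m => gfield true d m (gfield false d (n - m) v)).
Proof.
have [M hM] := gfield_tame true d v; have [M' hM'] := gfield_tame false d v.
apply: (@finsum_bound _ _ _ (n - M'%:Z) M%:Z) => k kb.
  by rewrite hM' ?gfield0 //; lia.
by rewrite gfield_anticomm hM ?gfield0 ?oppr0 //; lia.
Qed.

Fact kop_linear d n : linear (kop d n).
Proof.
move=> c u v; rewrite /kop -zsumZ; last exact: kop_finsum.
rewrite -zsumD; last 2 first.
- by have [A hA] := kop_finsum d n u; exists A => k /hA->; rewrite scaler0.
- exact: kop_finsum.
by apply: eq_zsum => k; rewrite !(gfieldD, gfieldZ).
Qed.
HB.instance Definition _ d n := GRing.isLinear.Build K fock fock *:%R (kop d n)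
  (kop_linear d n).

Lemma kop_g d n e p v : kop d n (osc (false, e) p v) = osc (false, e) p (kop d n v).
Proof.
rewrite zsum_linear; last exact: kop_finsum.
case: e.
  transitivity (zsum (fun m => osc (false, true) p (gfield true d m (gfield false d (n - m) v))
      - gfield true d m (osc (true, d) (n + p - m) v))).
    apply: eq_zsum => k; rewrite gm_gp gfieldD gfieldN gfield_g.
    by have -> : n - k + p = n + p - k by lia.
  rewrite zsumD; last 2 first.
  - by apply: finsum_linear; exact: kop_finsum.
  - by apply: finsumN; exact: gchi_finsum.
  by rewrite zsumN ?[zsum (fun k => gfield _ _ _ _)]gchi_eq0 ?oppr0 ?addr0 //; exact: gchi_finsum.
pose x k := - gfield false d k (osc (true, d) (n + p - k) v).
have fx : finsum x by apply: finsumN; exact: gchi_finsum.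
transitivity (zsum (fun m => osc (false, false) p (gfield true d m (gfield false d (n - m) v))
      + x (n - m))).
  apply: eq_zsum => k; rewrite gfield_g gp_gm /x.
  have -> : n + p - (n - k) = k + p by lia.
  by rewrite gfield_c opprK.
rewrite zsumD; last 2 first.
- by apply: finsum_linear; exact: kop_finsum.
- have [A hA] := fx; exists [fset (n - k : int) | k in A]%fset => k kA.
  apply: hA; apply: contra kA => kA; apply/imfsetP; exists (n - k) => //=.
  by rewrite opprB addrC subrK.
by rewrite (zsum_refl n x) zsumN ?[zsum (fun k => gfield _ _ _ _)]gchi_eq0 ?oppr0 ?addr0 //; exact: gchi_finsum.
Qed.

(** Passing the conjugate fermion through both factors leaves the difference that defines [dchi]. So
    [kop] turns one fermion into the other, with a coefficient polynomial in the index. *)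
Lemma kop_cN d n p v : kop d n (osc (true, ~~ d) p v) =
  osc (true, ~~ d) p (kop d n v)
  + (sg d * hat p * (n%:~R + 2%:R * hat p)) *: osc (true, d) (n + p) v.
Proof.
rewrite zsum_linear; last exact: kop_finsum.
transitivity (zsum (fun m => osc (true, ~~ d) p (gfield true d m (gfield false d (n - m) v))
      + (- (sg d * hat p)) *: dchi_term d n p m v)).
  apply: eq_zsum => k; rewrite gfield_cN gfieldD !gfieldN gfieldZ gfield_cN opprB /dchi_term.
  have -> : n - k + p = n + p - k by lia.
  move: (gfield _ _ _ (osc _ _ _)) (osc _ _ (gfield _ _ _ _)) => x y.
  by fock_atoms; fock_ring.
rewrite zsumD; last 2 first.
- by apply: finsum_linear; exact: kop_finsum.
- by have [A hA] := dchi_finsum d n p v; exists A => k /hA->; rewrite scaler0.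
rewrite zsumZ; last exact: dchi_finsum.
rewrite -/(dchi d n p v) dchiE scaleNr scalerN opprK scalerA; congr (_ + _ *: _).
by rewrite !rmorphD rmorph1 /hat; field.
Qed.

End InvariantSubspaces.

(** * Isolating single products of two oscillators *)

Section AdmissibleCoefficients.
Variable K : numFieldType.
Local Notation fock := (freemod K state).
Local Notation osc := (@osc K).
Local Notation om := (@om K).
Local Notation hat := (@hat K).
Local Notation modeop := (@modeop K).
Local Notation vac := (@vac K).
Local Notation quad := (@quad K).
Local Notation gfield := (@gfield K).
Local Notation kop := (@kop K).
Local Notation sg := (@sg K).
Implicit Types (s t r : species) (k l m n p : int) (u v : fock) (e d : bool).
Implicit Type f : int -> K.

Definition mode_closed (S : set fock) : Prop :=
  [/\ S 0, forall (a : K) u v, S u -> S v -> S (a *: u + v)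
    & forall a n v, S v -> S (modeop a n v)].

Variable S : set fock.
Hypothesis hS : mode_closed S.

Lemma mcl0 : S 0. Proof. by case: hS. Qed.
Lemma mclD u v : S u -> S v -> S (u + v).
Proof. by case: hS => _ SL _ Su Sv; rewrite -[u]scale1r; apply: SL. Qed.
Lemma mclZ a v : S v -> S (a *: v).
Proof. by case: hS => S0 SL _ Sv; rewrite -[_ *: _]addr0; apply: SL. Qed.
Lemma mclZI a v : a != 0 -> S (a *: v) -> S v.
Proof. by move=> a0 /(mclZ a^-1); rewrite scalerA mulVf // scale1r. Qed.
Lemma mclB u v : S u -> S v -> S (u - v).
Proof. by move=> Su Sv; rewrite -scaleN1r; apply: mclD => //; apply: mclZ. Qed.

Lemma mcl_zsum (x : int -> fock) : finsum x -> (forall k, S (x k)) -> S (zsum x).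
Proof.
move=> [A hA] Sx; rewrite (zsumE hA); elim/big_rec: _ => [|k u _ Su]; first exact: mcl0.
exact: mclD.
Qed.

Lemma mcl_gfield e d m v : S v -> S (gfield e d m v).
Proof.
move=> Sv; have [c c0 [a cE]] := gfieldE K e d.
by apply: (mclZI c0); rewrite -cE; case: hS => _ _; apply.
Qed.

Lemma mcl_kop d n v : S v -> S (kop d n v).
Proof.
by move=> Sv; apply: mcl_zsum => [|k]; [exact: kop_finsum|do 2 apply: mcl_gfield].
Qed.

Lemma kopZ d n c v : kop d n (c *: v) = c *: kop d n v.
Proof. exact: linearZ. Qed.

(** All four bilinears gamma chi are required at once, because a commutator with [kop d] replaces
    the fermion [~~ d] by the fermion [d]. *)
Definition admissible f := forall e d m v, S v -> S (quad (false, e) (true, d) f m v).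

Lemma gc_finsumZ e d f m v :
  finsum (fun k => f k *: osc (false, e) (m - 1 - k) (osc (true, d) k v)).
Proof. by have [A hA] := gc_finsum e d m v; exists A => k /hA->; rewrite scaler0. Qed.

Lemma admissible1 : admissible (fun=> 1).
Proof. by move=> e d m v; apply: mcl_gfield. Qed.

Lemma admissibleZ c f : admissible f -> admissible (fun k => c * f k).
Proof.
move=> Sf e d m v Sv; rewrite quad_gc.
rewrite (_ : zsum _ = c *: quad (false, e) (true, d) f m v); first exact/mclZ/Sf.
rewrite quad_gc -zsumZ; last exact: gc_finsumZ.
by apply: eq_zsum => k; rewrite scalerA.
Qed.

Lemma admissibleD f g : admissible f -> admissible g -> admissible (fun k => f k + g k).
Proof.
move=> Sf Sg e d m v Sv; rewrite quad_gc.
rewrite (_ : zsum _ = quad (false, e) (true, d) f m v + quad (false, e) (true, d) g m v).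
  by apply: mclD; [apply: Sf|apply: Sg].
rewrite !quad_gc -zsumD; [|exact: gc_finsumZ|exact: gc_finsumZ].
by apply: eq_zsum => k; rewrite scalerDl.
Qed.

(* The effect of commuting with the n-th mode of [kop]. *)
Lemma admissible_kop n f : admissible f ->
  admissible (fun k => f (k - n) * hat (k - n) * (n%:~R + 2%:R * hat (k - n))).
Proof.
move=> Sf e d m v Sv; set g := (X in quad _ _ X).
pose q w := quad (false, e) (true, ~~ d) f (m - n) w.
have sd0 : sg d != 0 by rewrite /sg; case: (d); rewrite ?oppr_eq0 oner_eq0.
apply: (mclZI sd0).
have -> : sg d *: quad (false, e) (true, d) g m v = kop d n (q v) - q (kop d n v).
  rewrite /q !quad_gc (zsum_linear (kop d n)); last exact: gc_finsumZ.
  rewrite -(zsumN (gc_finsumZ e (~~ d) f (m - n) (kop d n v))) -zsumD; last 2 first.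
  - by apply: (finsum_linear (kop d n)); exact: gc_finsumZ.
  - by apply: finsumN; exact: gc_finsumZ.
  rewrite -zsumZ; last exact: gc_finsumZ.
  rewrite -[LHS](zsum_shift n); apply: eq_zsum => k.
  rewrite /= kopZ kop_g kop_cN oscD oscZ scalerDr [RHS]addrC addKr !scalerA.
  have -> : m - 1 - (k + n) = m - n - 1 - k by lia.
  rewrite /g addrK [k + n]addrC; congr (_ *: _); ring.
by apply: mclB; [apply: mcl_kop; apply: Sf|apply: Sf; apply: mcl_kop].
Qed.

Lemma admissible_eq f g : f =1 g -> admissible f -> admissible g.
Proof. by move=> /funext->. Qed.

Lemma hatB k n : hat (k - n) = hat k - n%:~R.
Proof. by rewrite /hat rmorphB addrAC. Qed.

(** The case n = 0 of [admissible_kop] multiplies by 2 x^2, with x = hat k. *)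
Lemma admissible_sq f : admissible f -> admissible (fun k => f k * hat k ^+ 2).
Proof.
move=> /(admissible_kop 0)/(admissibleZ 2%:R^-1); apply: admissible_eq => k.
by rewrite !subr0 /=; field.
Qed.

(** With x = hat k, the cases n = 1 and n = -1 in succession multiply by x (x + 1) (2x + 1)^2 = 4x^4
    + 8x^3 + 5x^2 + x. Removing 4x^4 + 5x^2, which is admissible by [admissible_sq], leaves the odd
    polynomial x (8x^2 + 1). *)
Lemma admissible_odd f : admissible f -> admissible (fun k => f k * (hat k * (8%:R * hat k ^+ 2 + 1))).
Proof.
move=> Sf.
have := admissible_kop (- 1) (admissible_kop 1 Sf).
have /(admissibleZ (- 4%:R)) := admissible_sq (admissible_sq Sf).
move=> /admissibleD D /D{D}.
have /(admissibleZ (- 5%:R)) := admissible_sq Sf.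
move=> /admissibleD D /D{D}; apply: admissible_eq => k.
have -> : k - - 1 - 1 = k by lia.
by rewrite !hatB rmorphN rmorph1; ring.
Qed.

Lemma hat_real k : hat k \is Num.real.
Proof. by rewrite /hat rpredD // ?realV ?realz // realn. Qed.

Lemma hat_inj k l : hat k = hat l -> k = l.
Proof. by move/addIr/eqP; rewrite eqr_int => /eqP. Qed.

Lemma hat_neq0 k : hat k != 0.
Proof. by have := wt_neq0 K (true, true) k; rewrite /wt /= mul1r. Qed.

(* Only finitely many terms of a mode of gamma chi act on v, and a polynomial in
   hat k with admissible even and odd parts isolates any one of them. *)
Lemma mcl_gc e k d l v : S v -> S (osc (false, e) k (osc (true, d) l v)).
Proof.
move=> Sv; have [A hA] := gc_finsum e d (k + l + 1) v.
(* On A the even polynomial [h] leaves only the indices with hat j = hat l or hat j = - hat l. The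
   second factor of [f] adds the values of an odd polynomial at hat l and hat j: it vanishes in the
   second case and doubles in the first. *)
pose h j := \prod_(i <- A | hat i ^+ 2 != hat l ^+ 2) (hat j ^+ 2 - hat i ^+ 2).
pose f j := h j * (hat l * (8%:R * hat l ^+ 2 + 1) + hat j * (8%:R * hat j ^+ 2 + 1)).
have Sh : admissible h.
  rewrite /h; elim: (enum_fset A) => [|i s IH].
    by apply: admissible_eq admissible1 => j; rewrite big_nil.
  have [il|il] := boolP (hat i ^+ 2 != hat l ^+ 2); last first.
    by apply: admissible_eq IH => j; rewrite big_cons (negPf il).
  have /(admissibleZ (- hat i ^+ 2)) := IH; have /admissibleD := admissible_sq IH.
  by move=> /[apply]; apply: admissible_eq => j; rewrite big_cons il; ring.
have Sf : admissible f.
  have := admissibleZ (hat l * (8%:R * hat l ^+ 2 + 1)) Sh.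
  move=> /admissibleD/(_ (admissible_odd Sh)); apply: admissible_eq => j.
  by rewrite /f; ring.
have h8 j : 8%:R * hat j ^+ 2 + 1 != 0.
  by rewrite gt_eqF // ltr_wpDl // mulr_ge0 // real_exprn_even_ge0 // hat_real.
have fl : f l != 0.
  rewrite /f mulf_neq0 //; first by rewrite /h prodf_seq_neq0; apply/allP => i _; apply/implyP; rewrite eq_sym subr_eq0.
  by rewrite -mulr2n mulrn_eq0 /= mulf_neq0 ?h8 ?hat_neq0.
apply: (mclZI fl).
have := Sf e d (k + l + 1) v Sv; rewrite quad_gc (zsum_eq1 (c := l)).
  by have -> : k + l + 1 - 1 - l = k by lia.
move=> j jl; have [jA|/hA->] := boolP (j \in A); last by rewrite scaler0.
suff -> : f j = 0 by rewrite scale0r.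
have [/eqP|jl2] := eqVneq (hat j ^+ 2) (hat l ^+ 2).
  rewrite eqf_sqr => /orP[/eqP/hat_inj jE|/eqP jE]; first by rewrite jE eqxx in jl.
  by rewrite /f jE; ring.
suff -> : f j = 0 by [].
rewrite /f /h (big_rem j) //= jl2 subrr !mul0r //.
Qed.

(** Two oscillators of the same statistics are obtained from four, by inserting a pair of the other
    statistics whose supercommutator is a nonzero scalar [z]. As [om s k t l = 0], the original two
    can be exchanged, and each half is a product of two operators of [mcl_gc]. *)
Lemma mcl_osc2 s k t l v : om s k t l = 0 -> S v -> S (osc s k (osc t l v)).
Proof.
have omc c i : om c i (conj c) (- 1 - i) != 0.
  have i0 : i + (- 1 - i) + 1 == 0 by apply/eqP; lia.
  by rewrite /om eqxx i0 wt_neq0.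
case: s => -[] e; case: t => -[] d o0 Sv; last first.
- have := omc (true, true) 0; set z := om _ _ _ _ => z0; apply: (mclZI z0).
  have -> : z *: osc (false, e) k (osc (false, d) l v) =
      osc (false, e) k (osc (true, true) 0 (osc (false, d) l (osc (true, false) (- 1 - 0) v)))
    + osc (false, d) l (osc (true, false) (- 1 - 0) (osc (false, e) k (osc (true, true) 0 v))).
    rewrite -!gc_comm -(gb_comm _ o0) -oscD -oscD.
    rewrite [osc (true, true) _ _]osc_comm /sgp expr1 scaleN1r -/z addrAC addNr add0r.
    by rewrite !oscZ.
  by apply: mclD; do 2 apply: mcl_gc.
- exact: mcl_gc.
- by rewrite -gc_comm; exact: mcl_gc.
have := omc (false, true) 0; set z := om _ _ _ _ => z0; apply: (mclZI z0).
have -> : z *: osc (true, e) k (osc (true, d) l v) =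
    osc (false, true) 0 (osc (true, e) k (osc (false, false) (- 1 - 0) (osc (true, d) l v)))
  + osc (false, false) (- 1 - 0) (osc (true, d) l (osc (false, true) 0 (osc (true, e) k v))).
  rewrite -[osc (true, e) k (osc (false, _) _ _)]gc_comm.
  rewrite -[osc (true, d) l (osc (false, _) _ _)]gc_comm.
  rewrite [osc (true, d) l (osc (true, e) _ _)]cc_comm; last first.
    by rewrite om_sym o0 mulr0.
  rewrite [osc (false, true) 0 _]osc_comm /sgp expr0 scale1r -/z !oscN.
  by rewrite addrAC subrr add0r.
by apply: mclD; do 2 apply: mcl_gc.
Qed.

End AdmissibleCoefficients.

(** * Minimality of the even and odd parts *)

Section Irreducibility.
Variable K : numFieldType.
Local Notation fock := (freemod K state).
Local Notation osc := (@osc K).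
Local Notation om := (@om K).
Local Notation modeop := (@modeop K).
Local Notation vac := (@vac K).
Local Notation quad := (@quad K).
Implicit Types (s t r : species) (k l m p : int) (u v : fock) (x y : state) (j : bool).

Definition supported (P : state -> Prop) v := forall x, v x != 0 -> P x.
Definition homog j : set fock := [set v | supported (fun x => odd (num x) = j) v].

Lemma supported0 P : supported P 0.
Proof. by move=> x; rewrite fm_zeroE eqxx. Qed.

Lemma supportedL P (a : K) u v : supported P u -> supported P v -> supported P (a *: u + v).
Proof.
move=> Pu Pv x; rewrite fm_addE fm_scaleE.
have [v0|/Pv//] := eqVneq (v x) 0; have [u0|/Pu//] := eqVneq (u x) 0.
by rewrite u0 v0 mulr0 addr0 eqxx.
Qed.

Lemma supportedD P u v : supported P u -> supported P v -> supported P (u + v).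
Proof. by move=> Pu Pv; rewrite -[u]scale1r; apply: supportedL. Qed.
Lemma supportedZ P (a : K) v : supported P v -> supported P (a *: v).
Proof. by move=> Pv; rewrite -[_ *: _]addr0; apply: supportedL => //; exact: supported0. Qed.
Lemma supportedN P v : supported P v -> supported P (- v).
Proof. by move=> Pv; rewrite -scaleN1r; exact: supportedZ. Qed.

Lemma supported_bas (P : state -> Prop) x : P x -> supported P (bas K x).
Proof. by move=> Px y; rewrite basE; case: (eqVneq y x) => [->//|_]; rewrite eqxx. Qed.

Lemma supported_lin (P Q : state -> Prop) (T : {linear fock -> fock}) :
  (forall x, P x -> supported Q (T (bas K x))) ->
  forall v, supported P v -> supported Q (T v).
Proof.
move=> PQ v Pv; apply: (@freemod_ind _ _ (fun v => supported Q (T v))) => [|a u w Qu Qw|x vx].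
- by rewrite linear0; exact: supported0.
- by rewrite linearP; exact: supportedL.
by apply: PQ; exact: Pv.
Qed.

Lemma supported_annihilate s (n N : nat) v : supported (fun x => num x <= N)%N v ->
  supported (fun x => num x <= N.-1)%N (osc s n v).
Proof.
apply: (supported_lin (T := osc s n)) => x xN /=.
have [c [y [-> cy]]] := osc_bas K s n x.
have [->|/cy/= xy] := eqVneq c 0; first by rewrite scale0r; exact: supported0.
by apply: supportedZ; apply: supported_bas; rewrite /= -ltnS -xy (leq_trans xN) // leqSpred.
Qed.

Lemma homog_osc s k j v : homog j v -> homog (~~ j) (osc s k v).
Proof.
apply: (supported_lin (T := osc s k)) => x xj /=.
have [c [y [-> cy]]] := osc_bas K s k x.
have [->|/cy xy] := eqVneq c 0; first by rewrite scale0r; exact: supported0.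
apply: supportedZ; apply: supported_bas; rewrite /= -xj.
by case: ifP xy => _ ->; rewrite /= ?negbK.
Qed.

Lemma homog_quad s t f m j v : homog j v -> homog j (quad s t f m v).
Proof.
move=> hv; have [A hA] := quad_finsum s t f m v.
have -> : quad s t f m v = zsum (fun k => f k *: nop s (m - 1 - k) t k v) by [].
rewrite (zsumE hA); elim/big_rec: _ => [|k u _ hu]; first exact: supported0.
apply: supportedL => //; rewrite nopE -scaleNr; apply: supportedD; last exact: supportedZ.
by rewrite -[j]negbK; do 2 apply: homog_osc.
Qed.

Lemma homog_modeop a m j v : homog j v -> homog j (modeop a m v).
Proof.
move=> hv; rewrite modeop_def; case: a => /=;
  do ?[apply: supportedD | apply: supportedN | apply: supportedZ | exact: homog_quad | by []].
Qed.

Lemma supportedW P Q v : (forall x, P x -> Q x) -> supported P v -> supported Q v.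
Proof. by move=> PQ Pv x /Pv/PQ. Qed.

Section Minimal.
Variable S : set fock.
Hypothesis hS : mode_closed S.

Lemma num_le1 x j : odd (num x) = j -> (num x <= j)%N \/ exists N, num x = N.+2.
Proof. by case: (num x) => [|[|N]] <-; [left|left|right; exists N]. Qed.

(** By parity a state with more than j quanta has at least two to spare. Annihilating two quanta of
    such a state stays in S, keeps the parity, lowers the maximal number of quanta, and does not
    kill the vector. *)
Lemma mcl_lower j v : S v -> v != 0 -> homog j v ->
  exists u, [/\ S u, u != 0, homog j u & supported (fun x => num x <= j)%N u].
Proof.
move=> + + hv; have [N vN] : exists N, supported (fun x => num x <= N)%N v.
  exists (\max_(x <- fm_supp v) num x)%N => x vx.
  have xs : x \in fm_supp v by apply: contraNT vx => /fm_suppP->.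
  by rewrite (big_fsetD1 x) //= leq_maxl.
elim: N v hv vN => [|N IH] v hv vN Sv v0.
  by exists v; split=> // x /vN; rewrite leqn0 => /eqP->.
have [/eqP hx|hx] := boolP `[< exists x, v x != 0 /\ ~~ (num x <= j)%N >]; last first.
  exists v; split=> // x vx; apply: contraNT hx => xj.
  by apply/asboolP; exists x.
move/eqP: hx => /asboolP[x [vx xj]].
have [|[M xM]] := num_le1 (hv _ vx); first by rewrite (negPf xj).
have xv : x <> vst by move=> xE; rewrite xE /num stat_vst in xM.
have [s [n [y [xy sE]]]] := state_split K xv.
have yv : y <> vst by move=> yE; rewrite xy yE /num stat_vst in xM.
have [t [m [z [yz tE]]]] := state_split K yv.
apply: (IH (osc t m (osc s n v))).
- by rewrite -[j]negbK; do 2 apply: homog_osc.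
- apply: (supportedW _ (supported_annihilate (supported_annihilate vN))) => w.
  by move/leq_trans; apply; exact: leq_pred.
- by apply: (mcl_osc2 hS); rewrite ?om_eq0.
by apply: contra_neq vx => w0; apply/sE/tE; rewrite w0.
Qed.

Lemma supported_num0 v : supported (fun x => num x <= 0)%N v -> v = vev v *: vac.
Proof.
move=> v0; apply: freemodP => x; rewrite fm_scaleE basE.
case: (eqVneq x vst) => [->|/eqP xv]; first by rewrite mulr1.
rewrite mulr0; apply: contra_notP xv => /eqP/v0.
by rewrite leqn0 => /eqP/num_eq0.
Qed.

Lemma mcl_one v : S v -> v != 0 -> homog true v -> supported (fun x => num x <= 1)%N v ->
  forall t (m : nat), S (osc t (Negz m) vac).
Proof.
move=> Sv v0 hv v1.
have [x vx] : exists x, v x != 0.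
  apply: contra_notP (negP v0) => /forallNP h; apply/eqP/freemodP => x.
  by apply/eqP; rewrite fm_zeroE -[_ == _]negbK; apply/negP.
have x1 : num x = 1%N by have := v1 _ vx; have := hv _ vx; case: (num x) => [|[|]].
have xv : x <> vst by move=> xE; rewrite xE /num stat_vst in x1.
have [s [n [y [xy sE]]]] := state_split K xv.
have vE := supported_num0 (supported_annihilate (s := s) (n := n) v1).
have yE : y = vst by apply: num_eq0; move: xy; rewrite x1 => -[<-].
have c0 : vev (osc s n v) != 0.
  apply: contra_neq vx => c0; apply: sE.
  by rewrite vE c0 scale0r fm_zeroE.
(* Annihilating and then creating reaches every one-quantum state whose creator has an index not
   opposite to that of the annihilator. *)
have far t (m : nat) : (Negz m + n%:Z + 1 == 0) = false -> S (osc t (Negz m) vac).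
  move=> mn; apply: (mclZI hS c0); rewrite -oscZ -vE; apply: (mcl_osc2 hS) => //.
  by rewrite om_eq0 // mn.
move=> t m; have [mn|] := boolP (Negz m + n%:Z + 1 == 0); last by move/negPf/far.
(* The remaining creator is reached through the next one: create a quantum of t at m + 1, then
   annihilate it and create one at m; this last pair commutes. *)
pose r := conj t; have cr : conj r = t by rewrite /r /conj /= negbK -surjective_pairing.
have o0 : om r m.+1 t (Negz m.+1) != 0.
  have m0 : m.+1%:Z + Negz m.+1 + 1 == 0 by apply/eqP; lia.
  by rewrite /om -cr eqxx m0 wt_neq0.
apply: (mclZI hS o0); rewrite -oscZ.
have -> : om r m.+1 t (Negz m.+1) *: vac = osc r m.+1 (osc t (Negz m.+1) vac).
  by rewrite osc_comm osc_vac // osc0 scaler0 add0r.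
apply: (mcl_osc2 hS); first by rewrite om_eq0 //; apply/eqP; lia.
by apply: far; apply/eqP; lia.
Qed.

(** From the states with at most one quantum, all others of the same parity are built by adding
    quanta two at a time. *)
Lemma mcl_bas j v : S v -> v != 0 -> homog j v -> forall x, odd (num x) = j -> S (bas K x).
Proof.
move=> Sv v0 hv; have [u [Su u0 hu uj]] := mcl_lower Sv v0 hv.
have base x : (num x <= j)%N -> odd (num x) = j -> S (bas K x).
  case: j hu uj {hv} => hu uj; last first.
    rewrite leqn0 => /eqP/num_eq0-> _; have uE := supported_num0 uj.
    apply: (mclZI hS (a := vev u)); last by rewrite -[bas K _]/vac -uE.
    by apply: contra_neq u0 => c0; rewrite uE c0 scale0r.
  move=> x1 xodd; have xv : x <> vst by move=> xE; rewrite xE /num stat_vst in xodd.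
  have [s [n [y [c c0 [xy yE]]]]] := state_create K xv.
  have yv : y = vst by apply: num_eq0; move: x1; rewrite xy ltnS leqn0 => /eqP.
  apply: (mclZI hS c0); rewrite -yE yv; exact: (mcl_one Su u0 hu uj).
move=> x; have [N] := ubnP (num x); elim: N x => // N IH x xN xj.
have [|[M xM]] := num_le1 xj; first by move/base; apply.
have xv : x <> vst by move=> xE; rewrite xE /num stat_vst in xM.
have [s [n [y [c c0 [xy yE]]]]] := state_create K xv.
have yv : y <> vst by move=> yE'; rewrite xy yE' /num stat_vst in xM.
have [t [m [z [d d0 [yz zE]]]]] := state_create K yv.
apply: (mclZI hS (mulf_neq0 d0 c0)); rewrite -scalerA -yE -oscZ -zE.
apply: (mcl_osc2 hS); first by rewrite om_eq0.
by apply: IH; [rewrite xy yz ltnS in xN; exact: ltnW|rewrite -xj xy yz /= negbK].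
Qed.

Theorem mcl_homog j v : S v -> v != 0 -> homog j v -> forall u, homog j u -> S u.
Proof.
move=> Sv v0 hv u hu; apply: (@freemod_ind _ _ S) => [|a w w' Sw Sw'|x /hu].
- exact: mcl0.
- by apply: mclD => //; apply: mclZ.
- exact: mcl_bas hv x.
Qed.

End Minimal.
End Irreducibility.

(** * Uniqueness of irreducible highest weight modules *)

Section Modules.
Local Open Scope classical_set_scope.
Local Open Scope ring_scope.
Variables (R : realType) (c : R[i]).
Local Notation C := R[i].
Implicit Types (a b : N4gen) (m n : int).

Definition charge a : int :=
  match a with
  | L | J0 => 0 | Jp => 2 | Jm => - 2
  | Gp | Gbp => 1 | Gm | Gbm => - 1
  end.

Definition lowering a n : bool :=
  (n < 0) || (n == 0) && (if a is (Jm | Gm | Gbm) then true else false).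

Section OneModule.
Variable V : ramond_module c.
Implicit Types u v w : V.

Lemma modeD a n u v : mode V a n (u + v) = mode V a n u + mode V a n v.
Proof. exact: linearD. Qed.
Lemma modeZ a n (k : C) v : mode V a n (k *: v) = k *: mode V a n v.
Proof. exact: linearZ. Qed.
Lemma modeB a n u v : mode V a n (u - v) = mode V a n u - mode V a n v.
Proof. exact: linearB. Qed.
Lemma mode0 a n : mode V a n 0 = 0.
Proof. exact: linear0. Qed.

Lemma falling0 (x : C) : falling x 0 = 1.
Proof. by rewrite /falling big_ord0. Qed.
Lemma falling1 (x : C) : falling x 1 = x.
Proof. by rewrite /falling big_ord_recl big_ord0 subr0 mulr1. Qed.

Lemma mode_commL a n v :
  mode V L 0 (mode V a n v) = mode V a n (mode V L 0 v) - n%:~R *: mode V a n v.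
Proof.
have := @mode_comm _ _ V L a 0 n v (leq0n _).
rewrite expr0 scale1r => /eqP; rewrite subr_eq => /eqP->; rewrite addrC; congr (_ + _).
have w1 : 2%:R - 1 = 1 :> C by ring.
have w3 : falling (2%:R - 1 : C) 3 = 0.
  by rewrite w1 /falling !big_ord_recl /= subrr mul0r mulr0.
have E k u : (1 * falling (2%:R - 1) 0) *: (- (n%:~R + k) *: u) +
    (k * falling (2%:R - 1) 1) *: u = - (n%:~R *: u).
  rewrite falling0 falling1 w1 !mulr1 scale1r -scalerDl -scaleNr; congr (_ *: _); ring.
rewrite /mode_bracket; case: a => /=; rewrite !big_cons big_nil ?addr0 /= ?add0r; last first.
1-7: exact: E.
rewrite addrA.
by rewrite w3 mulr0 scale0r addr0; exact: E.
Qed.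

Lemma mode_commJ a n v : mode V J0 0 (mode V a n v) =
  mode V a n (mode V J0 0 v) + (charge a)%:~R *: mode V a n v.
Proof.
have JL : mode V J0 0 (mode V L n v) = mode V L n (mode V J0 0 v).
  have := @mode_comm _ _ V L J0 n 0 v isT; rewrite expr0 scale1r => /eqP.
  rewrite subr_eq => /eqP->; rewrite -[LHS]add0r; congr (_ + _); apply/esym.
  rewrite /mode_bracket !big_cons big_nil /= addr0 falling0 falling1 !addr0 /=.
  rewrite scalerA -scalerDl -[RHS](scale0r (mode V J0 n v)); congr (_ *: _); ring.
have E b : (0 < N4rank b)%N -> mode V J0 0 (mode V b n v) - mode V b n (mode V J0 0 v) =
    mode_bracket c (mode V) J0 b 0 n v.
  by move=> b0; rewrite -mode_comm // expr0 scale1r.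
apply/eqP; rewrite -subr_eq0 opprD addrA subr_eq0; apply/eqP.
case: a; last 7 first.
1-7: rewrite E // /mode_bracket /= big_cons big_nil /= addr0 ?falling0 ?falling1 add0r ?mulr1 //.
- by rewrite subrr mulr0 !scale0r.
by rewrite JL subrr scale0r.
Qed.

(* The eigenvalues of 3 L_0 - J_0 strictly increase under lowering modes. *)
Definition energy u : V := 3%:R *: mode V L 0 u - mode V J0 0 u.

(** The factor 3 of the energy outweighs the charges, which are at most 2 in absolute value; the
    lowering modes of index 0 are ordered by J_0 alone. *)
Definition step a n : int := - (3 * n) - charge a.

Lemma lowering_step a n : lowering a n -> 0 < step a n.
Proof. by rewrite /lowering /step; case: a => /=; lia. Qed.

Lemma energyL (k : C) u v : energy (k *: u + v) = k *: energy u + energy v.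
Proof.
by rewrite /energy !modeD !modeZ scalerDr scalerBr opprD addrACA !scalerA [3%:R * k]mulrC.
Qed.

Lemma energy_mode a n u :
  energy (mode V a n u) = mode V a n (energy u) + (step a n)%:~R *: mode V a n u.
Proof.
rewrite /energy mode_commL mode_commJ modeB modeZ scalerBr opprD addrACA.
by rewrite /step rmorphB rmorphN rmorphM /= scalerA scalerBl scaleNr.
Qed.

Variable e0 : C.

Inductive above : V -> Prop :=
  | Above0 : above 0
  | AboveL (k : C) u v : above u -> above v -> above (k *: u + v)
  | AboveE (m : nat) u : energy u = (e0 + m.+1%:R) *: u -> above u.

Lemma above_lowering a n u : lowering a n -> above u -> above (mode V a n u).
Proof.
move=> /lowering_step an; elim=> [|k {}u v _ IHu _ IHv|m {}u uE].
- by rewrite mode0; exact: Above0.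
- by rewrite modeD modeZ; exact: AboveL.
have {}an : exists p : nat, step a n = p.+1%:Z.
  by case: (step a n) an => [[|p]|] // _; exists p.
case: an => p pE; apply: (@AboveE (m + p.+1)%N).
rewrite energy_mode uE modeZ pE -scalerDl; congr (_ *: _).
by rewrite -addrA -addSn natrD.
Qed.

(** The product of the operators energy - (e0 + i) for i = 1, ..., N. For suitable N it kills a
    given vector of [above], while on an eigenvector of eigenvalue e0 it is a nonzero scalar; hence
    [above_eigen], without diagonalising the module. *)
Fixpoint energy_poly (N : nat) u : V :=
  if N is M.+1 then energy (energy_poly M u) - (e0 + N%:R) *: energy_poly M u else u.

Lemma energy0 : energy 0 = 0.
Proof. by rewrite /energy !mode0 scaler0 subr0. Qed.

Lemma energy_polyL N (k : C) u v :
  energy_poly N (k *: u + v) = k *: energy_poly N u + energy_poly N v.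
Proof.
elim: N => //= N ->; rewrite energyL [_ *: (_ + energy_poly N v)]scalerDr opprD addrACA.
by congr (_ + _); rewrite [RHS]scalerBr !scalerA [k * _]mulrC.
Qed.

Lemma energy_poly_eigen N (x : C) u : energy u = x *: u ->
  energy_poly N u = (\prod_(i < N) (x - e0 - i.+1%:R)) *: u.
Proof.
move=> uE; elim: N => [|N IH] /=; first by rewrite big_ord0 scale1r.
have := energyL (\prod_(i < N) (x - e0 - i.+1%:R)) u 0.
rewrite IH energy0 !addr0 uE => ->; rewrite !scalerA -scalerBl.
by rewrite big_ord_recr /=; congr (_ *: _); ring.
Qed.

Lemma energy_poly_le M N u : (M <= N)%N -> energy_poly M u = 0 -> energy_poly N u = 0.
Proof.
move=> /subnK <-; elim: (N - M)%N => // p IH u0.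
by rewrite addSn /= IH // energy0 scaler0 subr0.
Qed.

Lemma above_poly u : above u -> exists N, energy_poly N u = 0.
Proof.
elim=> [|k {}u v _ [M uM] _ [N vN]|m {}u uE]; first by exists 0%N.
  exists (maxn M N); rewrite energy_polyL.
  rewrite (energy_poly_le (leq_maxl M N) uM) (energy_poly_le (leq_maxr M N) vN).
  by rewrite scaler0 addr0.
exists m.+1; rewrite (energy_poly_eigen _ uE) big_ord_recr /=.
by rewrite [X in _ * X](_ : _ = 0) ?mulr0 ?scale0r //; ring.
Qed.

Lemma above_eigen u : energy u = e0 *: u -> above u -> u = 0.
Proof.
move=> uE /above_poly[N]; rewrite (energy_poly_eigen _ uE) => /eqP.
rewrite scaler_eq0 => /orP[|/eqP//]; rewrite prodf_seq_eq0 => /hasP[i _] /=.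
by rewrite subrr sub0r oppr_eq0 pnatr_eq0.
Qed.

End OneModule.

Section TwoModules.
Variables (V W : ramond_module c) (h s : C) (v0 : V) (w0 : W).
Hypothesis (hv0 : highest_weight_vector h s v0) (hw0 : highest_weight_vector h s w0).
Implicit Types (u v : V) (w z : W).

(* The subspace of V x W generated from (v0, w0) by the lowering modes; it turns
   out to be stable under all modes. *)
Inductive linked : V -> W -> Prop :=
  | Linked1 : linked v0 w0
  | LinkedL (k : C) u w u' w' : linked u w -> linked u' w' ->
      linked (k *: u + u') (k *: w + w')
  | LinkedM a n u w : lowering a n -> linked u w -> linked (mode V a n u) (mode W a n w).

Lemma linked0 : linked 0 0.
Proof.
have := LinkedL (- 1) Linked1 Linked1; rewrite !scaleN1r !addNr; exact.
Qed.
Lemma linkedZ (k : C) u w : linked u w -> linked (k *: u) (k *: w).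
Proof. by move=> uw; have := LinkedL k uw linked0; rewrite !addr0. Qed.

Lemma linked_sum (T : Type) (r : seq T) (k : T -> C) (u : T -> V) (w : T -> W) :
  (forall i, linked (u i) (w i)) ->
  linked (\sum_(i <- r) k i *: u i) (\sum_(i <- r) k i *: w i).
Proof.
move=> uw; elim: r => [|i r IH]; first by rewrite !big_nil; exact: linked0.
by rewrite !big_cons; exact: LinkedL.
Qed.

Lemma linked_bracket a b m n u w : (forall a n, linked (mode V a n u) (mode W a n w)) ->
  linked u w -> linked (mode_bracket c (mode V) a b m n u) (mode_bracket c (mode W) a b m n w).
Proof.
move=> um uw; apply: linked_sum => -[[k j] x] /=; case: x => [|d|d] /=.
- by case: ifP => _ //; exact: linked0.
- exact: um.
- by apply: linkedZ; exact: um.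
Qed.

(** A mode is moved past the lowering modes by the commutator formula until it meets (v0, w0), where
    the highest weight conditions have the same scalars on both sides. *)
Lemma linked_mode a n u w : linked u w -> linked (mode V a n u) (mode W a n w).
Proof.
move=> uw; elim: uw a n => [|k {}u {}w u' w' _ IH _ IH'|b m {}u {}w bm uw IH] a n.
- have [an|] := boolP (lowering a n); first exact/LinkedM/Linked1.
  case: hv0 => _ _ vp [vJ vG vGb] [vL vJ0]; case: hw0 => _ _ wp [wJ wG wGb] [wL wJ0].
  rewrite /lowering negb_or -leNgt le_eqVlt => /andP[/orP[/eqP<-|n0] an]; last first.
    by rewrite vp // wp //; exact: linked0.
  move: an; rewrite eqxx; case: a => //= _; rewrite ?vJ ?vG ?vGb ?wJ ?wG ?wGb ?vL ?wL ?vJ0 ?wJ0.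
  1-5: by [exact: linked0 | apply: linkedZ; exact: Linked1].
- by rewrite !(modeD, modeZ); exact: LinkedL.
have base : linked (mode V b m (mode V a n u)) (mode W b m (mode W a n w)).
  exact: LinkedM.
(* The commutator formula is available in one order of the ranks; in the other order it is solved
   for the wanted product. *)
have [ab|/ltnW ba] := leqP (N4rank a) (N4rank b).
  have sw (X : ramond_module c) (x : X) : mode X a n (mode X b m x) =
      (- 1) ^+ (N4odd a && N4odd b) *: mode X b m (mode X a n x) + mode_bracket c (mode X) a b n m x.
    by rewrite -(mode_comm _ _ _ ab) addrC subrK.
  by rewrite !sw; apply: LinkedL => //; exact: linked_bracket.
have sw (X : ramond_module c) (x : X) : mode X a n (mode X b m x) =
    (- (- 1) ^+ (N4odd b && N4odd a)) *: mode_bracket c (mode X) b a m n x +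
    (- 1) ^+ (N4odd b && N4odd a) *: mode X b m (mode X a n x).
  rewrite -(mode_comm _ _ _ ba) scalerBr !scaleNr opprK scalerA -expr2 sqrr_sign scale1r.
  by rewrite addrAC addNr add0r.
by rewrite !sw; apply: LinkedL; [exact: linked_bracket|exact: linkedZ].
Qed.

Lemma linked_parity u w : linked u w -> linked (parity V u) (parity W w).
Proof.
elim=> [|k {}u {}w u' w' _ IH _ IH'|a n {}u {}w an _ IH].
- by case: hv0 => _ -> _ _ _; case: hw0 => _ -> _ _ _; exact: Linked1.
- by rewrite !linearP; exact: LinkedL.
- by rewrite !mode_parity; apply: linkedZ; exact: LinkedM.
Qed.

Lemma energy_hw (X : ramond_module c) (x : X) : highest_weight_vector h s x ->
  energy x = (3%:R * h - s) *: x.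
Proof. by case=> _ _ _ _ [xL xJ]; rewrite /energy xL xJ scalerA scalerBl. Qed.

(** What matters is that both components have the same coefficient [k] at the highest weight
    vectors; this excludes the pair (v0, 0). *)
Lemma linked_above u w : linked u w -> exists (k : C) u' w',
  [/\ above (3%:R * h - s) u', above (3%:R * h - s) w', u = k *: v0 + u' & w = k *: w0 + w'].
Proof.
elim=> [|k {}u {}w ? ? _ [a [u' [w' [hu hw -> ->]]]] _ [b [v' [z' [hv hz -> ->]]]]|a n {}u {}w an].
- by exists 1, 0, 0; split; rewrite ?scale1r ?addr0 //; exact: Above0.
- exists (k * a + b), (k *: u' + v'), (k *: w' + z'); split.
  + exact: AboveL.
  + exact: AboveL.
  + by rewrite scalerDr scalerA scalerDl addrACA.
  + by rewrite scalerDr scalerA scalerDl addrACA.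
have low (X : ramond_module c) (x : X) : highest_weight_vector h s x ->
    above (3%:R * h - s) (mode X a n x).
  move=> hx; have := lowering_step an; case sE: (step a n) => [[|p]|] // _.
  apply: (AboveE (m := p)).
  by rewrite energy_mode (energy_hw hx) modeZ -scalerDl sE.
move=> _ [b [u' [w' [hu hw -> ->]]]]; exists 0, (mode V a n (b *: v0 + u')), (mode W a n (b *: w0 + w')).
split; rewrite ?scale0r ?add0r // modeD modeZ; apply: AboveL; try exact: low.
all: exact: above_lowering.
Qed.

Lemma hw_not_above (X : ramond_module c) (x : X) : highest_weight_vector h s x ->
  ~ above (3%:R * h - s) x.
Proof. by move=> hx /(above_eigen (energy_hw hx)) x0; case: hx => /eqP. Qed.

Lemma not_linked0r : ~ linked v0 0.
Proof.
move=> /linked_above[a [u' [w' [hu hw uE wE]]]].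
have [a0|a0] := eqVneq a 0.
  by apply: (hw_not_above hv0); rewrite uE a0 scale0r add0r.
apply: (hw_not_above hw0); rewrite (_ : w0 = (- a^-1) *: w' + 0).
  by apply: AboveL => //; exact: Above0.
have -> : w' = - (a *: w0) by apply/eqP; rewrite -addr_eq0 addrC -wE.
by rewrite addr0 scalerN scaleNr opprK scalerA mulVf // scale1r.
Qed.

End TwoModules.

Lemma linked_sym (V W : ramond_module c) (v0 : V) (w0 : W) u w :
  linked v0 w0 u w -> linked w0 v0 w u.
Proof.
elim=> [|k {}u {}w u' w' _ IH _ IH'|a n {}u {}w an _ IH].
- exact: Linked1.
- exact: LinkedL.
- exact: LinkedM.
Qed.

(** * Multiplicities carried along the graph of the linked pairs *)

Section Transfer.
Variables (V W : ramond_module c) (h s : C) (v0 : V) (w0 : W) (F : set W).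
Hypothesis (hv0 : highest_weight_vector h s v0) (hw0 : highest_weight_vector h s w0).
Hypothesis (Vgen : forall S : set V, submodule S -> S v0 -> S = setT).
Hypothesis (Virr : forall S : set V, submodule S -> S = [set 0] \/ S = setT).
Hypothesis (Fsub : submodule F) (Fw0 : F w0).
(** In the application W is the whole Fock space, which is reducible; irreducibility and generation
    are therefore stated relative to its submodule [F]. *)
Hypothesis (Firr : forall S : set W, submodule S -> S `<=` F -> S w0 \/ S `<=` [set 0]).
Hypothesis (Fgen : forall S : set W, submodule S -> S w0 -> F `<=` S).
Local Notation lk := (linked v0 w0).

Lemma linkedF u w : lk u w -> F w.
Proof.
elim=> [//|k {}u {}w u' w' _ Fw _ Fw'|a n {}u {}w an _ Fw].
- by case: Fsub => _ + _ _; apply.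
- by case: Fsub => _ _ _; apply.
Qed.

(** The vectors linked to 0 form a submodule that misses v0, so irreducibility makes it zero. *)
Lemma linked_inj u : lk u 0 -> u = 0.
Proof.
have sub : submodule [set u | lk u 0].
  split=> [|k v v' hv hv'|v hv|a n v hv] /=.
  - exact: linked0.
  - by rewrite -[0 : W](scaler0 _ k) -[X in lk _ X]addr0; exact: LinkedL.
  - by have := linked_parity hv0 hw0 hv; rewrite linear0.
  - by have := linked_mode hv0 hw0 a n hv; rewrite mode0.
case: (Virr sub) => [SE|ST] hu; first by have : [set u | lk u 0] u by []; rewrite SE.
have : [set u | lk u 0] v0 by rewrite ST.
by move/(not_linked0r hv0 hw0).
Qed.

Lemma linked_fun w : lk 0 w -> w = 0.
Proof.
have sub : submodule [set w | lk 0 w].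
  split=> [|k v v' hv hv'|v hv|a n v hv] /=.
  - exact: linked0.
  - by rewrite -[0 : V](scaler0 _ k) -[X in lk X _]addr0; exact: LinkedL.
  - by have := linked_parity hv0 hw0 hv; rewrite linear0.
  - by have := linked_mode hv0 hw0 a n hv; rewrite mode0.
have sF : ([set w | lk 0 w] `<=` F) by move=> w' /linkedF.
case: (Firr sub sF) => [/linked_sym/(not_linked0r hw0 hv0)//|S0].
exact: S0.
Qed.

Lemma linked_total u : exists w, lk u w.
Proof.
have sub : submodule [set u | exists w, lk u w].
  split=> [|k v v' [w hw] [w' hw']|v [w hw]|a n v [w hw]] /=.
  - by exists 0; exact: linked0.
  - by exists (k *: w + w'); exact: LinkedL.
  - by exists (parity W w); exact: (linked_parity hv0 hw0).
  - by exists (mode W a n w); exact: (linked_mode hv0 hw0).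
suff ST : [set u | exists w, lk u w] = setT by have : [set: V] u by []; rewrite -ST.
by apply: Vgen sub _; exists w0; exact: Linked1.
Qed.

Lemma linked_onto w : F w -> exists u, lk u w.
Proof.
have sub : submodule [set w | exists u, lk u w].
  split=> [|k v v' [u hu] [u' hu']|v [u hu]|a n v [u hu]] /=.
  - by exists 0; exact: linked0.
  - by exists (k *: u + u'); exact: LinkedL.
  - by exists (parity V u); exact: (linked_parity hv0 hw0).
  - by exists (mode V a n u); exact: (linked_mode hv0 hw0).
by apply: (Fgen sub); exists v0; exact: Linked1.
Qed.

Lemma has_dim_transfer p x d :
  has_dim ([set w | F w /\ weight_space p x w]) d -> has_dim (weight_space (V := V) p x) d.
Proof.
move=> [b [bF bfree bspan]].
have [g gb] : {g : 'I_d -> V & forall i, lk (g i) (b i)}.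
  by apply: (@choice _ _ (fun i u => lk u (b i))) => i; apply: linked_onto; case: (bF i).
have eqV u v w : lk u w -> lk v w -> u = v.
  move=> uw vw; apply/eqP; rewrite -subr_eq0; apply/eqP/linked_inj.
  by have := LinkedL (- 1) vw uw; rewrite !scaleN1r addNr addrC.
have eqW u w z : lk u w -> lk u z -> w = z.
  move=> uw uz; apply/eqP; rewrite -subr_eq0; apply/eqP/linked_fun.
  by have := LinkedL (- 1) uz uw; rewrite !scaleN1r addNr addrC.
have lsum k : lk (\sum_i k i *: g i) (\sum_i k i *: b i) by apply: linked_sum.
exists g; split=> [i|k k0|v [vp vL vJ]].
- have [_ [bp bL bJ]] := bF i; split; apply: eqV.
  + exact: linked_parity hv0 hw0 _ _ (gb i).
  + by rewrite bp; exact: linkedZ.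
  + exact: linked_mode hv0 hw0 _ _ _ _ (gb i).
  + by rewrite bL; exact: linkedZ.
  + exact: linked_mode hv0 hw0 _ _ _ _ (gb i).
  + by rewrite bJ; exact: linkedZ.
- by apply: bfree; apply: linked_fun; rewrite -k0.
have [w vw] := linked_total v.
have wE : F w /\ weight_space p x w.
  split; first exact: linkedF vw.
  split; apply: eqW.
  + exact: linked_parity hv0 hw0 _ _ vw.
  + by rewrite vp; exact: linkedZ.
  + exact: linked_mode hv0 hw0 _ _ _ _ vw.
  + by rewrite vL; exact: linkedZ.
  + exact: linked_mode hv0 hw0 _ _ _ _ vw.
  + by rewrite vJ; exact: linkedZ.
have [k wk] := bspan w wE; exists k; apply: (eqV _ _ w) => //.
by rewrite wk.
Qed.

End Transfer.
End Modules.

(** * Weight spaces of the Fock space *)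

Section Weights.
Implicit Types (x y : state) (i m N : nat).

(** Twice the energy above the vacuum: the code 2k + e belongs to an oscillator of energy k +
    1/2. *)
Definition deg : state -> nat :=
  stat (fun i => (i./2).*2.+1) (fun i => (i./2).*2.+1).
Definition chg : state -> int :=
  stat (fun i => if odd i then 1 else - 1) (fun=> 0).

Lemma deg_vst : deg vst = 0%N. Proof. exact: stat_vst. Qed.
Lemma deg_inc x i : deg (inc x.1 i, x.2) = ((i./2).*2.+1 + deg x)%N.
Proof. exact: stat_inc. Qed.
Lemma deg_fsetU1 x i : i \notin x.2 -> deg (x.1, (i |` x.2)%fset) = ((i./2).*2.+1 + deg x)%N.
Proof. exact: stat_fsetU1. Qed.
Lemma chg_vst : chg vst = 0. Proof. exact: stat_vst. Qed.
Lemma chg_inc x i : chg (inc x.1 i, x.2) = (if odd i then 1 else - 1) + chg x.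
Proof. exact: stat_inc. Qed.
Lemma chg_fsetU1 x i : i \notin x.2 -> chg (x.1, (i |` x.2)%fset) = chg x.
Proof. by move=> ix; rewrite /chg stat_fsetU1 // add0r. Qed.

(** Every quantum has odd degree, so a change of sign of t = q^(1/2) detects the parity of the
    number of quanta. *)
Lemma odd_deg x : odd (deg x) = odd (num x).
Proof.
elim/state_ind: x => [|x i IH|x i ix IH].
- by rewrite deg_vst /num stat_vst.
- by rewrite deg_inc num_inc addSn /= oddD odd_double IH.
- by rewrite deg_fsetU1 // num_fsetU1 // addSn /= oddD odd_double IH.
Qed.

Lemma deg_bound x i : (x.1 i <= deg x)%N /\ ((0 < x.1 i)%N || (i \in x.2) -> (i <= deg x)%N).
Proof.
have half j : (j <= (j./2).*2.+1)%N.
  by rewrite -{1}[j]odd_double_half -addn1 addnC leq_add2l; case: odd.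
elim/state_ind: x => [|x j [IH IH']|x j jx [IH IH']].
- by rewrite /= fsfunE !inE.
- rewrite deg_inc /= incE; split; first by apply: leq_add => //; case: (j == i).
  case: eqP => [<- _|_ /IH' h]; first exact: leq_trans (half j) (leq_addr _ _).
  exact: leq_trans h (leq_addl _ _).
- rewrite deg_fsetU1 //=; split; first by apply: leq_trans IH _; exact: leq_addl.
  rewrite in_fset1U orbCA; case: eqP => [-> _|_ /= /IH' h].
    exact: leq_trans (half j) (leq_addr _ _).
  exact: leq_trans h (leq_addl _ _).
Qed.

Definition box_step m x (kb : nat * bool) : state :=
  (iter kb.1 (fun n => inc n m) x.1, if kb.2 then (m |` x.2)%fset else x.2).

(** The states with codes below [m] and occupation numbers at most [N], listed one code at a time:
    every finite set of states lies in some box, and over a box a sum of multiplicative weights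
    factors. *)
Fixpoint box m N : seq state :=
  if m is m'.+1 then
    [seq box_step m' x kb | x <- box m' N,
       kb <- [seq (k, b) | k <- iota 0 N.+1, b <- [:: false; true]]]
  else [:: vst].

Arguments box : simpl never.

Lemma iter_inc n m k i : iter k (fun n => inc n m) n i = ((if m == i then k else 0) + n i)%N.
Proof. by elim: k => [|k IH] /=; [rewrite if_same|rewrite incE IH; case: eqP]. Qed.

Lemma boxS m N : box m.+1 N = [seq box_step m x kb | x <- box m N,
  kb <- [seq (k, b) | k <- iota 0 N.+1, b <- [:: false; true]]].
Proof. by []. Qed.

Lemma box_supp m N x i : x \in box m N -> (m <= i)%N -> x.1 i = 0%N /\ i \notin x.2.
Proof.
elim: m x => [|m IH] x; first by rewrite inE => /eqP-> _; rewrite fsfunE inE.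
rewrite boxS; case/allpairsP => -[y [k b]] /= [yB _ ->] mi.
have [y0 yi] := IH y yB (ltnW mi); rewrite /box_step /= iter_inc y0 (ltn_eqF mi).
split=> //; by case: b => //; rewrite in_fset1U gtn_eqF.
Qed.

Lemma box_mem m N x : (forall i, (x.1 i <= N)%N) ->
  (forall i, (m <= i)%N -> x.1 i = 0%N /\ i \notin x.2) -> x \in box m N.
Proof.
elim: m x => [|m IH] x xN xm.
  rewrite inE; apply/eqP; case: x xN xm => n S xN xm; congr (_, _).
    by apply/fsfunP => i; rewrite fsfunE /=; case: (xm i).
  by apply/fsetP => i; rewrite inE; apply/negbTE; case: (xm i).
pose y : state := ([fsfun x.1 with m |-> 0%N], (x.2 `\ m)%fset).
rewrite boxS; apply/allpairsP; exists (y, (x.1 m, m \in x.2)); split.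
- apply: IH => i; first by rewrite fsfun_withE; case: eqP.
  rewrite leq_eqVlt => /orP[/eqP<-|/xm[x0 ix]].
    by rewrite fsfun_withE eqxx !inE eqxx.
  by rewrite fsfun_withE x0 if_same !inE (negPf ix) andbF.
- apply/allpairsP; exists (x.1 m, m \in x.2); split=> //; last by rewrite /=; case: (m \in x.2).
  by rewrite mem_iota /= add0n ltnS.
rewrite /box_step /=; case: x {xN xm} @y => n S /=; congr (_, _).
  apply/fsfunP => i; rewrite iter_inc fsfun_withE eq_sym; case: eqP => [->|_] //.
  by rewrite addn0.
by case: ifPn => mS; [rewrite fsetD1K|apply/fsetP => i; rewrite !inE; case: eqP mS => [->/negPf->|]].
Qed.

Lemma box_uniq m N : uniq (box m N).
Proof.
elim: m => // m IH; rewrite boxS; apply: allpairs_uniq => //.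
  by apply: allpairs_uniq => //; [exact: iota_uniq|case=> a b [c d] _ _ [-> ->]].
move=> [x [k b]] [y [l c]] /allpairsP[[x' kb] [xB _ [xx _]]] /allpairsP[[y' lc] [yB _ [yy _]]].
rewrite -{}xx in xB; rewrite -{}yy in yB.
rewrite /box_step /= => -[nE SE].
have [x0 xm] := box_supp xB (leqnn m); have [y0 ym] := box_supp yB (leqnn m).
have kl : k = l by have := congr1 (fun f : {fsfun _ -> _ with _} => f m) nE; rewrite !iter_inc eqxx x0 y0 !addn0.
have bc : b = c.
  have := congr1 (fun S : {fset nat} => m \in S) SE.
  by case: b c {SE} => -[]; rewrite ?in_fset1U ?eqxx ?(negPf xm) ?(negPf ym).
subst l c; congr (_, _); case: x y nE SE {x0 y0} xm ym {xB yB} => n S [n' S'] /= nE SE xm ym.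
congr (_, _).
  apply/fsfunP => i; have := congr1 (fun f : {fsfun _ -> _ with _} => f i) nE.
  by rewrite !iter_inc; case: eqP => _; [move/addnI|].
case: b SE => // SE; apply/fsetP => i.
have := congr1 (fun S : {fset nat} => i \in S) SE; rewrite !in_fset1U.
by case: eqP => [-> _|//]; rewrite (negPf xm) (negPf ym).
Qed.

Lemma deg_box x m N : (deg x < m)%N -> (deg x <= N)%N -> x \in box m N.
Proof.
move=> dm dN; apply: box_mem => i; first by have [h _] := deg_bound x i; exact: leq_trans h dN.
move=> mi; have [_ h] := deg_bound x i.
have : ~~ ((0 < x.1 i)%N || (i \in x.2)) by apply: contraL (leq_trans dm mi) => /h; rewrite leqNgt.
by rewrite negb_or lt0n negbK => /andP[/eqP].
Qed.

End Weights.

(** * Simultaneous diagonalisation of L_0 and J_0 *)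

Section Eigenvalues.
Variable K : numFieldType.
Local Notation fock := (freemod K state).
Local Notation osc := (@osc K).
Local Notation modeop := (@modeop K).
Implicit Types (x y : state) (v : fock) (j p : bool).

Lemma modeop_eigen a (lam : state -> K) :
    N4odd a = false -> (forall s, adt a s = s) -> modeop a 0 (vac K) = lam vst *: vac K ->
    (forall x i, lam (inc x.1 i, x.2) = adc K a (false, odd i) 0 (Negz i./2) + lam x) ->
    (forall x i, i \notin x.2 ->
       lam (x.1, (i |` x.2)%fset) = adc K a (true, odd i) 0 (Negz i./2) + lam x) ->
  forall x, modeop a 0 (bas K x) = lam x *: bas K x.
Proof.
move=> aodd aid avac abos afer; elim/state_ind => // x i.
  move=> IH; rewrite -osc_binc modeop_osc aodd aid add0r IH oscZ /sgp expr0 scale1r.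
  by rewrite abos -scalerDl addrC.
move=> ix IH; apply: (scalerI (fsgn_neq0 K i x.2)).
rewrite -modeopZ scalerA mulrC -scalerA -osc_finc //.
rewrite modeop_osc aodd aid add0r IH oscZ /sgp expr0 scale1r.
by rewrite afer // -scalerDl addrC.
Qed.

Lemma L0_bas x : modeop L 0 (bas K x) = ((deg x)%:R / 2%:R - 8%:R^-1) *: bas K x.
Proof.
apply: (@modeop_eigen _ (fun x => (deg x)%:R / 2%:R - 8%:R^-1)) => // [|y i|y i iy].
- by rewrite modeop_vac //= deg_vst mul0r sub0r.
- rewrite deg_inc /= natrD -addn1 natrD -muln2 natrM /hat NegzE rmorphN /= -addn1 natrD.
  by field.
- rewrite deg_fsetU1 //= natrD -addn1 natrD -muln2 natrM /hat NegzE rmorphN /= -addn1 natrD.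
  by field.
Qed.

Lemma J0_bas x : modeop J0 0 (bas K x) = (chg x)%:~R *: bas K x.
Proof.
apply: (@modeop_eigen _ (fun x => (chg x)%:~R)) => // [|y i|y i iy].
- by rewrite modeop_vac //= chg_vst.
- by rewrite chg_inc rmorphD /=; case: odd.
- by rewrite chg_fsetU1 //= add0r.
Qed.

Lemma diag_coef (T : {linear fock -> fock}) (lam : state -> K) :
  (forall x, T (bas K x) = lam x *: bas K x) -> forall v x, T v x = lam x * v x.
Proof.
move=> TE v x; move: v.
change (forall v, (fm_coef x \o T) v = (lam x \*: fm_coef x) v); apply: lin_ext => y.
rewrite /= TE /fm_coef fm_scaleE basE; case: eqP => [->//|_].
by rewrite scaler0 mulr0.
Qed.

Lemma diag_supported (T : {linear fock -> fock}) (lam : state -> K) (c : K) :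
    (forall x, T (bas K x) = lam x *: bas K x) ->
  forall v, T v = c *: v <-> supported (fun x => lam x = c) v.
Proof.
move=> TE v; split=> [Tv x vx|hv].
  have := congr1 (fun u : fock => u x) Tv; rewrite (diag_coef TE) fm_scaleE.
  by move/(mulIf vx).
apply: freemodP => x; rewrite (diag_coef TE) fm_scaleE.
by have [->|/hv->//] := eqVneq (v x) 0; rewrite !mulr0.
Qed.

End Eigenvalues.

Section Dimensions.
Variable R : realType.
Local Notation C := R[i].
Local Notation fock := (fock_module R).
Local Open Scope classical_set_scope.
Local Open Scope ring_scope.
Implicit Types (x y : state) (j p : bool) (w : C * C).

Definition in_weight j p w x := [/\ odd (num x) = j, odd #|` x.2| = p,
  (deg x)%:R / 2%:R - 8%:R^-1 = w.1 & (chg x)%:~R = w.2].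

Lemma fock_weightE j p w :
  [set v : fock | homog j v /\ weight_space p w v] = supported (in_weight j p w).
Proof.
apply/seteqP; split=> v /=.
  case=> hv [vp vL vJ] x vx; split; first exact: hv.
  - have /(_ x vx) := (diag_supported ((- 1) ^+ p) (@parity_opE C) v).1 vp.
    rewrite -signr_odd => /(congr1 (fun a : C => a == -1)).
    by case: (odd _); case: p {vp}; rewrite ?expr1 ?expr0 ?eqxx // => /esym; rewrite eq_sym eqNr ?oner_eq0.
  - exact: ((diag_supported w.1 (@L0_bas C) v).1 vL x vx).
  - exact: ((diag_supported w.2 (@J0_bas C) v).1 vJ x vx).
move=> hv; split; first by apply: supportedW hv => x [].
split.
- apply/(diag_supported _ (@parity_opE C)); apply: supportedW hv => x [_ <- _ _].
  by rewrite signr_odd.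
- by apply/(diag_supported _ (@L0_bas C)); apply: supportedW hv => x [].
- by apply/(diag_supported _ (@J0_bas C)); apply: supportedW hv => x [].
Qed.

Definition fiber j p w : {fset state} := fset_set (in_weight j p w).

(** [fset_set] is empty on infinite sets, so the point is finiteness: the eigenvalue of L_0 fixes
    the degree, and the states of a given degree lie in one box. *)
Lemma fiberP j p w x : reflect (in_weight j p w x) (x \in fiber j p w).
Proof.
rewrite in_fset_set; first by apply: (iffP idP) => [/set_mem|/mem_set].
have [[y [_ _ yw _]]|no] := pselect (exists y, in_weight j p w y); last first.
  by apply: (sub_finite_set (B := set0)) => // y hy; case: no; exists y.
apply: (sub_finite_set (B := [set` box (deg y).+1 (deg y)])); last exact: finite_seq.
move=> z [_ _ zw _]; suff yz : deg y = deg z.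
  by rewrite yz; exact: deg_box.
move: yw; rewrite -zw => /addIr; move/(mulIf _)=> h; apply/eqP.
rewrite -(eqr_nat C); apply/eqP; apply: h.
by rewrite invr_eq0 pnatr_eq0.
Qed.

Lemma has_dim_supported (P : state -> Prop) (A : {fset state}) :
  (forall x, x \in A <-> P x) -> has_dim (supported P : set fock) #|` A|.
Proof.
move=> AP; pose e (i : 'I_#|` A|) := nth vst (enum_fset A) i.
have eA i : e i \in A by rewrite /e mem_nth // -cardfE.
have einj : injective e.
  by move=> i k /eqP; rewrite /e nth_uniq ?fset_uniq // => /eqP/val_inj.
have coefE (k : 'I_#|` A| -> C) i : (\sum_i0 k i0 *: bas C (e i0)) (e i) = k i.
  rewrite fm_sumE (bigD1 i) // fm_scaleE basE eqxx mulr1 big1 => [|l li]; first exact: addr0.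
  by rewrite fm_scaleE basE (inj_eq einj) eq_sym (negPf li) mulr0.
exists (fun i => bas C (e i)); split=> [i|k k0 i|v hv].
- by apply: supported_bas; apply/AP; exact: eA.
- by have := coefE k i; rewrite k0 fm_zeroE.
exists (fun i => (v : freemod C state) (e i)); apply: freemodP => x.
have [xA|xA] := boolP (x \in A); last first.
  rewrite fm_sumE big1 => [|i _].
    apply/eqP; apply: contraNT xA => vx; apply/AP; exact: hv.
  rewrite fm_scaleE basE; case: eqP => [xE|_]; last by rewrite mulr0.
  by rewrite xE eA in xA.
have xi : (index x (enum_fset A) < #|` A|)%N by rewrite index_mem.
have -> : x = e (Ordinal xi) by rewrite /e nth_index.
by rewrite coefE.
Qed.

Lemma fock_has_dim j p w :
  has_dim [set v : fock | homog j v /\ weight_space p w v] #|` fiber j p w|.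
Proof.
rewrite fock_weightE; apply: has_dim_supported => x.
by split=> /fiberP.
Qed.

End Dimensions.

(** * Highest weight vectors of the two parts and their multiplicities *)

Section FockHighestWeight.
Variable R : realType.
Local Notation C := R[i].
Local Notation fock := (fock_module R).
Local Open Scope classical_set_scope.
Local Open Scope ring_scope.
Implicit Types j p : bool.

Lemma homog_submodule j : submodule (homog j : set fock).
Proof.
split=> [|k u v hu hv|v|a n v].
- exact: supported0.
- exact: supportedL.
- apply: (supported_lin (T := @parity_op C)) => x xj /=.
  by rewrite parity_opE; apply: supportedZ; apply: supported_bas.
- exact: homog_modeop.
Qed.

Lemma submodule_mode_closed (S : set fock) : submodule S -> mode_closed S.
Proof. by case=> S0 SL _ Sm; split. Qed.

Definition hw_vector j : fock := if j then osc (false, true) (Negz 0) (vac C) else vac C.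

Lemma hw_vector_neq0 j : hw_vector j != 0.
Proof.
have b0 (x : state) : bas C x != 0.
  apply/eqP => /(congr1 (fun v : freemod C state => v x)).
  by rewrite basE eqxx fm_zeroE => /eqP; rewrite oner_eq0.
by case: j; [rewrite /hw_vector (osc_binc C vst 1); exact: b0|exact: b0].
Qed.

Lemma hw_vector_homog j : homog j (hw_vector j).
Proof.
have vac0 : homog false (vac C) by apply: supported_bas; rewrite /num stat_vst.
by case: j => //; apply: (homog_osc (j := false)).
Qed.

Lemma parity_vac : parity_op (vac C) = vac C.
Proof. by rewrite parity_opE cardfs0 expr0 scale1r. Qed.

Lemma hw_vectorP j : highest_weight_vector (hR R 2 j) (sR R 2 j) (hw_vector j).
Proof.
have sv a (n : int) : 0 < n -> modeop a n (vac C) = 0.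
  by move=> n0; rewrite modeop_vac ?ltW // (gt_eqF n0) andbF scale0r.
split; first exact: hw_vector_neq0.
- case: j => /=; last exact: parity_vac.
  by rewrite parity_op_osc parity_vac expr0 scale1r.
- move=> a n n0; case: j => /=; last exact: sv.
  by rewrite modeop_osc sv // osc0 scaler0 add0r osc_vac ?scaler0 //; lia.
- case: j => /=; last by split; rewrite modeop_vac //= scale0r.
  by split; rewrite modeop_osc modeop_vac //= !scale0r osc0 scaler0 addr0.
case: j => /=; last first.
  rewrite !modeop_vac //= !scale0r /hR /sR; split; last by rewrite mulr0 mul0r scale0r.
  by congr (_ *: _); field.
rewrite !modeop_osc !modeop_vac //= !scale0r osc0 scaler0 add0r !add0r /sR /hR; split.
  rewrite oscZ scalerA -scalerDl; congr (_ *: _).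
  by rewrite /sgp expr0 /hat NegzE rmorphN /=; field.
by congr (_ *: _); field.
Qed.

Lemma irreducible_weight_dims j (V : ramond_module (cM R 2)) :
  irreducible_highest_weight V (hR R 2 j) (sR R 2 j) ->
  weight_dims V (fun p w => #|` fiber j p w|).
Proof.
move=> [[_ Virr] [v0 hv0 Vgen]] p w.
have Fgen (S : set fock) : submodule S -> S (hw_vector j) -> homog j `<=` S.
  move=> /submodule_mode_closed Scl Sw.
  apply: (mcl_homog Scl Sw (@hw_vector_neq0 j)); exact: hw_vector_homog.
have Firr (S : set fock) : submodule S -> S `<=` homog j ->
    S (hw_vector j) \/ S `<=` [set 0].
  move=> /submodule_mode_closed Scl SF.
  have [S0|nS0] := pselect (S `<=` [set 0]); first by right.
  left; have [v [Sv v0']] : exists v, S v /\ v != 0.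
    apply: contra_notP nS0 => /forallNP h v Sv; apply/eqP.
    by apply: contra_notT (h v) => vn; split.
  apply: (mcl_homog Scl Sv v0' (SF _ Sv)); exact: hw_vector_homog.
apply: (has_dim_transfer hv0 (hw_vectorP j) Vgen Virr (homog_submodule j)
  (@hw_vector_homog j) Firr Fgen (fock_has_dim j p w)).
Qed.

End FockHighestWeight.

(** * Unconditional sums and the triple product *)

Section ComplexLimits.
Variable R : realType.
Local Notation C := R[i].
Implicit Types (x y z l : C) (u v : nat -> C) (e r M : R).

(** The modulus as a real number: the norm of [R[i]] takes its values in [R[i]], where real
    estimates are awkward. *)
Definition nrm x : R := Normc.normc x.

Lemma nrm_ge0 x : 0 <= nrm x.
Proof. by case: x => a b; rewrite /nrm /= sqrtr_ge0. Qed.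
Lemma nrm0 : nrm 0 = 0. Proof. exact: Normc.normc0. Qed.
Lemma nrm1 : nrm 1 = 1. Proof. exact: Normc.normc1. Qed.
Lemma nrm_eq0 x : (nrm x == 0) = (x == 0).
Proof. by apply/eqP/eqP => [/Normc.eq0_normc|->] //; exact: nrm0. Qed.
Lemma nrm_gt0 x : (0 < nrm x) = (x != 0).
Proof. by rewrite lt_def nrm_eq0 nrm_ge0 andbT. Qed.
Lemma nrmM x y : nrm (x * y) = nrm x * nrm y. Proof. exact: Normc.normcM. Qed.
Lemma nrmV x : nrm x^-1 = (nrm x)^-1. Proof. exact: Normc.normcV. Qed.
Lemma nrmN x : nrm (- x) = nrm x. Proof. exact: normcN. Qed.
Lemma nrmD x y : nrm (x + y) <= nrm x + nrm y. Proof. exact: le_normcD. Qed.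
Lemma nrmB x y : nrm (x - y) <= nrm x + nrm y.
Proof. by rewrite -[nrm y]nrmN; exact: nrmD. Qed.
Lemma nrmC x y : nrm (x - y) = nrm (y - x).
Proof. by rewrite -nrmN opprB. Qed.
Lemma nrm_dist x y z : nrm (x - z) <= nrm (x - y) + nrm (y - z).
Proof. by have := nrmD (x - y) (y - z); rewrite addrA subrK. Qed.
Lemma nrmX x n : nrm (x ^+ n) = nrm x ^+ n.
Proof. by elim: n => [|n IH]; rewrite ?expr0 ?nrm1 // !exprS nrmM IH. Qed.
Lemma nrmXz x (n : int) : nrm (x ^ n) = nrm x ^ n.
Proof. by case: n => n; rewrite ?NegzE -?exprnN /= ?nrmV ?nrmX // -exprnP nrmX. Qed.
Lemma nrm_prod (I : Type) (s : seq I) (F : I -> C) :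
  nrm (\prod_(i <- s) F i) = \prod_(i <- s) nrm (F i).
Proof. by elim/big_rec2: _ => [|i a b _ <-]; rewrite ?nrm1 // nrmM. Qed.
Lemma nrm_sum (I : Type) (s : seq I) (F : I -> C) :
  nrm (\sum_(i <- s) F i) <= \sum_(i <- s) nrm (F i).
Proof.
elim/big_rec2: _ => [|i a b _ ab]; first by rewrite nrm0.
by apply: le_trans (nrmD _ _) _; rewrite lerD2l.
Qed.
Lemma nrm_norm x : `|x| = (nrm x)%:C%C.
Proof. by case: x => a b; rewrite normc_def. Qed.
Lemma nrm_real r : 0 <= r -> nrm (r%:C%C) = r.
Proof. by move=> r0; rewrite /nrm /= expr0n /= addr0 sqrtr_sqr ger0_norm. Qed.
Lemma nrm_Re x : `|complex.Re x| <= nrm x.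
Proof.
by have := normc_ge_Re x; rewrite nrm_norm lecR.
Qed.
Lemma nrm_le x : nrm x <= `|complex.Re x| + `|complex.Im x|.
Proof.
case: x => a b /=; rewrite /nrm /= -[leRHS]ger0_norm ?addr_ge0 // -sqrtr_sqr ler_wsqrtr //.
rewrite sqrrD !real_normK ?num_real //.
by rewrite lerD2r lerDl mulrn_wge0 // mulr_ge0.
Qed.
Lemma nrm_Im x : `|complex.Im x| <= nrm x.
Proof.
have -> : nrm x = nrm ((0 +i* 1)%C * x) by rewrite nrmM /nrm /= expr0n expr1n add0r sqrtr1 mul1r.
by apply: le_trans (nrm_Re _); case: x => a b /=; rewrite mul0r sub0r mul1r normrN.
Qed.

Definition lims u l := forall e, 0 < e -> exists N : nat, forall n, (N <= n)%N -> nrm (u n - l) < e.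

Lemma lims_cvg u l : lims u l <-> ((u : nat -> C^o) @ \oo --> (l : C^o))%classic.
Proof.
split=> [h|/cvgrPdist_lt h].
  apply/cvgrPdist_lt => -[e e'] /=; rewrite ltcE /= => /andP[/eqP e0 epos].
  have [N hN] := h e epos; near=> n.
  have : nrm (u n - l) < e by apply: hN; near: n; exact: nbhs_infty_ge.
  by rewrite nrmC nrm_norm e0 => h'; rewrite -[(e +i* 0)%C]/(e%:C%C) ltcR.
move=> e e0; have e0' : 0 < e%:C%C :> C by rewrite ltcR.
have [N _ hN] := h _ e0'; exists N => n /hN /=.
by rewrite nrm_norm ltcR nrmC.
Unshelve. all: by end_near. Qed.

Lemma lims_unique u l l' : lims u l -> lims u l' -> l = l'.
Proof.
move=> /lims_cvg h /lims_cvg h'.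
exact: (cvg_unique (@norm_hausdorff _ _) h h').
Qed.

Lemma limsM u v l l' : lims u l -> lims v l' -> lims (fun n => u n * v n) (l * l').
Proof. by move=> /lims_cvg h /lims_cvg h'; apply/lims_cvg; exact: cvgM h h'. Qed.
Lemma limsV u l : l != 0 -> lims u l -> lims (fun n => (u n)^-1) l^-1.
Proof. by move=> l0 /lims_cvg h; apply/lims_cvg; exact: cvgV l0 h. Qed.
Lemma lims_cst l : lims (fun=> l) l.
Proof. by move=> e e0; exists 0%N => n _; rewrite subrr nrm0. Qed.
Lemma eq_lims u v l : u =1 v -> lims u l -> lims v l.
Proof. by move=> /funext->. Qed.
Lemma lims_sub u l (f : nat -> nat) : (forall n, (n <= f n)%N) -> lims u l -> lims (fun n => u (f n)) l.
Proof. by move=> fn h e /h[N hN]; exists N => n Nn; apply: hN; exact: leq_trans Nn (fn n). Qed.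

Lemma lims_bounded u l : lims u l -> exists2 M, 0 < M & forall n, nrm (u n) <= M.
Proof.
move=> h; have [N hN] := h 1 ltr01.
exists (\sum_(i < N) nrm (u i) + (nrm l + 1)).
  by rewrite ltr_wpDl ?sumr_ge0 ?ltr_wpDl // => [i _|]; exact: nrm_ge0.
move=> n; have [/hN nN|nN] := leqP N n.
  apply: le_trans (_ : nrm l + 1 <= _); last by rewrite lerDr sumr_ge0 // => i _; exact: nrm_ge0.
  by rewrite -[u n](subrK l) addrC (le_trans (nrmD _ _)) // lerD2l ltW.
rewrite (bigD1 (Ordinal nN)) //= -addrA lerDl addr_ge0 ?sumr_ge0 ?addr_ge0 ?nrm_ge0 // => i _.
exact: nrm_ge0.
Qed.

Lemma geometric_lt e r : 0 <= r < 1 -> forall M, 0 < e -> exists N : nat, forall n, (N <= n)%N -> M * r ^+ n < e.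
Proof.
move=> /andP[r0 r1] M e0.
have := @cvg_geometric R M r; rewrite ger0_norm // => /(_ r1)/cvgrPdist_lt/(_ e e0)[N _ hN].
by exists N => n /hN /=; rewrite sub0r normrN => /(le_lt_trans (ler_norm _)).
Qed.

Lemma sum_geometric_le r n : 0 <= r < 1 -> \sum_(i < n) r ^+ i <= (1 - r)^-1.
Proof.
move=> /andP[r0 r1]; have r1' : 0 < 1 - r by rewrite subr_gt0.
rewrite -[leRHS]mul1r ler_pdivlMr // mulrC -opprB mulNr -subrX1 opprB.
by rewrite gerBl exprn_ge0.
Qed.

(** The increments of the real and imaginary parts are dominated by a geometric series. The rate is
    kept because the limit form of the triple product depends on it. *)
Lemma lims_complete u M r : 0 <= r < 1 -> (forall n, nrm (u n.+1 - u n) <= M * r ^+ n) ->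
  exists2 l, lims u l & forall n, nrm (u n - l) <= M / (1 - r) * r ^+ n.
Proof.
move=> r01 du; have /andP[r0 r1] := r01.
have M0 : 0 <= M by have := le_trans (nrm_ge0 _) (du 0%N); rewrite expr0 mulr1.
have part (f : C -> R) : (forall x y, f (x - y) = f x - f y) -> (forall x, `|f x| <= nrm x) ->
    exists a : R, forall e, 0 < e -> exists N : nat, forall n, (N <= n)%N -> `|f (u n) - a| < e.
  move=> fB fn; pose d n := f (u n.+1) - f (u n).
  have dcvg : cvgn (series d).
    apply: normed_cvg; apply: (series_le_cvg (v_ := geometric M r)).
    - by move=> n; exact: normr_ge0.
    - by move=> n; rewrite mulr_ge0 ?exprn_ge0.
    - by move=> n; rewrite /= /d -fB; exact: le_trans (fn _) (du n).
    - by apply: is_cvg_geometric_series; rewrite ger0_norm.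
  exists (f (u 0%N) + limn (series d)) => e e0.
  have /cvgrPdist_lt/(_ e e0)[N _ hN] := dcvg; exists N => n /hN /=.
  rewrite /series /= telescope_sumr // distrC; congr (`|_| < _).
  by rewrite [in RHS]opprD addrA.
have [a ha] := part (@complex.Re R) (fun x y => raddfB _ x y) nrm_Re.
have [b hb] := part (@complex.Im R) (fun x y => raddfB _ x y) nrm_Im.
have ul : lims u (a +i* b)%C.
  move=> e e0; have e2 : 0 < e / 2 by rewrite divr_gt0.
  have [N hN] := ha _ e2; have [N' hN'] := hb _ e2; exists (maxn N N') => n.
  rewrite geq_max => /andP[/hN na /hN' nb]; apply: le_lt_trans (nrm_le _) _.
  by rewrite [e]splitr; apply: ltrD; rewrite raddfB.
exists (a +i* b)%C => // n.
have diff m : nrm (u (n + m)%N - u n) <= M / (1 - r) * r ^+ n.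
  apply: (le_trans (y := \sum_(i < m) M * r ^+ (n + i))).
    elim: m => [|m IH]; first by rewrite addn0 subrr nrm0 big_ord0.
    rewrite big_ord_recr /= addnS addrC; apply: le_trans (nrm_dist _ (u (n + m)%N) _) _.
    exact: lerD.
  under eq_bigr do rewrite exprD mulrA; rewrite -mulr_sumr -mulrA mulrAC mulrA.
  rewrite ler_wpM2l ?mulr_ge0 ?exprn_ge0 //; exact: sum_geometric_le.
apply/ler_addgt0Pr => e e0; have [N hN] := ul e e0.
rewrite nrmC; apply: le_trans (nrm_dist _ (u (n + N)%N) _) _; rewrite addrC; apply: lerD => //.
by rewrite nrmC ltW // hN // leq_addl.
Qed.

Lemma prod_lims (a : nat -> C) c r : 0 <= r < 1 -> (forall k, nrm (a k) <= c * r ^+ k) ->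
  exists l M, [/\ 0 <= M, lims (fun n => \prod_(k < n) (1 + a k)) l
    & forall n, nrm (\prod_(k < n) (1 + a k) - l) <= M * r ^+ n].
Proof.
move=> r01 ac; have /andP[r0 r1] := r01.
have c0 : 0 <= c by have := le_trans (nrm_ge0 _) (ac 0%N); rewrite expr0 mulr1.
pose B := expR (c / (1 - r)).
have bound n : nrm (\prod_(k < n) (1 + a k)) <= B.
  rewrite nrm_prod; apply: (le_trans (y := \prod_(k < n) expR (c * r ^+ k))).
    apply: ler_prod => k _; rewrite nrm_ge0 /=.
    apply: le_trans (nrmD _ _) _; rewrite nrm1; apply: le_trans (expR_ge1Dx _).
    by rewrite lerD2l.
  rewrite -expR_sum ler_expR -mulr_sumr ler_wpM2l //; exact: sum_geometric_le.
have [|l ul rate] := @lims_complete (fun n => \prod_(k < n) (1 + a k)) (B * c) r r01.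
  move=> n; rewrite big_ord_recr /= -[X in _ - X]mulr1 -mulrBr [1 + _]addrC addrK nrmM -mulrA.
  by apply: ler_pM; rewrite ?nrm_ge0 // bound.
exists l, (B * c / (1 - r)); split=> //.
by rewrite divr_ge0 ?mulr_ge0 ?expR_ge0 // subr_ge0 ltW.
Qed.

(** Beyond the place K where |a k| <= 1/2, the product of the reciprocals 1 + b k converges too. The
    two limits multiply to the product of the first K factors, which is not zero. *)
Lemma prod_lims_neq0 (a : nat -> C) c r l : 0 <= r < 1 -> (forall k, nrm (a k) <= c * r ^+ k) ->
  (forall k, 1 + a k != 0) -> lims (fun n => \prod_(k < n) (1 + a k)) l -> l != 0.
Proof.
move=> r01 ac an0 al; have /andP[r0 r1] := r01.
have c0 : 0 <= c by have := le_trans (nrm_ge0 _) (ac 0%N); rewrite expr0 mulr1.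
have h2 : 0 < 2^-1 :> R by rewrite invr_gt0.
have [K hK] := geometric_lt r01 c h2.
have half k : nrm (a (K + k)%N) <= 2^-1.
  by apply: le_trans (ac _) (ltW (hK _ _)); rewrite leq_addr.
pose b k := - a (K + k)%N / (1 + a (K + k)%N).
have bE k : 1 + b k = (1 + a (K + k)%N)^-1.
  by rewrite /b; have := an0 (K + k)%N => h; field.
have [|m [M [_ bm _]]] := @prod_lims b (2 * c) r r01.
  move=> k; rewrite /b nrmM nrmN nrmV -ler_pdivlMr ?invr_gt0 ?nrm_gt0 // invrK.
  have h1 : 2^-1 <= nrm (1 + a (K + k)%N).
    have := nrmB (1 + a (K + k)%N) (a (K + k)%N); rewrite addrK nrm1; have := half k.
    by lra.
  apply: (le_trans (y := c * r ^+ k)).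
    apply: le_trans (ac _) _; rewrite ler_wpM2l // exprD ler_piMl ?exprn_ge0 //.
    by rewrite exprn_ile1 // ltW.
  have : 0 <= c * r ^+ k by rewrite mulr_ge0 ?exprn_ge0.
  move=> d0; have := ler_wpM2l d0 h1; move: (nrm (1 + _)) => N.
  have -> : 2 * c * r ^+ k * N = 2 * (c * r ^+ k * N) by ring.
  by move: (c * r ^+ k) (c * r ^+ k * N) => d dN; lra.
have [al'|] := eqVneq l 0; last by [].
have /limsM/(_ bm) := lims_sub (fun n => leq_addl K n) al.
have E n : \prod_(k < K + n) (1 + a k) * \prod_(k < n) (1 + b k) = \prod_(k < K) (1 + a k).
  rewrite big_split_ord /= -mulrA -big_split /= [X in _ * X]big1 ?mulr1 // => i _.
  by rewrite bE mulfV.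
move/(eq_lims E)/lims_unique/(_ (lims_cst _)); rewrite al' mul0r => /esym/eqP.
by rewrite prodf_seq_eq0 => /hasP[i _ /=]; rewrite (negPf (an0 _)).
Qed.

End ComplexLimits.

(** * Unconditional sums: exhaustion, regrouping, products *)

Section UnconditionalSums.
Variable R : realType.
Local Notation C := R[i].
Implicit Types (S T c : C) (e M : R).

Definition usum (I : choiceType) (x : I -> C) S := forall e, 0 < e ->
  exists A : {fset I}, forall B : {fset I}, (A `<=` B)%fset -> nrm (\sum_(i <- B) x i - S) < e.

Definition abs_bounded (I : choiceType) (x : I -> C) :=
  exists M, forall A : {fset I}, \sum_(i <- A) nrm (x i) <= M.

Section OneFamily.
Variable I : choiceType.
Implicit Types (x y : I -> C) (A B : {fset I}).

Lemma usum_sums_to x S : usum x S -> sums_to x S.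
Proof.
move=> h; have fT := @totally_filter I; apply/cvgrPdist_lt => -[e e'] /=; rewrite ltcE /= => /andP[/eqP e0 epos].
have [A hA] := h e epos; exists A => // B /hA.
rewrite nrmC e0 => h'; rewrite -[(e +i* 0)%C]/(e%:C%C) nrm_norm ltcR /partial_sum.
by rewrite big_seq_fsetE in h'.
Qed.

Lemma usum_sum x S : usum x S -> summability.sum (x : I -> C^o) = S.
Proof.
move=> /usum_sums_to h; have fT := @totally_filter I.
exact: (cvg_lim (@norm_hausdorff _ _) h).
Qed.

Lemma usum_unique x S T : usum x S -> usum x T -> S = T.
Proof. by move=> /usum_sum<- /usum_sum<-. Qed.

Lemma eq_usum x y S : x =1 y -> usum x S -> usum y S.
Proof. by move=> /funext->. Qed.

Lemma usumD x y S T : usum x S -> usum y T -> usum (fun i => x i + y i) (S + T).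
Proof.
move=> hx hy e e0; have e2 : 0 < e / 2 by rewrite divr_gt0.
have [A hA] := hx _ e2; have [B hB] := hy _ e2; exists (A `|` B)%fset => D.
rewrite fsubUset => /andP[/hA hDA /hB hDB].
rewrite big_split opprD addrACA [e]splitr; apply: le_lt_trans (nrmD _ _) _.
exact: ltrD.
Qed.

Lemma usumZ c x S : usum x S -> usum (fun i => c * x i) (c * S).
Proof.
move=> hx e e0; have c1 : 0 < nrm c + 1 by rewrite ltr_wpDl ?nrm_ge0.
have [|A hA] := hx (e / (nrm c + 1)); first by rewrite divr_gt0.
exists A => B /hA; rewrite ltr_pdivlMr // -mulr_sumr -mulrBr nrmM => h.
apply: le_lt_trans h; rewrite mulrC ler_wpM2l ?nrm_ge0 //.
by rewrite lerDl.
Qed.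

Lemma usum_finite x A : (forall i, i \notin A -> x i = 0) -> usum x (\sum_(i <- A) x i).
Proof.
move=> hA e e0; exists A => B AB.
by rewrite -(big_fset_incl _ AB) ?subrr ?nrm0 // => i _ /hA.
Qed.

Lemma sum_seq_fset (M : nmodType) (F : I -> M) (s : seq I) : uniq s ->
  \sum_(i <- [fset i in s]%fset) F i = \sum_(i <- s) F i.
Proof.
move=> us; apply: perm_big; apply: uniq_perm => // i; by rewrite !inE.
Qed.

Lemma sum_fsetID (M : nmodType) (F : I -> M) A (s : seq I) : uniq s -> {subset A <= s} ->
  \sum_(i <- s) F i = \sum_(i <- A) F i + \sum_(i <- s | i \notin A) F i.
Proof.
move=> us As; rewrite (bigID (mem A)) /=; congr (_ + _).
rewrite -big_filter; apply: perm_big; apply: uniq_perm => [||i].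
- exact: filter_uniq.
- exact: fset_uniq.
by rewrite mem_filter; case: (boolP (i \in A)) => //= /As ->.
Qed.

(** A finite set that nearly attains the supremum of the sums of norms leaves little outside it.
    Hence the limit can be found along any convenient family of lists that contain arbitrary finite
    sets. *)
Lemma usum_exhaust x S : abs_bounded x ->
  (forall A e, 0 < e -> exists s, [/\ uniq s, {subset A <= s} & nrm (\sum_(i <- s) x i - S) < e]) ->
  usum x S.
Proof.
move=> [M xM] hS e e0; pose E : set R := range (fun A => \sum_(i <- A) nrm (x i)).
have supE : has_sup E.
  split; first by exists (\sum_(i <- fset0) nrm (x i)); exists fset0.
  by exists M => _ [A _ <-].
have e2 : 0 < e / 2 by rewrite divr_gt0.
have [_ [A _ <-] hA] := sup_adherent e2 supE; exists A => B AB.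
have [s [us Bs sS]] := hS B _ e2.
have small : nrm (\sum_(i <- s | i \notin B) x i) < e / 2.
  rewrite -big_filter; apply: le_lt_trans (nrm_sum _ _) _; rewrite big_filter.
  have : \sum_(i <- s) nrm (x i) <= sup E.
    rewrite -sum_seq_fset //; apply: ub_le_sup; first by case: supE.
    by exists [fset i in s]%fset.
  rewrite (sum_fsetID _ us Bs) (sum_fsetID (A := A) _ (fset_uniq B)); last exact/fsubsetP.
  have : 0 <= \sum_(i <- B | i \notin A) nrm (x i) by apply: sumr_ge0 => i _; exact: nrm_ge0.
  by move: hA; lra.
rewrite [e]splitr; apply: le_lt_trans (nrm_dist _ (\sum_(i <- s) x i) _) _; apply: ltrD => //.
by rewrite nrmC (sum_fsetID _ us Bs) addrAC subrr add0r.
Qed.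

End OneFamily.

Lemma usum_fibers (I J : choiceType) (pi : I -> J) (F : J -> {fset I}) (x : I -> C) S :
    (forall i j, i \in F j -> pi i = j) -> (forall i, x i != 0 -> i \in F (pi i)) ->
  usum x S -> usum (fun j => \sum_(i <- F j) x i) S.
Proof.
move=> Fpi xF xS e /xS[A hA]; exists [fset pi i | i in A]%fset => B AB.
pose D := (A `|` \bigcup_(j <- B) F j)%fset.
suff -> : \sum_(j <- B) \sum_(i <- F j) x i = \sum_(i <- D) x i by apply: hA; exact: fsubsetUl.
have FD j : j \in B -> \sum_(i <- F j) x i = \sum_(i <- D) (if i \in F j then x i else 0).
  move=> jB; have FjD : (F j `<=` D)%fset.
    by apply: fsubset_trans (fsubsetUr _ _); exact: bigfcup_sup.
  rewrite -(big_fset_incl _ FjD) => [|i _ /negPf->//].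
  by rewrite big_seq [RHS]big_seq; apply: eq_bigr => i ->.
rewrite big_seq (eq_bigr _ FD) -big_seq exchange_big /= big_seq [RHS]big_seq.
apply: eq_bigr => i iD; have [xi|xi] := eqVneq (x i) 0.
  by rewrite big1 // => j _; rewrite xi if_same.
have piB : pi i \in B.
  have := iD; rewrite in_fsetU => /orP[iA|/bigfcupP[j /andP[jB _] /Fpi->//]].
  by apply: (fsubsetP AB); apply/imfsetP; exists i.
rewrite (big_fsetD1 _ piB) /= xF // big1_fset ?addr0 // => j.
by rewrite in_fsetD1 => /andP[jp _] _; case: ifP => // /Fpi jE; rewrite jE eqxx in jp.
Qed.

Section Products.
Variables I J : choiceType.

Lemma sum_fst_snd (x : I -> R) (y : J -> R) (A : {fset I * J}) :
    (forall i, 0 <= x i) -> (forall j, 0 <= y j) ->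
  \sum_(p <- A) x p.1 * y p.2 <=
  (\sum_(i <- [fset p.1 | p in A]%fset) x i) * (\sum_(j <- [fset p.2 | p in A]%fset) y j).
Proof.
move=> x0 y0; set B1 := [fset _ | p in A]%fset; set B2 := [fset _ | p in A]%fset.
rewrite big_distrlr /=.
rewrite -(big_allpairs (r1 := B1) (r2 := B2) (F := fun p => x p.1 * y p.2)) /=.
have us : uniq [seq (a, b) | a <- B1, b <- B2].
  by apply: allpairs_uniq => // -[a b] [c d] _ _ [-> ->].
rewrite (sum_fsetID (A := A) _ us) => [|p pA].
  by rewrite lerDl sumr_ge0 // => p _; rewrite mulr_ge0.
apply/allpairsP; exists p; split; last exact: surjective_pairing.
  by apply/imfsetP; exists p.
by apply/imfsetP; exists p.
Qed.

Lemma abs_boundedM (x : I -> C) (y : J -> C) : abs_bounded x -> abs_bounded y ->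
  abs_bounded (fun p => x p.1 * y p.2).
Proof.
move=> [M xM] [N yN]; exists (M * N) => A; under eq_bigr do rewrite nrmM.
apply: le_trans (sum_fst_snd A (fun i => nrm_ge0 (x i)) (fun i => nrm_ge0 (y i))) _.
by apply: ler_pM => //; apply: sumr_ge0 => i _; exact: nrm_ge0.
Qed.

Lemma usumM (x : I -> C) (y : J -> C) S T : abs_bounded x -> abs_bounded y ->
  usum x S -> usum y T -> usum (fun p => x p.1 * y p.2) (S * T).
Proof.
move=> bx b_y xS yT; apply: usum_exhaust; first exact: abs_boundedM.
move=> A e e0; pose k := nrm S + nrm T + 1.
have k0 : 0 < k by rewrite /k ltr_wpDl // addr_ge0 ?nrm_ge0.
(* As d <= 1, the error of the product is below d^2 + d |T| + |S| d <= d k <= e. *)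
pose d := Num.min 1 (e / k); have d0 : 0 < d by rewrite lt_min ltr01 divr_gt0.
have [B1 hB1] := xS d d0; have [B2 hB2] := yT d d0.
pose A1 := (B1 `|` [fset p.1 | p in A])%fset; pose A2 := (B2 `|` [fset p.2 | p in A])%fset.
exists [seq (a, b) | a <- enum_fset A1, b <- enum_fset A2]; split.
- by apply: allpairs_uniq => // -[a b] [c f] _ _ [-> ->].
- move=> p pA; apply/allpairsP; exists p; split; last exact: surjective_pairing.
    by rewrite in_fsetU; apply/orP; right; apply/imfsetP; exists p.
  by rewrite in_fsetU; apply/orP; right; apply/imfsetP; exists p.
rewrite big_allpairs /= -big_distrlr /=.
have := hB1 A1 (fsubsetUl _ _); have := hB2 A2 (fsubsetUl _ _).
move: (\sum_(i <- A1) x i) (\sum_(i <- A2) y i) => a b hb ha.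
have -> : a * b - S * T = (a - S) * (b - T) + (a - S) * T + S * (b - T) by ring.
apply: le_lt_trans (nrmD _ _) _; apply: (le_lt_trans (lerD (nrmD _ _) (lexx _))).
rewrite !nrmM; have d1 : d <= 1 by rewrite ge_min lexx.
have dk : d * k <= e by rewrite -ler_pdivlMr // ge_min lexx orbT.
apply: lt_le_trans dk; rewrite /k.
have := nrm_ge0 S; have := nrm_ge0 T; have := nrm_ge0 (a - S); have := nrm_ge0 (b - T).
move: (nrm S) (nrm T) (nrm (a - S)) (nrm (b - T)) ha hb => s t u v; nra.
Qed.

End Products.
End UnconditionalSums.

(** * Sums over states as infinite products *)

Section StateSums.

Definition multiplicative_weight (A : comNzRingType) (a b : nat -> A) (W : state -> A) :=
  [/\ W vst = 1, forall x i, W (inc x.1 i, x.2) = a i * W x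
    & forall x i, i \notin x.2 -> W (x.1, (i |` x.2)%fset) = b i * W x].

Lemma sum_box (A : comNzRingType) (a b : nat -> A) (W : state -> A) m N :
  multiplicative_weight a b W ->
  \sum_(x <- box m N) W x = \prod_(i < m) ((\sum_(k < N.+1) a i ^+ k) * (1 + b i)).
Proof.
move=> [W0 Wa Wb]; elim: m => [|m IH]; first by rewrite big_ord0 big_seq1.
have step x kb : x \in box m N ->
    W (box_step m x kb) = (if kb.2 then b m else 1) * a m ^+ kb.1 * W x.
  move=> /box_supp/(_ (leqnn m))[_ mx]; rewrite /box_step.
  have -> : W (iter kb.1 (fun n => inc n m) x.1, if kb.2 then (m |` x.2)%fset else x.2) =
      (if kb.2 then b m else 1) * W (iter kb.1 (fun n => inc n m) x.1, x.2).
    case: kb.2; last by rewrite mul1r.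
    by rewrite -(Wb (iter kb.1 (fun n => inc n m) x.1, x.2)).
  rewrite -mulrA; congr (_ * _); elim: kb.1 => [|k IHk].
    by rewrite expr0 mul1r -surjective_pairing.
  by rewrite (Wa (iter k (fun n => inc n m) x.1, x.2)) IHk exprS mulrA.
rewrite boxS big_allpairs_dep big_seq.
under eq_bigr => x xB do under eq_bigr => kb _ do rewrite step //.
rewrite -big_seq; under eq_bigr do rewrite -mulr_suml.
rewrite -mulr_sumr IH [RHS]big_ord_recr [RHS]mulrC; congr (_ * _).
rewrite big_allpairs_dep -[iota 0 N.+1]/(index_iota 0 N.+1) big_mkord mulr_suml; apply: eq_bigr => k _.
by rewrite big_cons big_seq1 /= mul1r mulrDr mulr1 [b m * _]mulrC.
Qed.

Section Convergence.
Variable R : realType.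
Local Notation C := R[i].
Variables (a b : nat -> C) (W : state -> C) (c r rho : R).
Hypothesis hW : multiplicative_weight a b W.
Hypothesis r01 : 0 <= r < 1.
Hypothesis rho1 : rho < 1.
Hypothesis ar : forall i, nrm (a i) <= c * r ^+ i.
Hypothesis br : forall i, nrm (b i) <= c * r ^+ i.
Hypothesis arho : forall i, nrm (a i) <= rho.

Lemma nrm_multiplicative :
  multiplicative_weight (fun i => nrm (a i)) (fun i => nrm (b i)) (fun x => nrm (W x)).
Proof.
case: hW => W0 Wa Wb; split=> [|x i|x i ix]; first by rewrite W0 nrm1.
- by rewrite Wa nrmM.
- by rewrite Wb // nrmM.
Qed.

Lemma seq_in_box (A : {fset state}) : exists m0, forall m N, (m0 <= m)%N -> (m0 <= N)%N ->
  {subset A <= box m N}.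
Proof.
exists (\max_(x <- A) deg x).+1 => m N m0m m0N x xA.
have xm : (deg x <= \max_(x <- A) deg x)%N by rewrite (big_fsetD1 x) //= leq_maxl.
by apply: deg_box; [exact: leq_ltn_trans xm m0m|apply: leq_trans xm _; exact: ltnW].
Qed.

Lemma weight_abs_bounded : abs_bounded W.
Proof.
have /andP[r0 r1] := r01; have c0 : 0 <= c by have := le_trans (nrm_ge0 _) (ar 0%N); rewrite expr0 mulr1.
have rho' : 0 < 1 - rho by rewrite subr_gt0.
(* Each factor (1 - |a i|)^-1 (1 + |b i|) is at most exp (d r^i), since (1 - x)^-1 <= 1 + x / (1 -
   rho) for 0 <= x <= rho. *)
pose d := c / (1 - rho) + c.
exists (expR (d / (1 - r))) => A.
have [m0 hm0] := seq_in_box A; have sA := hm0 m0 m0 (leqnn _) (leqnn _).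
rewrite -[leLHS]addr0; apply: (le_trans (y := \sum_(x <- box m0 m0) nrm (W x))).
  rewrite (sum_fsetID _ (box_uniq _ _) sA) lerD2l; apply: sumr_ge0 => x _; exact: nrm_ge0.
rewrite (sum_box _ _ nrm_multiplicative).
apply: (le_trans (y := \prod_(i < m0) expR (d * r ^+ i))); last first.
  rewrite -expR_sum ler_expR -mulr_sumr ler_wpM2l ?sum_geometric_le //.
  by rewrite /d addr_ge0 ?divr_ge0 // ltW.
apply: ler_prod => i _; have a0 := nrm_ge0 (a i); have b0 := nrm_ge0 (b i).
rewrite mulr_ge0 ?addr_ge0 ?sumr_ge0 //=; last by move=> k _; rewrite exprn_ge0.
rewrite /d mulrDl expRD; apply: ler_pM; rewrite ?addr_ge0 ?sumr_ge0 //.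
- by move=> k _; rewrite exprn_ge0.
- apply: le_trans (expR_ge1Dx _); apply: le_trans (sum_geometric_le _ _) _.
    by rewrite a0 (le_lt_trans (arho i)).
  have a1 : 0 < 1 - nrm (a i) by rewrite subr_gt0 (le_lt_trans (arho i)).
  rewrite -[leLHS]mul1r ler_pdivrMr // mulrDl mul1r.
  have : nrm (a i) <= c / (1 - rho) * r ^+ i * (1 - nrm (a i)).
    have -> : c / (1 - rho) * r ^+ i * (1 - nrm (a i)) =
        c * r ^+ i * ((1 - nrm (a i)) / (1 - rho)) by ring.
    apply: le_trans (ar i) _; rewrite ler_peMr ?mulr_ge0 ?exprn_ge0 //.
    by rewrite ler_pdivlMr // mul1r lerD2l lerN2.
  by lra.
- by apply: le_trans (expR_ge1Dx _); rewrite lerD2l.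
Qed.

Lemma geometric_lims (z : C) : nrm z < 1 -> lims (fun N => \sum_(k < N.+1) z ^+ k) (1 - z)^-1.
Proof.
move=> z1; have z01 : 0 <= nrm z < 1 by rewrite nrm_ge0.
have z0 : 1 - z != 0 by rewrite subr_eq0; apply: contraTneq z1 => <-; rewrite nrm1 ltxx.
move=> e e0; have [N hN] := geometric_lt z01 (nrm (1 - z)^-1) e0; exists N => n Nn.
have -> : \sum_(k < n.+1) z ^+ k - (1 - z)^-1 = - ((1 - z)^-1 * z ^+ n.+1).
  have E : (1 - z) * \sum_(k < n.+1) z ^+ k = 1 - z ^+ n.+1.
    by rewrite -[1 - z]opprB mulNr -subrX1 opprB.
  apply: (mulfI z0); rewrite mulrBr E mulrN mulrA mulfV // mul1r.
  by rewrite addrAC subrr add0r.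
by rewrite nrmN nrmM nrmX; apply: hN; exact: leqW.
Qed.

(** The range is doubled because the codes 2k and 2k + 1 share an energy; together they match one
    factor of a Jacobi product. *)
Lemma weight_usum P :
  lims (fun m => \prod_(i < m.*2) ((1 - a i)^-1 * (1 + b i))) P -> usum W P.
Proof.
move=> hP; apply: usum_exhaust; first exact: weight_abs_bounded.
move=> A e e0; have e2 : 0 < e / 2 by rewrite divr_gt0.
have [m0 hm0] := seq_in_box A; have [m1 hm1] := hP _ e2.
pose m := (maxn m0 m1).*2.
have mm : (m0 <= m)%N by rewrite /m -addnn (leq_trans (leq_maxl _ m1)) // leq_addr.
have : lims (fun N => \sum_(x <- box m N) W x) (\prod_(i < m) ((1 - a i)^-1 * (1 + b i))).
  apply: (eq_lims (u := fun N => \prod_(i < m) ((\sum_(k < N.+1) a i ^+ k) * (1 + b i)))).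
    by move=> N; rewrite (sum_box _ _ hW).
  elim: m {mm} => [|m IH]; first by rewrite big_ord0; apply: eq_lims (lims_cst 1) => N; rewrite big_ord0.
  rewrite big_ord_recr /=; apply: eq_lims (limsM IH (limsM (geometric_lims _) (lims_cst (1 + b m)))).
    by move=> N; rewrite [RHS]big_ord_recr.
  exact: le_lt_trans (arho m) rho1.
move=> /(_ _ e2)[N hN]; exists (box m (maxn N m0)); split.
- exact: box_uniq.
- by apply: hm0 => //; exact: leq_maxr.
rewrite [e]splitr; apply: le_lt_trans (nrm_dist _ (\prod_(i < m) ((1 - a i)^-1 * (1 + b i))) _) _.
by apply: ltrD; [apply: hN; exact: leq_maxl|apply: hm1; exact: leq_maxr].
Qed.

End Convergence.
End StateSums.

(** * The finite form of the triple product identity *)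

Section TripleProduct.
Variable R : realType.
Local Notation C := R[i].
Variable p : C.
Hypothesis p0 : p != 0.
Hypothesis p1 : nrm p < 1.
Implicit Types (w : C) (n m : int) (N k : nat).
Let Q := p ^+ 2.

Definition euler_fac N : C := \prod_(k < N) (1 - Q ^+ k.+1).

Lemma nrmQ_lt1 : 0 <= nrm Q < 1.
Proof. by rewrite nrm_ge0 /Q nrmX exprn_ilt1 // nrm_ge0. Qed.

Lemma euler_factor_neq0 k : 1 - Q ^+ k.+1 != 0.
Proof.
have /andP[q0 q1] := nrmQ_lt1.
rewrite subr_eq0; apply/eqP => /(congr1 (@nrm R)); rewrite nrm1 nrmX => /esym/eqP.
by rewrite lt_eqF // exprn_ilt1.
Qed.

Lemma euler_fac_neq0 N : euler_fac N != 0.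
Proof. by apply/prodf_neq0 => k _; exact: euler_factor_neq0. Qed.

Lemma euler_facS N : euler_fac N.+1 = euler_fac N * (1 - Q ^+ N.+1).
Proof. exact: big_ord_recr. Qed.

(** The reciprocal of a q-factorial, extended by 0 to negative integers so that [inv_facB1] holds at
    every integer without boundary cases. *)
Definition inv_fac m : C := if m is Posz N then (euler_fac N)^-1 else 0.

Lemma inv_facB1 m : inv_fac (m - 1) = (1 - Q ^ m) * inv_fac m.
Proof.
case: m => [[|N]|N].
- by rewrite expr0z subrr mul0r.
- rewrite (_ : N.+1%:Z - 1 = N); last by lia.
  rewrite /inv_fac euler_facS -exprnP.
  have h1 := euler_fac_neq0 N; have h2 := euler_factor_neq0 N; by rewrite invfM mulrCA mulfV ?mulr1.
- have -> : Negz N - 1 = Negz N.+1 by lia.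
  by rewrite /= mulr0.
Qed.

(** This is p^(n^2) times the Gaussian binomial coefficient of 2N over N + n in the base p^2. *)
Definition jtp_coef N n : C := p ^ (n * n) * (euler_fac N.*2 * inv_fac (N%:Z + n) * inv_fac (N%:Z - n)).

(** The next factor of the product is 1 + P^2 + P (w + w^-1) with P = p^(2N + 1). In a = p^(N + n)
    and b = p^(N - n) the recursion becomes an identity of rational functions. *)
Lemma jtp_coef_rec N n : jtp_coef N.+1 n = (1 + p ^ (N.*2.+1.*2)%:Z) * jtp_coef N n
  + p ^ (N.*2.+1)%:Z * (jtp_coef N (n - 1) + jtp_coef N (n + 1)).
Proof.
pose a := p ^ (N%:Z + n); pose b := p ^ (N%:Z - n).
have a0 : a != 0 by rewrite expfz_neq0.
have b0 : b != 0 by rewrite expfz_neq0.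
have pD (k l : int) : p ^ (k + l) = p ^ k * p ^ l by rewrite expfzDr.
have QE (k : int) : Q ^ k = p ^ k * p ^ k by rewrite -expfzMl -expr2.
have pab : p ^ (N.*2)%:Z = a * b by rewrite -pD; congr (p ^ _); lia.
have Qa : Q ^ (N%:Z + n + 1) = p ^+ 2 * a ^+ 2 by rewrite QE pD expr1z -/a; ring.
have Qb : Q ^ (N%:Z - n + 1) = p ^+ 2 * b ^+ 2 by rewrite QE pD expr1z -/b; ring.
have Qa' : Q ^ (N%:Z + n) = a ^+ 2 by rewrite QE -/a; ring.
have Qb' : Q ^ (N%:Z - n) = b ^+ 2 by rewrite QE -/b; ring.
have iX := inv_facB1 (N%:Z + n + 1); rewrite addrK Qa in iX.
have iY := inv_facB1 (N%:Z - n + 1); rewrite addrK Qb in iY.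
have iX' := inv_facB1 (N%:Z + n); rewrite Qa' in iX'.
have iY' := inv_facB1 (N%:Z - n); rewrite Qb' in iY'.
have E2 : euler_fac (N.+1).*2 =
    euler_fac N.*2 * (1 - p ^+ 2 * a ^+ 2 * b ^+ 2) * (1 - p ^+ 4 * a ^+ 2 * b ^+ 2).
  rewrite doubleS !euler_facS; congr (_ * (1 - _) * (1 - _)).
    by rewrite exprSr [Q ^+ N.*2]exprnP QE pab /Q; ring.
  by rewrite !exprSr [Q ^+ N.*2]exprnP QE pab /Q; ring.
have n1 : p ^ ((n - 1) * (n - 1)) * a = p ^ (n * n) * p * b.
  rewrite -[X in _ * X * b]expr1z -!pD; congr (p ^ _); lia.
have n2 : p ^ ((n + 1) * (n + 1)) * b = p ^ (n * n) * p * a.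
  rewrite -[X in _ * X * a]expr1z -!pD; congr (p ^ _); lia.
have p4 : p ^ (N.*2.+1.*2)%:Z = p ^+ 2 * a ^+ 2 * b ^+ 2.
  rewrite (_ : (N.*2.+1.*2)%:Z = N.*2%:Z + N.*2%:Z + 1 + 1); last by lia.
  by rewrite !pD expr1z pab; ring.
have p2 : p ^ (N.*2.+1)%:Z = p * a * b.
  rewrite (_ : (N.*2.+1)%:Z = N.*2%:Z + 1); last by lia.
  by rewrite !pD expr1z pab; ring.
rewrite /jtp_coef E2 p4 p2.
have -> : N.+1%:Z + n = N%:Z + n + 1 by lia.
have -> : N.+1%:Z - n = N%:Z - n + 1 by lia.
have -> : N%:Z + (n - 1) = N%:Z + n - 1 by lia.
have -> : N%:Z - (n - 1) = N%:Z - n + 1 by lia.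
have -> : N%:Z + (n + 1) = N%:Z + n + 1 by lia.
have -> : N%:Z - (n + 1) = N%:Z - n - 1 by lia.
rewrite iX' iY' iX iY.
move: (inv_fac (N%:Z + n + 1)) (inv_fac (N%:Z - n + 1)) (euler_fac _) => X Y E.
have -> : p ^ ((n - 1) * (n - 1)) = p ^ (n * n) * p * b / a by rewrite -n1 mulfK.
have -> : p ^ ((n + 1) * (n + 1)) = p ^ (n * n) * p * a / b by rewrite -n2 mulfK.
move: (p ^ (n * n)) => P; field; exact/andP.
Qed.

Definition jacobi_prod w N : C :=
  \prod_(k < N) ((1 + w * p ^+ k.*2.+1) * (1 + w^-1 * p ^+ k.*2.+1)).

Definition seg N : seq int := map Posz (iota 0 N.+1) ++ map Negz (iota 0 N).

Lemma seg_uniq N : uniq (seg N).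
Proof.
rewrite cat_uniq !map_inj_uniq ?iota_uniq ?andbT /=; last 2 first.
- by move=> i j [].
- by move=> i j [].
by apply/hasPn => _ /mapP[i _ ->]; apply/mapP => -[j].
Qed.

Lemma mem_seg N n : (n \in seg N) = (`|n|%N <= N)%N.
Proof.
rewrite /seg mem_cat; case: n => n.
  have -> : (Posz n \in map Negz (iota 0 N)) = false by apply/mapP => -[].
  rewrite orbF mem_map => [|i j [] //].
  by rewrite mem_iota add0n ltnS.
have -> : (Negz n \in map Posz (iota 0 N.+1)) = false by apply/mapP => -[].
rewrite mem_map => [|i j [] //].
by rewrite mem_iota add0n.
Qed.

Lemma jtp_coef_out N n : (N < `|n|%N)%N -> jtp_coef N n = 0.
Proof.
rewrite /jtp_coef; case: n => n /= Nn.
  have -> : N%:Z - n%:Z = Negz (n - N).-1 by lia.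
  by rewrite !mulr0.
have -> : N%:Z + Negz n = Negz (n - N) by lia.
by rewrite mulr0 mul0r mulr0.
Qed.

Lemma finsum_jtp N (f : int -> C) : finsum (fun n => jtp_coef N n * f n : C^o).
Proof.
exists (seq_fset tt (seg N)) => n; rewrite seq_fsetE mem_seg -ltnNge => /jtp_coef_out->.
by rewrite mul0r.
Qed.

Lemma finite_jacobi_triple w N : w != 0 ->
  jacobi_prod w N = zsum (fun n => jtp_coef N n * w ^ n : C^o).
Proof.
move=> w0; elim: N => [|N IH].
  rewrite /jacobi_prod big_ord0 (@zsum_eq1 _ _ _ 0).
    change (1 = p ^ 0 * (euler_fac 0 * (euler_fac 0)^-1 * (euler_fac 0)^-1) * w ^ 0).
    by rewrite /euler_fac !big_ord0 !expr0z invr1 !mulr1.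
  by move=> n n0; rewrite jtp_coef_out ?mul0r // lt0n absz_eq0.
rewrite /jacobi_prod big_ord_recr /= -/(jacobi_prod w N) IH.
pose c1 := 1 + p ^ (N.*2.+1.*2)%:Z; pose c2 := p ^ (N.*2.+1)%:Z.
pose x n : C^o := jtp_coef N n * w ^ n.
have fx c d : finsum (fun n => c * x (n + d) : C^o).
  have [A hA] := finsum_jtp N (fun n => w ^ n).
  exists [fset (n - d : int) | n in A]%fset => n nA; rewrite /x hA ?mulr0 //.
  apply: contra nA => nA; apply/imfsetP; exists (n + d) => //=.
  by rewrite addrK.
have zx c d : zsum (fun n => c * x (n + d) : C^o) = c * zsum x.
  rewrite -(zsum_shift d x); apply/esym.
  by apply: (zsum_linear (c \*: idfun)); have := fx 1 d; under eq_fun do rewrite mul1r.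
transitivity (zsum (fun n => (c1 * x (n + 0) + (c2 * w * x (n + - 1) + c2 * w^-1 * x (n + 1)) : C^o))).
  rewrite zsumD ?zsumD ?zx; [|exact: fx|exact: fx|exact: fx|by apply: finsumD; exact: fx].
  have -> : c1 = 1 + c2 * c2 by rewrite /c1 -expfzDr //; congr (1 + p ^ _); lia.
  rewrite /c2 -exprnP; move: (p ^+ N.*2.+1) => P.
  rewrite -[X in X * _ = _]/(zsum x); move: (zsum x) => z.
  by field.
apply: eq_zsum => n; rewrite jtp_coef_rec /x addr0 -/c1 -/c2.
have -> : w ^ (n + -1) = w ^ n / w by rewrite expfzDr // exprN1.
have -> : w ^ (n + 1) = w ^ n * w by rewrite expfzDr // expr1z.
by field.
Qed.

End TripleProduct.

(** * Theta series and the triple product *)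

Section ThetaSeries.
Variable R : realType.
Local Notation C := R[i].
Implicit Types (p w : C) (n m : int) (N k : nat) (e sigma : R).

Definition theta_term p w n : C := p ^ (n * n) * w ^ n.

Lemma sum_seg (f : int -> R) N :
  \sum_(n <- seg N) f n = \sum_(i < N.+1) f i%:Z + \sum_(i < N) f (Negz i).
Proof.
rewrite big_cat !big_map -[iota 0 N.+1]/(index_iota 0 N.+1) big_mkord.
have -> : iota 0 N = index_iota 0 N by rewrite /index_iota subn0.
by rewrite big_mkord.
Qed.

Lemma sum_seg_geometric sigma N : 0 <= sigma < 1 ->
  \sum_(n <- seg N) sigma ^+ `|n|%N <= 2 / (1 - sigma).
Proof.
move=> s01; have /andP[s0 s1] := s01; rewrite sum_seg /= mulrDl !mul1r.
apply: lerD; first exact: sum_geometric_le.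
apply: le_trans (sum_geometric_le N s01); apply: ler_sum => i _.
by rewrite exprS ler_piMl ?exprn_ge0 // ltW.
Qed.

Lemma seq_in_seg (A : {fset int}) : exists m0 : nat, forall N, (m0 <= N)%N -> {subset A <= seg N}.
Proof.
exists (\max_(x <- A) `|x|%N) => N mN x xA; rewrite mem_seg; apply: leq_trans mN.
by rewrite (big_fsetD1 x) //= leq_maxl.
Qed.

(** The factor |p|^(n^2) beats any geometric rate: the bound is direct once W |p|^|n| <= sigma, and
    the finitely many earlier terms are absorbed in M. *)
Lemma theta_term_bound p w sigma : p != 0 -> w != 0 -> nrm p < 1 -> 0 < sigma < 1 ->
  exists2 M, 0 <= M & forall n, nrm (theta_term p w n) <= M * sigma ^+ `|n|%N.
Proof.
move=> p0 w0 p1 /andP[s0 s1]; have r01 : 0 <= nrm p < 1 by rewrite nrm_ge0.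
pose W := Num.max (nrm w) (nrm w)^-1; have w0' : 0 < nrm w by rewrite nrm_gt0.
have W1 : 1 <= W.
  rewrite le_max; have [//|w1] := lerP 1 (nrm w); rewrite /= invf_ge1 //.
  exact: ltW.
have W0 : 0 <= W by exact: le_trans W1.
have [K hK] := geometric_lt r01 W s0.
have nE n : nrm (theta_term p w n) <= (W * nrm p ^+ `|n|%N) ^+ `|n|%N.
  rewrite /theta_term nrmM !nrmXz mulrC exprMn -exprM; apply: ler_pM.
  - by rewrite exprz_ge0 // ltW.
  - by rewrite exprz_ge0 // nrm_ge0.
  - have wn : 0 <= nrm w by exact: ltW.
    case: n => n.
      by rewrite -exprnP; apply: lerXn2r; rewrite ?nnegrE // le_max lexx.
    rewrite NegzE -exprnN -exprVn; apply: lerXn2r; rewrite ?nnegrE ?invr_ge0 //.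
    by rewrite le_max lexx orbT.
  - by rewrite (_ : n * n = (`|n| * `|n|)%N%:Z) ?exprnP //; lia.
exists (1 + (W / sigma) ^+ K); first by rewrite addr_ge0 ?exprn_ge0 // divr_ge0 // ltW.
move=> n; apply: le_trans (nE n) _; have sn : 0 <= sigma ^+ `|n|%N by rewrite exprn_ge0 ?ltW.
have [/hK h|nK] := leqP K `|n|%N.
  apply: (le_trans (y := sigma ^+ `|n|%N)).
    by apply: lerXn2r; rewrite ?nnegrE ?mulr_ge0 ?exprn_ge0 ?nrm_ge0 // ltW.
  by rewrite mulrDl mul1r lerDl mulr_ge0 // exprn_ge0 // divr_ge0 // ltW.
apply: (le_trans (y := W ^+ K)).
  apply: (le_trans (y := W ^+ `|n|%N)); last by rewrite ler_weXn2l // ltnW.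
  apply: lerXn2r; rewrite ?nnegrE ?mulr_ge0 ?exprn_ge0 ?nrm_ge0 //.
  by rewrite ler_piMr // exprn_ile1 ?nrm_ge0 // ltW.
rewrite mulrDl mul1r ler_wpDl // exprMn -mulrA ler_peMr ?exprn_ge0 //.
rewrite exprVn mulrC ler_pdivlMr ?exprn_gt0 // mul1r.
by apply: ler_wiXn2l; rewrite ?(ltW s0) ?(ltW s1) // ltnW.
Qed.

Lemma theta_term_abs_bounded p w : p != 0 -> w != 0 -> nrm p < 1 -> abs_bounded (theta_term p w).
Proof.
move=> p0 w0 p1; have half : 0 < (2^-1 : R) < 1 by lra.
have [M M0 hM] := theta_term_bound p0 w0 p1 half; exists (M * (2 / (1 - 2^-1))) => A.
have [m0 /(_ m0 (leqnn _)) sA] := seq_in_seg A.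
apply: (le_trans (y := \sum_(n <- seg m0) nrm (theta_term p w n))).
  by rewrite (sum_fsetID _ (seg_uniq _) sA) lerDl sumr_ge0 // => n _; exact: nrm_ge0.
apply: (le_trans (y := \sum_(n <- seg m0) M * 2^-1 ^+ `|n|%N)); first exact: ler_sum.
rewrite -mulr_sumr ler_wpM2l // sum_seg_geometric //; lra.
Qed.

Lemma euler_lims p : nrm p < 1 -> exists l M, [/\ 0 <= M, l != 0, lims (euler_fac p) l
    & forall N, nrm (euler_fac p N - l) <= M * nrm (p ^+ 2) ^+ N].
Proof.
move=> p1; have q01 := nrmQ_lt1 p1; have /andP[q0 q1] := q01.
have b k : nrm (- (p ^+ 2) ^+ k.+1) <= 1 * nrm (p ^+ 2) ^+ k.
  by rewrite nrmN nrmX mul1r exprS ler_piMl ?exprn_ge0 // ltW.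
have [l [M [M0 hl rate]]] := prod_lims q01 b; exists l, M; split=> //.
by apply: (prod_lims_neq0 q01 b _ hl) => k; exact: euler_factor_neq0.
Qed.

Lemma jacobi_factor_bound p w k : nrm p < 1 ->
  nrm ((w + w^-1) * p ^+ k.*2.+1 + p ^+ k.*2.+1 ^+ 2) <= (nrm w + nrm w^-1 + 1) * nrm (p ^+ 2) ^+ k.
Proof.
move=> p1; have p0 := nrm_ge0 p; apply: le_trans (nrmD _ _) _; rewrite !nrmM !nrmX mulrDl mul1r.
have ek : nrm p ^+ k.*2.+1 <= (nrm p ^+ 2) ^+ k.
  by rewrite -exprM exprS -mul2n ler_piMl ?exprn_ge0 // ltW.
apply: lerD.
  by apply: ler_pM; rewrite ?nrm_ge0 ?exprn_ge0 // nrmD.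
apply: le_trans ek; rewrite ler_piMr ?exprn_ge0 //; apply: exprn_ile1 => //.
exact: ltW.
Qed.

Lemma jacobi_factorE p w k : w != 0 ->
  (1 + w * p ^+ k.*2.+1) * (1 + w^-1 * p ^+ k.*2.+1) =
  1 + ((w + w^-1) * p ^+ k.*2.+1 + p ^+ k.*2.+1 ^+ 2).
Proof. by move=> w0; field. Qed.

Lemma jacobi_lims p w : w != 0 -> nrm p < 1 -> exists l, lims (jacobi_prod p w) l.
Proof.
move=> w0 p1; have [l [M [_ hl _]]] := prod_lims (nrmQ_lt1 p1) (fun k => jacobi_factor_bound w k p1).
exists l; apply: eq_lims hl => N; apply: eq_bigr => k _.
by rewrite jacobi_factorE.
Qed.

Lemma jacobi_lims_neq0 p w l : w != 0 -> nrm p < 1 -> nrm (w * p) < 1 -> nrm (w^-1 * p) < 1 ->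
  lims (jacobi_prod p w) l -> l != 0.
Proof.
move=> w0 p1 wp wp' hl.
have nz z k : nrm (z * p) < 1 -> 1 + z * p ^+ k.*2.+1 != 0.
  move=> zp; rewrite addr_eq0; apply: contraTneq zp => /(congr1 (@nrm R)).
  rewrite nrm1 nrmN exprS mulrA nrmM -leNgt => ->.
  by rewrite ler_piMr ?nrm_ge0 // nrmX exprn_ile1 ?nrm_ge0 // ltW.
apply: (prod_lims_neq0 (nrmQ_lt1 p1) (fun k => jacobi_factor_bound w k p1)).
  by move=> k; rewrite -jacobi_factorE // mulf_neq0 // nz.
by apply: eq_lims hl => N; apply: eq_bigr => k _; rewrite jacobi_factorE.
Qed.

Lemma shift_nat N n : (`|n| <= N)%N -> exists a : nat, N%:Z + n = a%:Z /\ (N - `|n| <= a)%N.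
Proof.
move=> nN; exists (absz (N%:Z + n)); case: n nN => n /= nN; first by lia.
by rewrite NegzE; lia.
Qed.

(* Tannery's theorem: the coefficients of the finite identity approach those of
   the theta series at a geometric rate. *)
Theorem jacobi_triple p w phi B : p != 0 -> w != 0 -> nrm p < 1 ->
  lims (euler_fac p) phi -> lims (jacobi_prod p w) B -> usum (theta_term p w) (phi * B).
Proof.
move=> p0 w0 p1 hphi hB; apply: usum_exhaust; first exact: theta_term_abs_bounded.
have [phi' [M [M0 phi0 hphi' rate]]] := euler_lims p1.
have E := lims_unique hphi hphi'; subst phi' => {hphi'}.
have [D _ hD] := lims_bounded hphi; have [D' _ hD'] := lims_bounded (limsV phi0 hphi).
pose rho := nrm (p ^+ 2); have q01 : 0 <= rho < 1 by exact: nrmQ_lt1.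
have rho0 : 0 < rho by rewrite nrm_gt0 expf_neq0.
have /andP[_ rho1] := q01.
(* The relative error [F N n] of a coefficient is only of order rho^(N - |n|). Against theta terms
   of the smaller rate rho/2 the product is of order rho^N 2^(-|n|), which is summable in n and
   tends to 0 with N. *)
have sig : 0 < rho / 2 < 1 by lra.
have [G G0 hG] := theta_term_bound p0 w0 p1 sig.
pose F N n := phi * (euler_fac p N.*2 * inv_fac p (N%:Z + n) * inv_fac p (N%:Z - n)) - 1.
pose K := D' * D' * ((nrm phi + D + nrm phi) * M).
have K0 : 0 <= K.
  have D0 : 0 <= D by exact: le_trans (nrm_ge0 _) (hD 0%N).
  have D'0 : 0 <= D' by exact: le_trans (nrm_ge0 _) (hD' 0%N).
  by rewrite /K !mulr_ge0 ?addr_ge0 ?nrm_ge0.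
have Fb N n : (`|n| <= N)%N -> nrm (F N n) <= K * rho ^+ (N - `|n|)%N.
  move=> nN; have [a [aE Na]] := shift_nat nN.
  have [b [bE Nb]] : exists b : nat, N%:Z - n = b%:Z /\ (N - `|n| <= b)%N.
    by rewrite -abszN in nN *; exact: shift_nat.
  have small u : (N - `|n| <= u)%N -> nrm (euler_fac p u - phi) <= M * rho ^+ (N - `|n|)%N.
    by move=> Nu; apply: le_trans (rate u) _; rewrite ler_wpM2l // ler_wiXn2l // ltW.
  rewrite /F aE bE /=; have fa0 := euler_fac_neq0 p1 a; have fb0 := euler_fac_neq0 p1 b.
  have -> : phi * (euler_fac p N.*2 / euler_fac p a / euler_fac p b) - 1 =
      (euler_fac p a)^-1 * (euler_fac p b)^-1 * (phi * (euler_fac p N.*2 - phi)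
        + (- (euler_fac p a * (euler_fac p b - phi)) + - (phi * (euler_fac p a - phi)))).
    by field; apply/andP; split.
  rewrite nrmM /K -[leRHS]mulrA; apply: ler_pM; rewrite ?nrm_ge0 //.
    by rewrite nrmM; apply: ler_pM; rewrite ?nrm_ge0.
  rewrite -addrA !mulrDl; apply: le_trans (nrmD _ _) _; apply: lerD.
    rewrite nrmM -mulrA ler_wpM2l ?nrm_ge0 // small //.
    by apply: leq_trans (leq_subr _ _) _; rewrite -addnn leq_addr.
  apply: le_trans (nrmD _ _) _; rewrite !nrmN !nrmM -!mulrA; apply: lerD.
    by apply: ler_pM; rewrite ?nrm_ge0 // small.
  by rewrite ler_wpM2l ?nrm_ge0 // small.
have key N : nrm (phi * jacobi_prod p w N - \sum_(n <- seg N) theta_term p w n) <=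
    (K * G * 4) * rho ^+ N.
  rewrite finite_jacobi_triple // (@zsumE _ _ _ (seq_fset tt (seg N))); last first.
    move=> n; rewrite seq_fsetE mem_seg -ltnNge => nN.
    have -> : jtp_coef p N n = 0 by apply: jtp_coef_out.
    exact: mul0r.
  have -> : \sum_(n <- seq_fset tt (seg N)) (jtp_coef p N n * w ^ n : C^o) =
      \sum_(n <- seg N) (jtp_coef p N n * w ^ n).
    apply: perm_big; apply: uniq_perm => //; first exact: seg_uniq.
    by move=> n; rewrite seq_fsetE.
  rewrite mulr_sumr -sumrB; apply: le_trans (nrm_sum _ _) _.
  apply: (le_trans (y := \sum_(n <- seg N) (K * G * rho ^+ N) * 2^-1 ^+ `|n|%N)); last first.
    have -> : K * G * 4 * rho ^+ N = K * G * rho ^+ N * 4 by ring.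
    have KG : 0 <= K * G * rho ^+ N.
      by apply: mulr_ge0; [exact: mulr_ge0|apply: exprn_ge0; exact: ltW].
    rewrite -mulr_sumr; apply: ler_wpM2l => //.
    have h2 : 0 <= (2^-1 : R) < 1 by lra.
    have h4 : 2 / (1 - 2^-1) = 4 :> R by field.
    by rewrite -h4; exact: sum_seg_geometric.
  rewrite big_seq [leRHS]big_seq; apply: ler_sum => n; rewrite mem_seg => nN.
  have -> : phi * (jtp_coef p N n * w ^ n) - theta_term p w n = F N n * theta_term p w n.
    by rewrite /F /theta_term /jtp_coef; ring.
  rewrite nrmM; apply: (le_trans (y := (K * rho ^+ (N - `|n|)%N) * (G * (rho / 2) ^+ `|n|%N))).
    by apply: ler_pM; rewrite ?nrm_ge0 ?Fb.
  rewrite exprMn -{2}(subnK nN) exprD le_eqVlt; apply/orP; left; apply/eqP; ring.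
move=> A e e0; have e2 : 0 < e / 2 by rewrite divr_gt0.
have [m0 hm0] := seq_in_seg A.
have [m1 hm1] := limsM (lims_cst phi) hB e2.
have [m2 hm2] := geometric_lt q01 (K * G * 4) e2.
pose N := maxn m0 (maxn m1 m2); exists (seg N); split; first exact: seg_uniq.
  by apply: hm0; exact: leq_maxl.
rewrite [e]splitr; apply: le_lt_trans (nrm_dist _ (phi * jacobi_prod p w N) _) _; apply: ltrD.
  by rewrite nrmC; apply: le_lt_trans (key N) _; apply: hm2; rewrite !leq_max leqnn !orbT.
by apply: hm1; rewrite !leq_max leqnn !orbT.
Qed.

End ThetaSeries.

Section ThetaIdentities.
Variable R : realType.
Local Notation C := R[i].
Implicit Types (p w t y ep : C) (m n : int) (N k : nat) (j : bool).

Lemma usum_theta_product t w w' T T' : t != 0 -> w != 0 -> w' != 0 -> nrm t < 1 ->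
    usum (theta_term t w) T -> usum (theta_term t w') T' ->
  usum (fun mn => theta_term t w mn.1 * theta_term t w' mn.2) (T * T').
Proof.
by move=> t0 w0 w0' t1; apply: usumM; exact: theta_term_abs_bounded.
Qed.

Definition diag_index j (ab : int * int) : int * int := (ab.1 - ab.2, ab.1 + ab.2 + j%:Z).
Definition diag_inv j (mn : int * int) : int * int :=
  (((mn.1 + mn.2 - j%:Z) %/ 2)%Z, ((mn.2 - mn.1 - j%:Z) %/ 2)%Z).

Lemma diag_indexK j : cancel (diag_index j) (diag_inv j).
Proof.
case=> a b; rewrite /diag_inv /diag_index /=; congr (_, _).
  have -> : a - b + (a + b + j%:Z) - j%:Z = a * 2 by ring.
  by rewrite mulzK.
have -> : a + b + j%:Z - (a - b) - j%:Z = b * 2 by ring.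
by rewrite mulzK.
Qed.

Lemma diag_invP j m n : diag_index j (diag_inv j (m, n)) = (m, n) \/
  exists a, m + n = j%:Z + 2 * a + 1.
Proof.
have [a [aE|aE]] : exists a : int, m + n - j%:Z = 2 * a \/ m + n - j%:Z = 2 * a + 1.
  by exists ((m + n - j%:Z) %/ 2)%Z; lia.
- left; rewrite /diag_inv /diag_index /= aE mulrC mulzK //.
  have -> : n - m - j%:Z = (a - m) * 2 by lia.
  by rewrite mulzK //; congr (_, _); lia.
- by right; exists a; lia.
Qed.

(* The substitution (m, n) = (a - b, a + b + j) turns the terms with m + n = j mod 2
   of a product of two theta series in t into the square of a theta series in t^2. *)
Lemma theta_product t y ep j T1 T2 T3 T4 T5 : t != 0 -> y != 0 -> ep * ep = 1 -> nrm t < 1 ->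
    usum (theta_term t ep) T1 -> usum (theta_term t y) T2 ->
    usum (theta_term t (- ep)) T3 -> usum (theta_term t (- y)) T4 ->
    usum (theta_term (t ^+ 2) (t ^+ 2 ^+ j * (ep * y))) T5 ->
  T1 * T2 + (- 1) ^+ j * (T3 * T4) = 2 * (t ^+ j * y ^+ j * T5 ^+ 2).
Proof.
move=> t0 y0 ep2 t1 h1 h2 h3 h4 h5.
have ep0 : ep != 0 by apply: contra_eq_neq ep2 => ->; rewrite mul0r eq_sym oner_eq0.
have nep0 : - ep != 0 by rewrite oppr_eq0.
have ny0 : - y != 0 by rewrite oppr_eq0.
have N1 : (- 1 : C) != 0 by rewrite oppr_eq0 oner_eq0.
have q0 : t ^+ 2 != 0 by rewrite expf_neq0.
have q1 : nrm (t ^+ 2) < 1 by rewrite nrmX exprn_ilt1 ?nrm_ge0.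
have w0 : t ^+ 2 ^+ j * (ep * y) != 0 by rewrite !mulf_neq0 // expf_neq0.
pose z (mn : int * int) := theta_term t ep mn.1 * theta_term t y mn.2
  + (- 1) ^+ j * (theta_term t (- ep) mn.1 * theta_term t (- y) mn.2).
have hz : usum z (T1 * T2 + (- 1) ^+ j * (T3 * T4)).
  apply: usumD; first exact: usum_theta_product.
  by apply: usumZ; exact: usum_theta_product.
have zE m n : z (m, n) = (1 + (- 1) ^+ j * (- 1) ^ (m + n)) * (theta_term t ep m * theta_term t y n).
  rewrite /z /theta_term /= -[- ep]mulN1r -[- y]mulN1r !expfzMl expfzDr //; ring.
pose F ab : {fset int * int} := [fset diag_index j ab]%fset.
have Fpi i ab : i \in F ab -> diag_inv j i = ab.
  by rewrite inE => /eqP->; exact: diag_indexK.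
have sq (a : int) : (- 1 : C) ^ (2 * a) = 1.
  by rewrite -exprz_exp -exprnP sqrrN expr1n exp1rz.
have jj : (- 1) ^+ j * (- 1) ^ j%:Z = 1 :> C by rewrite -exprnP -expr2 sqrr_sign.
have zF i : z i != 0 -> i \in F (diag_inv j i).
  case: i => m n; rewrite zE inE => z0.
  have [->//|[a aE]] := diag_invP j m n; case/eqP: z0.
  have E : (- 1) ^+ j * (- 1) ^ (m + n) = - 1 :> C.
    by rewrite aE expfzDr // expfzDr // sq mulr1 expr1z mulrA jj mul1r.
  by rewrite E subrr mul0r.
have epV (a : int) : ep ^ (- a) = ep ^ a.
  have epi : ep^-1 = ep by apply: (mulfI ep0); rewrite mulfV.
  by rewrite -exprz_inv epi.
have := usum_fibers Fpi zF hz.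
have hT := usum_theta_product q0 w0 w0 q1 h5 h5.
move=> hz'; apply: usum_unique hz' _.
rewrite (_ : 2 * _ = 2 * (t ^+ j * y ^+ j) * (T5 * T5)); last by ring.
apply: eq_usum (usumZ _ hT) => -[a b] /=; rewrite /F big_seq_fset1 zE.
have -> : a - b + (a + b + j%:Z) = j%:Z + 2 * a by ring.
rewrite expfzDr // sq mulr1 jj /theta_term.
(* Here (a - b)^2 + (a + b + j)^2 = 2a^2 + 2b^2 + 2j (a + b) + j, because j is 0 or 1. *)
have tE : t ^ ((a - b) * (a - b)) * t ^ ((a + b + j%:Z) * (a + b + j%:Z)) =
    t ^+ j * ((t ^+ 2) ^ (a * a) * (t ^+ 2) ^ (b * b) * ((t ^+ 2 ^+ j) ^ a * (t ^+ 2 ^+ j) ^ b)).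
  rewrite !exprnP !exprz_exp -!expfzDr //; congr (t ^ _).
  by case: (j) => /=; ring.
have yE : y ^ (a + b + j%:Z) = y ^+ j * y ^ a * y ^ b.
  by rewrite expfzDr // expfzDr // exprnP; ring.
have epE : ep ^ (a - b) = ep ^ a * ep ^ b by rewrite expfzDr // epV.
have vE (k : int) : (t ^+ 2 ^+ j * (ep * y)) ^ k = (t ^+ 2 ^+ j) ^ k * (ep ^ k * y ^ k).
  by rewrite expfzMl; congr (_ * _); exact: expfzMl.
rewrite !vE yE epE.
move: tE; set u := t ^ _; set u' := t ^ _ => tE.
transitivity (2 * (u * u') * (y ^+ j * y ^ a * y ^ b * ep ^ a * ep ^ b)); last by ring.
rewrite tE; move: (ep ^ a) (ep ^ b) (y ^ a) (y ^ b) ((t ^+ 2) ^ (a * a)) ((t ^+ 2) ^ (b * b)).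
move: ((t ^+ 2 ^+ j) ^ a) ((t ^+ 2 ^+ j) ^ b) (t ^+ j) (y ^+ j) => x1 x2 x3 x4 x5 x6 x7 x8 x9 x10.
by ring.
Qed.

End ThetaIdentities.

(** * Characters *)

Section FockCharacter.
Variable R : realType.
Local Notation C := R[i].
Implicit Types (x : state) (j : bool).
Variables (t y ep : C).
Hypothesis (t0 : t != 0) (y0 : y != 0) (t1 : nrm t < 1).
Hypothesis (ty1 : nrm (t * y) < 1) (ty1' : nrm (t * y^-1) < 1) (ep2 : ep * ep = 1).

Definition monomial (t y ep : C) x : C := t ^+ deg x * y ^ chg x * ep ^+ #|` x.2|.

Let a s i : C := s ^+ (i./2).*2.+1 * (if odd i then y else y^-1).
Let b s i : C := s ^+ (i./2).*2.+1 * ep.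

Lemma monomial_multiplicative s : multiplicative_weight (a s) (b s) (monomial s y ep).
Proof.
split=> [|x i|x i ix].
- by rewrite /monomial deg_vst chg_vst cardfs0 !expr0 expr0z !mulr1.
- rewrite /monomial deg_inc chg_inc exprD expfzDr // /a.
  rewrite /= (_ : y ^ (if odd i then 1 else - 1) = if odd i then y else y^-1); last first.
    by case: odd; rewrite ?expr1z ?exprN1.
  move: (if odd i then _ else _) (s ^+ (i./2).*2.+1) (s ^+ deg x) (y ^ chg x) (ep ^+ _) => ? ? ? ? ?.
  by ring.
- rewrite /monomial deg_fsetU1 // chg_fsetU1 // cardfsU1 ix exprD /b /= add1n [ep ^+ _.+1]exprS.
  move: (s ^+ (i./2).*2.+1) (s ^+ deg x) (y ^ chg x) (ep ^+ #|` x.2|) => ? ? ? ?; ring.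
Qed.

Lemma nrm_ep : nrm ep = 1.
Proof.
have /eqP : nrm ep ^+ 2 = 1 by rewrite expr2 -nrmM ep2 nrm1.
by rewrite sqrp_eq1 ?nrm_ge0 // => /eqP.
Qed.

Lemma epV : ep^-1 = ep.
Proof.
have ep0 : ep != 0 by rewrite -nrm_gt0 nrm_ep.
by apply: (mulfI ep0); rewrite mulfV.
Qed.

(** At each energy there are two fermions, with factors 1 + ep s^(2k+1), and two bosons, with y and
    y^-1. As [ep] is its own inverse, the fermions give the Jacobi product at [ep], and the bosons
    the reciprocal of the one at [- y]. *)
Lemma monomial_usum s B D : nrm s = nrm t -> lims (jacobi_prod s ep) B ->
  lims (jacobi_prod s (- y)) D -> D != 0 -> usum (monomial s y ep) (B / D).
Proof.
move=> st hB hD D0.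
pose c := nrm y + nrm y^-1 + 1; pose rho := Num.max (nrm (t * y)) (nrm (t * y^-1)).
have tn : 0 <= nrm t := nrm_ge0 t.
have pow k : nrm (s ^+ (k./2).*2.+1) <= nrm t ^+ k.
  rewrite nrmX st ler_wiXn2l // ?ltW //.
  by rewrite -{1}[k]odd_double_half -addn1 addnC leq_add2l; case: odd.
have sy z k : nrm (t * z) <= rho -> nrm (s ^+ k.+1 * z) <= rho.
  move=> h; rewrite exprSr -mulrA nrmM nrmX st; apply: le_trans h.
  by rewrite nrmM st -nrmM ler_piMl ?nrm_ge0 // exprn_ile1 // ltW.
have rho1 : rho < 1 by rewrite gt_max ty1 ty1'.
have r01 : 0 <= nrm t < 1 by rewrite tn.
apply: (@weight_usum _ (a s) (b s) _ c (nrm t) rho (monomial_multiplicative s) r01 rho1).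
- move=> i; rewrite /a nrmM mulrC; apply: ler_pM; rewrite ?nrm_ge0 // /c.
  have := nrm_ge0 y; have := nrm_ge0 y^-1; case: odd; lra.
- move=> i; rewrite /b nrmM nrm_ep mulr1; apply: le_trans (pow i) _.
  rewrite ler_peMl ?exprn_ge0 // /c; have := nrm_ge0 y; have := nrm_ge0 y^-1; lra.
- by move=> i; rewrite /a; case: odd; apply: sy; rewrite le_max lexx ?orbT.
apply: eq_lims (limsM hB (limsV D0 hD)) => m; rewrite /jacobi_prod.
elim: m => [|m IH]; first by rewrite !big_ord0 invr1 mulr1.
rewrite doubleS !big_ord_recr /= -IH /a /b /=.
rewrite uphalf_double doubleK odd_double /= invrN !mulNr epV !invfM.
rewrite [y^-1 * _]mulrC [y * _]mulrC [ep * _]mulrC.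
by ring.
Qed.

Lemma monomialN x : monomial (- t) y ep x = (- 1) ^+ odd (num x) * monomial t y ep x.
Proof.
by rewrite /monomial [(- t) ^+ _]exprNn -odd_deg signr_odd !mulrA.
Qed.

Lemma jacobi_prodN w N : jacobi_prod (- t) w N = jacobi_prod t (- w) N.
Proof.
apply: eq_bigr => k _; rewrite exprNn (_ : (- 1) ^+ k.*2.+1 = -1 :> C); last first.
  by rewrite -signr_odd /= odd_double.
by rewrite invrN; ring.
Qed.

Lemma jacobi_prodM N : jacobi_prod t y N * jacobi_prod t (- y) N = jacobi_prod (t ^+ 2) (- y ^+ 2) N.
Proof.
rewrite -big_split; apply: eq_bigr => k _ /=.
have -> : (t ^+ 2) ^+ k.*2.+1 = t ^+ k.*2.+1 ^+ 2 by rewrite -!exprM mulnC.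
by rewrite !invrN -[(y ^+ 2)^-1]exprVn; ring.
Qed.

(* Half the sum over all states, twisted by the sign of t, selects the parity. *)
Lemma fock_character j E Bq Th : lims (euler_fac t) E -> lims (jacobi_prod (t ^+ 2) (- y ^+ 2)) Bq ->
    usum (theta_term (t ^+ 2) (t ^+ 2 ^+ j * (ep * y))) Th ->
  usum (fun x => if odd (num x) == j then monomial t y ep x else 0)
    (t ^+ j * y ^+ j * Th ^+ 2 / (E ^+ 2 * Bq)).
Proof.
move=> hE hBq hTh; have ep0 : ep != 0 by rewrite -nrm_gt0 nrm_ep.
have lo z : z != 0 -> exists l, lims (jacobi_prod t z) l by move=> z0; exact: jacobi_lims.
have [B1 hB1] := lo ep ep0.
have [B2 hB2] := lo y y0.
have nep0 : - ep != 0 by rewrite oppr_eq0.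
have ny0 : - y != 0 by rewrite oppr_eq0.
have [B3 hB3] := lo (- ep) nep0.
have [B4 hB4] := lo (- y) ny0.
have B2n0 : B2 != 0.
  by apply: (jacobi_lims_neq0 y0 t1 _ _ hB2); rewrite mulrC.
have B4n0 : B4 != 0.
  by apply: (jacobi_lims_neq0 ny0 t1 _ _ hB4); rewrite ?invrN mulNr nrmN mulrC.
have hBq' : B2 * B4 = Bq.
  apply: lims_unique hBq; apply: eq_lims (limsM hB2 hB4) => N; exact: jacobi_prodM.
have En0 : E != 0.
  by have [l [M [_ l0 hl _]]] := euler_lims t1; rewrite (lims_unique hE hl).
have h1 := monomial_usum erefl hB1 hB4 B4n0.
have h2 : usum (monomial (- t) y ep) (B3 / B2).
  apply: (monomial_usum _ _ _ B2n0); first by rewrite nrmN.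
    by apply: eq_lims hB3 => N; rewrite jacobi_prodN.
  by apply: eq_lims hB2 => N; rewrite jacobi_prodN opprK.
have T := jacobi_triple t0 _ t1 hE.
have key := theta_product t0 y0 ep2 t1 (T _ _ ep0 hB1) (T _ _ y0 hB2) (T _ _ nep0 hB3) (T _ _ ny0 hB4) hTh.
(* Over the common denominator B2 B4 = Bq the numerator is B1 B2 + (-1)^j B3 B4; multiplied by E^2
   it is the left-hand side of [theta_product]. *)
have -> : t ^+ j * y ^+ j * Th ^+ 2 / (E ^+ 2 * Bq) =
    2^-1 * (B1 / B4) + 2^-1 * (- 1) ^+ j * (B3 / B2).
  have two : (2 : C) != 0 by rewrite pnatr_eq0.
  apply: (mulfI two); rewrite mulrA -key -hBq'.
  move: ((- 1) ^+ j) => sj; field.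
  by rewrite En0 B2n0 B4n0.
apply: eq_usum (usumD (usumZ _ h1) (usumZ _ h2)) => x /=; rewrite monomialN [X in _ + X]mulrA.
have -> : 2^-1 * (- 1) ^+ j * (- 1) ^+ odd (num x) = (if odd (num x) == j then 2^-1 else - 2^-1) :> C.
  by case: (j); case: (odd _); rewrite /= ?expr0 ?expr1; ring.
by case: ifP => _; field.
Qed.

End FockCharacter.

(** * Theta and eta functions as theta series and Euler products *)

Section Exponentials.
Variable R : realType.
Local Notation C := R[i].
Local Notation ci := (ci R).
Local Notation cpi := (cpi R).
Implicit Types (x z tau : C).

Lemma cexpD x z : cexp (x + z) = cexp x * cexp z.
Proof.
case: x z => [a b] [a' b']; rewrite /cexp /= expRD cosD sinD.
by apply/eqP; rewrite eq_complex /=; apply/andP; split; apply/eqP; ring.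
Qed.

Lemma cexp0 : cexp (0 : C) = 1.
Proof. by apply/eqP; rewrite /cexp /= expR0 cos0 sin0 eq_complex /=; apply/andP; split; apply/eqP; ring. Qed.

Lemma nrm_cexp x : nrm (cexp x) = expR (complex.Re x).
Proof.
rewrite /cexp nrmM nrm_real ?expR_ge0 // [nrm (_ +i* _)%C]/nrm /=.
by rewrite cos2Dsin2 sqrtr1 mulr1.
Qed.

Lemma expiD x z : expi (x + z) = expi x * expi z.
Proof. by rewrite /expi mulrDr cexpD. Qed.
Lemma expi0 : expi (0 : C) = 1.
Proof. by rewrite /expi mulr0 cexp0. Qed.
Lemma expi_neq0 x : expi x != 0.
Proof. by rewrite -nrm_gt0 nrm_cexp expR_gt0. Qed.
Lemma expiN x : expi (- x) = (expi x)^-1.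
Proof. by apply: (mulfI (expi_neq0 x)); rewrite -expiD subrr expi0 mulfV ?expi_neq0. Qed.
Lemma expiMn x (n : nat) : expi (n%:R * x) = expi x ^+ n.
Proof.
elim: n => [|n IH]; first by rewrite mul0r expi0.
by rewrite -addn1 natrD mulrDl mul1r expiD IH addn1 exprSr.
Qed.
Lemma expiMz x (n : int) : expi (n%:~R * x) = expi x ^ n.
Proof.
case: n => n; first exact: expiMn.
by rewrite NegzE rmorphN mulNr expiN -exprnN -expiMn.
Qed.

Lemma expi_half : expi (2^-1 : C) = - 1.
Proof.
have -> : expi (2^-1 : C) = cexp (cpi * ci) by rewrite /expi; congr cexp; field.
rewrite /cexp /cpi /ci /= !mul0r mulr0 subrr mulr1 addr0 expR0 cospi sinpi.
by apply/eqP; rewrite eq_complex /=; apply/andP; split; apply/eqP; ring.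
Qed.

Lemma nrm_expi x : nrm (expi x) = expR (- (2 * pi * complex.Im x)).
Proof.
rewrite /expi nrm_cexp; congr expR; case: x => a b; rewrite /cpi /ci /=.
ring.
Qed.

Lemma cpi_ciE x : cexp (cpi * ci * x) = expi (x / 2).
Proof. by rewrite /expi; congr cexp; field. Qed.

(* expi x at x = tau / 2 is the square root of the nome. *)
Lemma theta0E (b : bool) tau z S :
  usum (theta_term (expi (tau / 2)) ((- 1) ^+ b * expi z)) S -> theta 0 b tau z = S.
Proof.
move=> hS; apply: usum_sum; apply: eq_usum hS => n.
rewrite /theta_term.
have -> : ((- 1) ^+ b : C) = expi (b%:R / 2).
  by case: b; rewrite /= ?expr0 ?expr1 ?mul0r ?expi0 // mul1r expi_half.
rewrite -!expiD -[in LHS]expiMz -[in LHS]expiMz -!expiD.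
have -> : cpi * ci * (n%:~R + 0 / 2) ^+ 2 * tau + 2 * cpi * ci * (n%:~R + 0 / 2) * (z + b%:R / 2) =
   cpi * ci * (n%:~R ^+ 2 * tau + 2 * (n%:~R * (z + b%:R / 2))) by rewrite mul0r; ring.
by rewrite cpi_ciE; congr expi; rewrite rmorphM /=; field.
Qed.

(** Expanding (n + 1/2)^2 moves a half period into the argument of the series and leaves the
    prefactor, which does not depend on n. *)
Lemma theta1E (b : bool) tau z S :
  usum (theta_term (expi (tau / 2)) ((- 1) ^+ b * (expi (tau / 2) * expi z))) S ->
  theta 1 b tau z = expi (tau / 8%:R + z / 2 + b%:R / 4%:R) * S.
Proof.
move=> hS; apply: usum_sum; apply: eq_usum (usumZ _ hS) => n.
rewrite /theta_term.
have -> : ((- 1) ^+ b : C) = expi (b%:R / 2).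
  by case: b {hS}; rewrite /= ?expr0 ?expr1 ?mul0r ?expi0 // mul1r expi_half.
rewrite -!expiD -[in LHS]expiMz -[in LHS]expiMz -!expiD.
have -> : cpi * ci * (n%:~R + 1 / 2) ^+ 2 * tau + 2 * cpi * ci * (n%:~R + 1 / 2) * (z + b%:R / 2) =
   cpi * ci * ((n%:~R + 1 / 2) ^+ 2 * tau + 2 * ((n%:~R + 1 / 2) * (z + b%:R / 2))) by ring.
by rewrite cpi_ciE; congr expi; rewrite rmorphM /=; field.
Qed.

Lemma etaE tau E : lims (euler_fac (expi (tau / 2))) E -> eta tau = expi (tau / 24%:R) * E.
Proof.
move=> /lims_cvg hE; have hl := cvg_lim (@norm_hausdorff _ _) hE.
rewrite /eta; set f := (X in lim (X @ _)%classic).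
suff -> : f = euler_fac (expi (tau / 2)) by rewrite hl.
apply/funext => N; rewrite /f big_add1 big_mkord; apply: eq_bigr => k _.
by have -> : expi tau = expi (tau / 2) ^+ 2 by rewrite -expiMn; congr expi; field.
Qed.

End Exponentials.

(** * From sums over states to the theta quotients *)

Section Characters.
Variable R : realType.
Local Notation C := R[i].
Implicit Types (tau z : C) (j super : bool).

Definition theta_quotient j super tau z : C :=
  (eta (2%:R * tau) / eta tau) ^+ 3 *
  (theta j super (2%:R * tau) z * theta 1 super tau z
    / (theta (~~ j) super (2%:R * tau) z * theta 0 1 (2%:R * tau) (2%:R * z))).

(** The factors with even and odd k separate. In the limit, and up to prefactors, theta_1b(tau, z)
    becomes a product of theta_0b(2 tau, z) and theta_1b(2 tau, z); this is how the theta quotients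
    turn into the square of a single theta function. *)
Lemma jacobi_prod_double t w N : t != 0 -> w != 0 ->
  jacobi_prod t (t * w) N.*2 = jacobi_prod (t ^+ 2) (t ^+ 2 * w) N * jacobi_prod (t ^+ 2) w N :> C.
Proof.
move=> t0 w0; elim: N => [|N IH]; first by rewrite /jacobi_prod !big_ord0 mulr1.
have -> : N.+1.*2 = N.*2.+2 by rewrite doubleS.
have E1 : t ^+ (N.*2).*2.+1 = t * t ^+ (N.*2).*2 by rewrite exprS.
have E2 : t ^+ (N.*2.+1).*2.+1 = t ^+ 3 * t ^+ (N.*2).*2 by rewrite -exprD; congr (_ ^+ _); lia.
have E3 : (t ^+ 2) ^+ N.*2.+1 = t ^+ 2 * t ^+ (N.*2).*2.
  by rewrite -exprM -exprD; congr (_ ^+ _); lia.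
rewrite /jacobi_prod [LHS]big_ord_recr [in LHS]big_ord_recr -/(jacobi_prod t (t * w) N.*2) IH.
rewrite !big_ord_recr -/(jacobi_prod (t ^+ 2) w N) -/(jacobi_prod (t ^+ 2) (t ^+ 2 * w) N) /= E1 E2 E3.
by move: (jacobi_prod _ _ _) (jacobi_prod _ w N) (t ^+ (N.*2).*2) => A B u; field; rewrite t0 w0.
Qed.

Lemma domain_bounds tau z : in_domain tau z ->
  let t := expi (tau / 2) in let y := expi z in
  [/\ nrm t < 1, 1 < nrm y & nrm (t * y) < 1].
Proof.
case=> tau0; rewrite !nrm_norm => y1 ty.
have {}y1 : 1 < nrm (expi z) by rewrite -ltcR.
have tE : expi tau = expi (tau / 2) ^+ 2 by rewrite -expiMn; congr expi; field.
have {}ty : nrm (expi z) < (nrm (expi (tau / 2)))^-1.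
  have sq : sqrtC (nrm (expi tau))%:C%C = (nrm (expi (tau / 2)))%:C%C.
    by rewrite -!nrm_norm tE normrX sqrCK.
  by move: ty; rewrite sq -fmorphV ltcR.
split=> //; last by rewrite nrmM mulrC -ltr_pdivlMr ?mul1r // nrm_gt0 expi_neq0.
have tau2 : 0 < complex.Im (tau / 2).
  have : complex.Im tau = complex.Im (tau / 2) + complex.Im (tau / 2).
    by rewrite -raddfD; congr complex.Im; field.
  by move: tau0; lra.
have e1 := expR_lt1 (- (2 * pi * complex.Im (tau / 2))).
by rewrite nrm_expi e1 oppr_lt0 !mulr_gt0 ?pi_gt0.
Qed.

Lemma fock_theta_character j super tau z : in_domain tau z ->
  usum (fun x => if odd (num x) == j then
          monomial (expi (tau / 2)) (expi z) ((- 1) ^+ super) x else 0)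
    ((- 1) ^+ (super && j) * theta_quotient j super tau z).
Proof.
move=> /domain_bounds; set t := expi (tau / 2); set y := expi z => -[t1 y1 ty1].
pose ep : C := (- 1) ^+ super.
have ep2 : ep * ep = 1 by rewrite -expr2 sqrr_sign.
have t0 : t != 0 := expi_neq0 _; have y0 : y != 0 := expi_neq0 _.
have nep : nrm ep = 1 by rewrite nrmX nrmN nrm1 expr1n.
have ep0 : ep != 0 by rewrite -nrm_gt0 nep.
have q0 : t ^+ 2 != 0 by rewrite expf_neq0.
have tn := nrm_ge0 t.
have q1 : nrm (t ^+ 2) < 1 by rewrite nrmX exprn_ilt1.
have yV : nrm y^-1 < 1 by rewrite nrmV invf_lt1 // (lt_trans ltr01).
have ty1' : nrm (t * y^-1) < 1 by rewrite nrmM mulr_ilt1 // ?nrm_ge0.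
have w0 : ep * y != 0 by rewrite mulf_neq0.
have qw0 : t ^+ 2 * (ep * y) != 0 by rewrite mulf_neq0.
have v0 : - y ^+ 2 != 0 by rewrite oppr_eq0 expf_neq0.
have wV : nrm (ep * y)^-1 < 1 by rewrite invfM nrmM nrmV nep invr1 mul1r.
have [E [_ [_ E0 hE _]]] := euler_lims t1.
have [E' [_ [_ E'0 hE' _]]] := euler_lims q1.
have [B0 hB0] := jacobi_lims w0 q1.
have [B1 hB1] := jacobi_lims qw0 q1.
have [Bq hBq] := jacobi_lims v0 q1.
have qy : nrm (t ^+ 2 * y) < 1 by rewrite expr2 -mulrA nrmM mulr_ilt1 ?nrm_ge0.
have B0n : B0 != 0.
  apply: (jacobi_lims_neq0 w0 q1 _ _ hB0).
    by rewrite -mulrA nrmM nep mul1r mulrC.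
  by rewrite nrmM mulr_ilt1 ?nrm_ge0.
(* The factor at k = 0 contains 1 + (ep y)^-1, which vanishes at y = - ep; the condition |y| > 1
   excludes this. *)
have B1n : B1 != 0.
  apply: (jacobi_lims_neq0 qw0 q1 _ _ hB1).
    rewrite mulrC nrmM mulr_ilt1 ?nrm_ge0 // mulrCA nrmM nep mul1r //.
  by rewrite invfM mulrAC mulVf // mul1r.
have Bqn : Bq != 0.
  apply: (jacobi_lims_neq0 v0 q1 _ _ hBq).
    by rewrite mulNr nrmN -exprMn nrmX exprn_ilt1 ?nrm_ge0 // mulrC.
  by rewrite invrN mulNr nrmN nrmM mulr_ilt1 ?nrm_ge0 // -exprVn nrmX exprn_ilt1 ?nrm_ge0.
have hBt : lims (jacobi_prod t (t * (ep * y))) (B1 * B0).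
  have [l hl] := jacobi_lims (mulf_neq0 t0 w0) t1.
  have -> : B1 * B0 = l; last by [].
  apply: lims_unique (limsM hB1 hB0) _.
  have := lims_sub (f := double) (fun n => _) hl.
  move=> /(_ (fun n => ltac:(by rewrite -addnn leq_addr))).
  by apply: eq_lims => N; exact: jacobi_prod_double.
have th0 := jacobi_triple q0 w0 q1 hE' hB0.
have th1 := jacobi_triple q0 qw0 q1 hE' hB1.
have thq := jacobi_triple q0 v0 q1 hE' hBq.
have tht := jacobi_triple t0 (mulf_neq0 t0 w0) t1 hE hBt.
have tau2 : expi (2%:R * tau / 2) = t ^+ 2 by rewrite -expiMn; congr expi; field.
have T0 : theta 0 super (2%:R * tau) z = E' * B0 by apply: theta0E; rewrite tau2.
have T1 : theta 1 super (2%:R * tau) z =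
    expi (2%:R * tau / 8%:R + z / 2 + super%:R / 4%:R) * (E' * B1).
  by apply: theta1E; rewrite tau2 mulrCA.
have Tq : theta 0 true (2%:R * tau) (2%:R * z) = E' * Bq.
  by apply: theta0E; rewrite tau2 expr1 mulN1r expiMn.
have Tt : theta 1 super tau z = expi (tau / 8%:R + z / 2 + super%:R / 4%:R) * (E * (B1 * B0)).
  by apply: theta1E; rewrite mulrCA.
have et : eta tau = expi (tau / 24%:R) * E by apply: etaE.
have et2 : eta (2%:R * tau) = expi (2%:R * tau / 24%:R) * E' by apply: etaE; rewrite tau2.
have hTh : usum (theta_term (t ^+ 2) (t ^+ 2 ^+ j * (ep * y))) (E' * (if j then B1 else B0)).
  by case: (j); rewrite ?expr1 ?expr0 ?mul1r.
have := fock_character t0 y0 t1 ty1 ty1' ep2 hE hBq hTh.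
suff -> : t ^+ j * y ^+ j * (E' * (if j then B1 else B0)) ^+ 2 / (E ^+ 2 * Bq) =
  (- 1) ^+ (super && j) * theta_quotient j super tau z by [].
rewrite /theta_quotient Tt Tq et et2.
pose u := expi (tau / 24%:R).
have u0 : u != 0 := expi_neq0 _.
have e1 : expi (2%:R * tau / 24%:R) = u ^+ 2 by rewrite -expiMn; congr expi; field.
pose v := expi (z / 2 + super%:R / 4%:R).
have v0' : v != 0 := expi_neq0 _.
have e2 : expi (tau / 8%:R + z / 2 + super%:R / 4%:R) = u ^+ 3 * v.
  by rewrite -expiMn -expiD; congr expi; field.
have e3 : expi (2%:R * tau / 8%:R + z / 2 + super%:R / 4%:R) = u ^+ 6 * v.
  by rewrite -expiMn -expiD; congr expi; field.
have e4 : t = u ^+ 12 by rewrite -expiMn; congr expi; field.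
(* For the supercharacter the prefactor of theta_11 contains e^(pi i / 2), whose square is -1. Two
   such functions meet in the numerator when j = 1, whence the sign of that supercharacter. *)
have e5 : v ^+ 2 = ep * y.
  rewrite -expiMn /ep; case: (super) => /=; last by rewrite expr0 mul1r; congr expi; field.
  by rewrite expr1 -expi_half -expiD; congr expi; field.
have {}e5 : y = ep * v ^+ 2 by rewrite e5 mulrA ep2 mul1r.
rewrite e1 e2; case: (j); rewrite ?andbT ?andbF /= ?T1 ?T0 ?e3 ?expr0 ?expr1.
  rewrite -/ep -/u e4 e5; field.
  by rewrite E0 E'0 B0n Bqn u0.
rewrite -/u !mul1r; field.
by rewrite E0 E'0 B1n Bqn u0 v0'.
Qed.

Lemma big_fsetU_disjoint (I : choiceType) (M : nmodType) (A B : {fset I}) (F : I -> M) :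
  (forall i, i \in A -> i \in B -> false) ->
  \sum_(i <- (A `|` B)%fset) F i = \sum_(i <- A) F i + \sum_(i <- B) F i.
Proof.
move=> AB; rewrite -big_cat; apply: perm_big; apply: uniq_perm => //.
  rewrite cat_uniq !fset_uniq andbT /=; apply/hasPn => i iB; apply/negP => iA.
  by move: (AB i iA iB).
by move=> i; rewrite in_fsetU mem_cat.
Qed.

Definition fock_dims j p (w : C * C) : nat := #|` fiber j p w|.

Definition state_weight (x : state) : C * C := ((deg x)%:R / 2%:R - 8%:R^-1, (chg x)%:~R).

Lemma sum_fiber j p w (c : C) (F : state -> C) : (forall x, in_weight j p w x -> F x = c) ->
  \sum_(x <- fiber j p w) F x = (fock_dims j p w)%:R * c.
Proof.
move=> Fc; rewrite big_seq (eq_bigr (fun=> c)) => [|x /fiberP/Fc//].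
by rewrite -big_seq big_const_seq count_predT iter_addr_0 -[LHS]mulr_natl.
Qed.

Lemma usum_mult j super (g : C * C -> C) S :
  usum (fun x => if odd (num x) == j then g (state_weight x) * (- 1) ^+ super ^+ #|` x.2| else 0) S ->
  usum (fun w => mult super (fock_dims j) w * g w) S.
Proof.
set f := (X in usum X S) => hf; pose F (w : C * C) : {fset state} := (fiber j false w `|` fiber j true w)%fset.
have memF x w : x \in F w -> state_weight x = w /\ odd (num x) = j.
  rewrite in_fsetU; case: w => [w1 w2].
  by case/orP => /fiberP[xj _ /= w1E w2E]; split=> //; congr (_, _).
have Fw x w : x \in F w -> state_weight x = w by case/memF.
have fF x : f x != 0 -> x \in F (state_weight x).
  rewrite /f; case: (odd _ =P j) => [xj _|_]; last by rewrite eqxx.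
  rewrite in_fsetU; apply/orP; case xp: (odd #|` x.2|); [right|left]; apply/fiberP; split=> //.
apply: eq_usum (usum_fibers Fw fF hf) => w.
have fE p x : in_weight j p w x -> f x = g w * (- 1) ^+ (super && p).
  case=> xj xp w1 w2; rewrite /f xj eqxx; congr (g _ * _).
    by case: (w) w1 w2 => ? ? /= w1 w2; congr (_, _).
  by case: (super); rewrite /= ?expr1n // expr1 -signr_odd xp.
rewrite big_fsetU_disjoint => [|x /fiberP[_ xp _ _] /fiberP[_ xp' _ _]]; last first.
  by rewrite xp in xp'.
rewrite (sum_fiber (fE false)) (sum_fiber (fE true)) /mult andbF andbT expr0; ring.
Qed.

Lemma ch_eq_fock j super tau z : in_domain tau z ->
  forall V : ramond_module (cM R 2), weight_dims V (fock_dims j) ->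
  ch_eq V super tau z ((- 1) ^+ (super && j) * theta_quotient j super tau z).
Proof.
move=> /(fock_theta_character j super) h V hV; exists (fock_dims j) => //.
apply: usum_sums_to; apply: usum_mult.
apply: eq_usum h => x; case: ifP => // _; rewrite /state_weight /monomial /=; congr (_ * _).
rewrite -expiMn -expiMz cM2; congr (expi _ * expi _); first by field.
by rewrite mulrC.
Qed.

Lemma ch_coef_eq_fock j super (x0 z : C) (A : {fset state}) :
    (forall x, x \in A <-> odd (num x) = j /\ (deg x)%:R / 2%:R = x0) ->
  forall V : ramond_module (cM R 2), weight_dims V (fock_dims j) ->
  ch_coef_eq V super x0 z (\sum_(x <- A) expi z ^ chg x * (- 1) ^+ super ^+ #|` x.2|).
Proof.
move=> AP V hV; exists (fock_dims j) => //; apply: usum_sums_to.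
(* Since c/24 = -1/8 equals the vacuum energy, the power of q is exactly half the degree. Cutting
   [g] off at this one eigenvalue of L_0 makes [usum_mult] extract the coefficient. *)
pose x1 := x0 + cM R 2 / 24%:R; rewrite -/x1.
have x1E d : (d / 2 - 8%:R^-1 == x1) = (d / 2 == x0).
  rewrite /x1 cM2 (_ : - 3%:R / 24%:R = - 8%:R^-1 :> C); last by field.
  by rewrite (inj_eq (addIr _)).
pose g (w : C * C) := if w.1 == x1 then expi (z * w.2) else 0.
pose S := \sum_(x <- A) expi z ^ chg x * (- 1) ^+ super ^+ #|` x.2|.
have h : usum (fun x => if odd (num x) == j then g (state_weight x) * (- 1) ^+ super ^+ #|` x.2| else 0) S.
  rewrite /S big_seq; under eq_bigr => x xA.
    have -> : expi z ^ chg x * (- 1) ^+ super ^+ #|` x.2| =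
        if odd (num x) == j then g (state_weight x) * (- 1) ^+ super ^+ #|` x.2| else 0.
      have /AP[xj xd] := xA; rewrite xj eqxx /g /state_weight /= x1E xd eqxx.
      by rewrite -expiMz [_%:~R * z]mulrC.
    over.
  rewrite -big_seq; apply: usum_finite => x xA; case: eqP => // xj.
  rewrite /g /state_weight /= x1E; case: eqP => [xd|_]; last by rewrite mul0r.
  by case/negP: xA; apply/AP.
pose F (mu : C) : {fset C * C} := [fset (x1, mu)]%fset.
have Fp (i : C * C) mu : i \in F mu -> i.2 = mu by rewrite inE => /eqP->.
have xF (i : C * C) : mult super (fock_dims j) i * g i != 0 -> i \in F i.2.
  case: i => i1 i2; rewrite /g /F inE /= => h0; apply/eqP; congr (_, _).
  by apply/eqP; apply: contraNT h0 => /negPf->; rewrite mulr0.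
apply: eq_usum (usum_fibers Fp xF (usum_mult h)) => mu.
by rewrite /F big_seq_fset1 /g /= eqxx.
Qed.

End Characters.

(** * States of degree 0 and 1, and the leading terms *)

Section LeadingTerms.
Variable R : realType.
Local Notation C := R[i].
Implicit Types (x : state) (z : C) (super : bool).

Definition one_boson k : state := (inc vst.1 k, vst.2).
Definition one_fermion k : state := (vst.1, (k |` vst.2)%fset).

Definition deg1_states : {fset state} := 
  [fset x in [:: one_boson 0; one_boson 1; one_fermion 0; one_fermion 1]]%fset.

Lemma one_boson_stats k :
  [/\ deg (one_boson k) = (k./2).*2.+1, chg (one_boson k) = if odd k then 1 else -1
    & #|` (one_boson k).2| = 0%N].
Proof. by split; [rewrite deg_inc deg_vst addn0|rewrite chg_inc chg_vst addr0|exact: cardfs0]. Qed.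

Lemma one_fermion_stats k :
  [/\ deg (one_fermion k) = (k./2).*2.+1, chg (one_fermion k) = 0 & #|` (one_fermion k).2| = 1%N].
Proof.
have kv : k \notin vst.2 by rewrite in_fset0.
by rewrite deg_fsetU1 // deg_vst addn0 chg_fsetU1 // chg_vst /= fsetU0 cardfs1.
Qed.

Lemma deg_eq0 x : deg x = 0%N -> x = vst.
Proof.
by elim/state_ind: x => // [x k _|x k kx _]; rewrite ?deg_inc ?deg_fsetU1 // addSn.
Qed.

Lemma mem_seq4P (T : eqType) (a b c d x : T) :
  reflect [\/ x = a, x = b, x = c | x = d] (x \in [:: a; b; c; d]).
Proof.
by rewrite !inE; apply: (iffP or4P) => -[] => [/eqP->|/eqP->|/eqP->|/eqP->|->|->|->|->];
  rewrite ?eqxx; do ?[by constructor 1|by constructor 2|by constructor 3|by constructor 4].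
Qed.

Lemma deg_eq1 x : deg x = 1%N <-> x \in deg1_states.
Proof.
rewrite in_fset; split=> [dx|]; last first.
  case/mem_seq4P=> ->; [case: (one_boson_stats 0)|case: (one_boson_stats 1)|
    case: (one_fermion_stats 0)|case: (one_fermion_stats 1)] => //.
have [k k2 [->|->]] : exists2 k, (k < 2)%N & x = one_boson k \/ x = one_fermion k.
  elim/state_ind: x dx => [|x k _|x k kx _]; first by rewrite deg_vst.
    rewrite deg_inc addSn => -[] /eqP; rewrite addn_eq0 double_eq0 => /andP[k0 /eqP/deg_eq0->].
    by exists k; [move: k k0 => [|[|k]] // _|left].
  rewrite deg_fsetU1 // addSn => -[] /eqP; rewrite addn_eq0 double_eq0 => /andP[k0 /eqP/deg_eq0->].
  by exists k; [move: k k0 {kx} => [|[|k]] // _|right].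
- by apply/mem_seq4P; case: k k2 => [|[|k]] k2; [constructor 1|constructor 2|].
- by apply/mem_seq4P; case: k k2 => [|[|k]] k2; [constructor 3|constructor 4|].
Qed.

Lemma uniq_seq4 (T : eqType) (a b c d : T) :
  a != b -> a != c -> a != d -> b != c -> b != d -> c != d -> uniq [:: a; b; c; d].
Proof. by rewrite /= !inE !negb_or => -> -> -> -> -> ->. Qed.

Lemma sum_deg1_states (f : int -> nat -> C) :
  \sum_(x <- deg1_states) f (chg x) #|` x.2| = f (- 1) 0%N + f 1 0%N + f 0 1%N *+ 2.
Proof.
have [_ b0 b0'] := one_boson_stats 0; have [_ b1 b1'] := one_boson_stats 1.
have [_ f0 f0'] := one_fermion_stats 0; have [_ f1 f1'] := one_fermion_stats 1.
have bb : one_boson 0 != one_boson 1 by apply/eqP => /(congr1 chg); rewrite b0 b1.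
have bf k l : one_boson k != one_fermion l.
  apply/eqP => /(congr1 (fun x : state => #|` x.2|)).
  by case: (one_boson_stats k) => _ _ ->; case: (one_fermion_stats l) => _ _ ->.
have ff : one_fermion 0 != one_fermion 1.
  apply/eqP => /(congr1 (fun x : state => 0%N \in x.2)).
  by rewrite /= !in_fset1U.
rewrite sum_seq_fset; last exact: (uniq_seq4 bb (bf _ _) (bf _ _) (bf _ _) (bf _ _) ff).
by rewrite !big_cons big_nil addr0 b0 b1 f0 f1 b0' ?b1' f0' ?f1' mulr2n !addrA.
Qed.

(** At z = - i the modulus is e^(2 pi). *)
Lemma nrm_expi_witness : 1 < nrm (expi (0 +i* (- 1))%C : C).
Proof. by rewrite nrm_expi /= mulrN1 opprK expR_gt1 mulr_gt0 ?pi_gt0. Qed.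

Lemma leading_term_even (V : ramond_module (cM R 2)) super :
  weight_dims V (fock_dims false) -> leading_term V super (fun _ _ => 1).
Proof.
move=> hV; exists 0, (fun=> 1); split=> [tau z|z _||x x0 z _].
- by rewrite mulr0 expi0 mulr1.
- have := ch_coef_eq_fock super (x0 := 0) z (A := [fset vst]%fset) _ hV.
  rewrite big_seq_fset1 chg_vst expr0z cardfs0 mulr1; apply=> x.
  rewrite in_fset1; split=> [/eqP->|[_ /eqP]]; first by rewrite deg_vst mul0r /num stat_vst.
  by rewrite mulf_eq0 invr_eq0 !pnatr_eq0 orbF => /eqP/deg_eq0->.
- exists (0 +i* (- 1))%C; last exact: oner_neq0.
  by rewrite nrm_norm ltcR nrm_expi_witness.
- have := ch_coef_eq_fock super (x0 := x) z (A := fset0) _ hV.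
  rewrite big_seq_fset0; apply=> s; rewrite in_fset0; split=> // -[_ sx].
  by move: x0; rewrite -sx mulr_ge0 ?ler0n // invr_ge0 ler0n.
Qed.

Lemma leading_term_odd (V : ramond_module (cM R 2)) super :
  weight_dims V (fock_dims true) ->
  leading_term V super (fun tau z =>
    expi (tau * (1 / 2%:R)) * expi z * (1 + (- 1) ^+ super * expi (- z)) ^+ 2).
Proof.
move=> hV; exists (1 / 2%:R), (fun z => expi z * (1 + (- 1) ^+ super * expi (- z)) ^+ 2).
split=> [tau z|z _||x x0 z _].
- by rewrite mulrA.
- have := ch_coef_eq_fock super (x0 := 1 / 2%:R) z (A := deg1_states) _ hV.
  have y0 := expi_neq0 z.
  rewrite (sum_deg1_states (fun c n => expi z ^ c * (- 1) ^+ super ^+ n)) expr0 !mulr1 expr1.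
  rewrite expr0z expr1z exprN1 !mul1r expiN.
  (* The four states of degree 1 are one quantum of gamma^-, gamma^+, chi or chi^bar; the perfect
     square uses that the sign of a fermion squares to 1. *)
  have -> : (expi z)^-1 + expi z + (- 1) ^+ super *+ 2 =
            expi z * (1 + (- 1) ^+ super / expi z) ^+ 2 :> C.
    case: super; rewrite ?expr1 ?expr0; by field.
  apply=> x; rewrite -deg_eq1; split=> [dx|[_ /eqP]].
    by rewrite -odd_deg dx mul1r.
  by rewrite -subr_eq0 -[X in _ - X]mul1r -mulrBl mulf_eq0 invr_eq0 pnatr_eq0 orbF
    subr_eq0 pnatr_eq1 => /eqP.
- exists (0 +i* (- 1))%C.
    by rewrite nrm_norm ltcR nrm_expi_witness.
  have y1 := nrm_expi_witness; rewrite mulf_neq0 ?expi_neq0 // expf_neq0 // expiN addr_eq0.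
  apply/eqP => /(congr1 (@nrm R)); rewrite nrm1 nrmN nrmM nrmX nrmN nrm1 expr1n mul1r nrmV.
  by move=> e; move: y1; rewrite -[X in 1 < X]invrK -e invr1 ltxx.
- have := ch_coef_eq_fock super (x0 := x) z (A := fset0) _ hV.
  rewrite big_seq_fset0; apply=> s; rewrite in_fset0; split=> // -[so sx].
  move: x0; rewrite -sx ler_pM2r ?invr_gt0 ?ltr0n // ler1n.
  by case: (deg s) (odd_deg s) => //=; rewrite so.
Qed.
End LeadingTerms.

Theorem proposition10p2 (R : realType)
    (V0 V1 : ramond_module (cM R 2))
    (hV0 : irreducible_highest_weight V0 (hR R 2 0) (sR R 2 0))
    (hV1 : irreducible_highest_weight V1 (hR R 2 1) (sR R 2 1)) :
  [/\ cM R 2 = - 3%:R,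
      hR R 2 0 = - (1 / 8%:R) /\ sR R 2 0 = 0
    & hR R 2 1 = 3%:R / 8%:R /\ sR R 2 1 = 1] /\
  (forall tau z : R[i], in_domain tau z ->
    [/\ ch_eq V0 false tau z
          ((eta (2%:R * tau) / eta tau) ^+ 3 *
           (theta 0 0 (2%:R * tau) z * theta 1 0 tau z
            / (theta 1 0 (2%:R * tau) z * theta 0 1 (2%:R * tau) (2%:R * z)))),
        ch_eq V0 true tau z
          ((eta (2%:R * tau) / eta tau) ^+ 3 *
           (theta 0 1 (2%:R * tau) z * theta 1 1 tau z
            / (theta 1 1 (2%:R * tau) z * theta 0 1 (2%:R * tau) (2%:R * z)))),
        ch_eq V1 false tau z
          ((eta (2%:R * tau) / eta tau) ^+ 3 *
           (theta 1 0 (2%:R * tau) z * theta 1 0 tau z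
            / (theta 0 0 (2%:R * tau) z * theta 0 1 (2%:R * tau) (2%:R * z))))
      & ch_eq V1 true tau z
          (- (eta (2%:R * tau) / eta tau) ^+ 3 *
           (theta 1 1 (2%:R * tau) z * theta 1 1 tau z
            / (theta 0 1 (2%:R * tau) z * theta 0 1 (2%:R * tau) (2%:R * z))))]) /\
  (forall super : bool,
    [/\ leading_term V0 super (fun _ _ => 1),
        forall tau z : R[i],
          1 = expi (tau * (- (1 / 24%:R * cM R 2) + hR R 2 0))
              * expi (sR R 2 0 * z),
        leading_term V1 super (fun tau z =>
          expi (tau * (1 / 2%:R)) * expi z
            * (1 + (- 1) ^+ super * expi (- z)) ^+ 2)
      & forall tau z : R[i],
          expi (tau * (1 / 2%:R)) * expi z
            * (1 + (- 1) ^+ super * expi (- z)) ^+ 2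
          = expi (tau * (- (1 / 24%:R * cM R 2) + hR R 2 1))
            * expi (sR R 2 1 * z) * (1 + (- 1) ^+ super * expi (- z)) ^+ 2]).
Proof.
have d0 := irreducible_weight_dims (j := false) hV0.
have d1 := irreducible_weight_dims (j := true) hV1.
have h0 : hR R 2 0 = - (1 / 8%:R) by rewrite /hR; field.
have h1 : hR R 2 1 = 3%:R / 8%:R by rewrite /hR; field.
have s0 : sR R 2 0 = 0 by rewrite /sR mulr0 mul0r.
have s1 : sR R 2 1 = 1 by rewrite /sR mulr1 divff ?pnatr_eq0.
split; first by split; first exact: cM2.
split=> [tau z dom|super].
  have e0 s := ch_eq_fock s dom d0; have e1 s := ch_eq_fock s dom d1.
  split.
  - by have := e0 false; rewrite mul1r.
  - by have := e0 true; rewrite mul1r.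
  - by have := e1 false; rewrite mul1r.
  - by have := e1 true; rewrite expr1 mulN1r -mulNr.
have c0 : - (1 / 24%:R * cM R 2) + hR R 2 0 = 0 by rewrite h0 cM2; field.
have c1 : - (1 / 24%:R * cM R 2) + hR R 2 1 = 1 / 2%:R by rewrite h1 cM2; field.
split=> [|tau z||tau z].
- exact: leading_term_even d0.
- by rewrite c0 s0 mulr0 mul0r expi0 mulr1.
- exact: leading_term_odd d1.
- by rewrite c1 s1 [1 * z]mul1r.
Qed.
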